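(* Let $p\ge 1$, $L\in\mathbb{N}\setminus\{0\}$ and $(g,G_1,\dots,G_L)\in SD_{L,p}(\Omega)$. Then there exists a (multi-indexed) sequence $(n_1,\dots,n_L)\mapsto u_{n_1,\dots,n_L}\in SBV(\Omega;\mathbb{R}^d)$ converging to $(g,G_1,\dots,G_L)$ in the sense of $SD_{L,p}(\Omega)$.
   Context: $\Omega\subset\mathbb{R}^N$ is a bounded, connected open set with Lipschitz boundary. $SBV(\Omega;\mathbb{R}^d)$ is the space of special functions of bounded variation; for $u\in SBV$, $\nabla u$ denotes the density of the absolutely continuous part of $Du$ with respect to Lebesgue measure. $\mathcal{M}(\Omega;\mathbb{R}^{d\times N})$ is the space of (finite) matrix-valued Radon measures; an $L^1$ function is identified with the measure having it as Lebesgue density. For $L\in\mathbb{N}\setminus\{0\}$ and $p\ge1$, $$SD_{L,p}(\Omega):=SBV(\Omega;\mathbb{R}^d)\times \underbrace{L^1(\Omega;\mathbb{R}^{d\times N})\times\cdots\times L^1(\Omega;\mathbb{R}^{d\times N})}_{(L-1)\text{ times}}\times L^p(\Omega;\mathbb{R}^{d\times N}).$$ A multi-indexed sequence $\mathbb{N}^L\ni(n_1,\dots,n_L)\mapsto u_{n_1,\dots,n_L}\in SBV(\Omega;\mathbb{R}^d)$ converges in the sense of $SD_{L,p}(\Omega)$ to $(g,G_1,\dots,G_L)\in SD_{L,p}(\Omega)$ if: (i) $\lim_{n_1}\cdots\lim_{n_L}u_{n_1,\dots,n_L}=g$, each of the iterated limits being in the sense of $L^1(\Omega;\mathbb{R}^d)$;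 (ii) for all $\ell=1,\dots,L-1$ there exists a sequence $\mathbb{N}^\ell\ni(n_1,\dots,n_\ell)\mapsto g_{n_1,\dots,n_\ell}\in SBV(\Omega;\mathbb{R}^d)$ such that $\lim_{n_{\ell+1}}\cdots\lim_{n_L}u_{n_1,\dots,n_L}=g_{n_1,\dots,n_\ell}$, with each iterated limit in $L^1(\Omega;\mathbb{R}^d)$, and $\lim_{n_1}\cdots\lim_{n_\ell}\nabla g_{n_1,\dots,n_\ell}=G_\ell$, with each iterated limit in the sense of weak* convergence in $\mathcal{M}(\Omega;\mathbb{R}^{d\times N})$ (this condition is void if $L=1$); (iii) $\lim_{n_1}\cdots\lim_{n_L}\nabla u_{n_1,\dots,n_L}=G_L$, with each iterated limit in the sense of weak* convergence in $\mathcal{M}(\Omega;\mathbb{R}^{d\times N})$. *)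

(* Defs.v *)
From HB Require Import structures.
From mathcomp Require Import all_boot all_order all_algebra.
From mathcomp Require Import all_classical all_reals all_analysis.

Set Implicit Arguments.
Unset Strict Implicit.
Unset Printing Implicit Defensive.

Import Order.TTheory GRing.Theory Num.Theory.
Import numFieldNormedType.Exports.

Local Open Scope classical_set_scope.
Local Open Scope ring_scope.

Definition mx_display : measure_display.
Proof. exact: default_measure_display. Qed.

(* 'M[R]_(m, n) is equipped with its Borel sigma-algebra. *)
Section borel_matrix.
Variables (R : realType) (m n : nat).

Let mx_borel : set (set 'M[R]_(m, n)) := <<s @open 'M[R]_(m, n) >>.

Let mx_borelC A : mx_borel A -> mx_borel (~` A).
Proof. exact: sigma_algebraC. Qed.

HB.instance Definition _ := @isMeasurable.Build mx_display 'M[R]_(m, n)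
  mx_borel (@sigma_algebra0 _ setT _) mx_borelC (@sigma_algebra_bigcup _ setT _).

End borel_matrix.

Section borel_matrix_theory.
Variable R : realType.

Lemma open_mx_rat_box m n (U : set 'M[R]_(m, n)) M : open U -> U M ->
  exists a b : 'M[rat]_(m, n),
    (forall i j, ratr (a i j) < M i j < ratr (b i j)) /\
    [set Z : 'M[R]_(m, n) |
      forall i j, ratr (a i j) < Z i j < ratr (b i j)] `<=` U.
Proof.
move=> oU UM; have /nbhs_ballP[e /= e0 eU] : nbhs M U by exact: open_nbhs_nbhs.
have ha (x : R) : {q : rat | x - e < ratr q < x}.
  apply/cid; have /rat_in_itvoo[q] : x - e < x by rewrite ltrBlDr ltrDl.
  by rewrite in_itv/= => ?; exists q.
have hb (x : R) : {q : rat | x < ratr q < x + e}.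
  apply/cid; have /rat_in_itvoo[q] : x < x + e by rewrite ltrDl.
  by rewrite in_itv/= => ?; exists q.
pose a := \matrix_(i, j) sval (ha (M i j)).
pose b := \matrix_(i, j) sval (hb (M i j)).
have aP i j : M i j - e < ratr (a i j) < M i j by rewrite mxE; exact: (svalP (ha _)).
have bP i j : M i j < ratr (b i j) < M i j + e by rewrite mxE; exact: (svalP (hb _)).
exists a, b; split=> [i j|Z /= HZ].
  by have /andP[_ ->] := aP i j; have /andP[-> _] := bP i j.
apply: eU; split => // i j.
have /andP[q1 q2] := HZ i j.
have /andP[a1 _] := aP i j; have /andP[_ b2] := bP i j.
rewrite /ball/= ltr_distlC; apply/andP; split.
  exact: lt_trans q1.
exact: lt_trans b2.
Qed.

Lemma measurable_fun_mx d (T : measurableType d) m n (f : T -> 'M[R]_(m, n)) :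
  (forall i j, measurable_fun setT (fun x => f x i j)) -> measurable_fun setT f.
Proof.
move=> mf; apply: (measurability (@open 'M[R]_(m, n))) => //.
move=> _ [U oU <-]; rewrite setTI.
pose F (ab : 'M[rat]_(m, n) * 'M[rat]_(m, n)) :=
  [set Z : 'M[R]_(m, n) | forall i j, ratr (ab.1 i j) < Z i j < ratr (ab.2 i j)].
rewrite (_ : f @^-1` U = \bigcup_ab
  (if pselect (F ab `<=` U) then f @^-1` F ab else set0)); last first.
  apply/seteqP; split => [x /= Ux|x [ab _]].
    have [a [b [abx abU]]] := open_mx_rat_box oU Ux.
    by exists (a, b) => //; case: pselect.
  by case: pselect => // FU /FU.
apply: countable_bigcupT_measurable; first exact: countableP.
move=> [a b]; case: pselect => Fab; last exact: measurable0.
rewrite (_ : _ @^-1` _ = \bigcap_(ij : 'I_m * 'I_n)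
  ((fun x => f x ij.1 ij.2) @^-1` `]ratr (a ij.1 ij.2), ratr (b ij.1 ij.2)[));
  last first.
  apply/seteqP; split => [x /= H [i j] _ /=|x /= H i j].
    by rewrite in_itv/=; exact: H.
  by have := H (i, j) I; rewrite /= in_itv.
apply: fin_bigcap_measurable => // -[i j] _.
by rewrite -[X in measurable X]setTI; apply: mf.
Qed.

Lemma measurable_coord m n i j :
  measurable_fun setT (fun M : 'M[R]_(m, n) => M i j).
Proof.
apply: (measurability _ (measurable_realfun.RGenOpens.measurableE R)).
move=> _ [_ [a [b ->] <-]]; rewrite setTI; apply: sub_sigma_algebra.
apply: open_comp; last exact: interval_open.
by move=> M _; exact: coord_continuous.
Qed.

End borel_matrix_theory.

Section lebesgue_rV.
Variable R : realType.

Definition rV_cons n (p : measurableTypeR R * 'rV[R]_n) : 'rV[R]_n.+1 :=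
  row_mx (const_mx p.1 : 'rV_1) p.2.

Definition rV_uncons n (v : 'rV[R]_n.+1) : measurableTypeR R * 'rV[R]_n :=
  (v 0 0, @rsubmx _ 1 1 n v).

Lemma rV_consK n : cancel (@rV_cons n) (@rV_uncons n).
Proof.
move=> [x v]; rewrite /rV_uncons/rV_cons/= row_mxKr; congr pair.
rewrite (_ : 0 = lshift n (0 : 'I_1) :> 'I_n.+1); last exact/val_inj.
by rewrite (@row_mxEl _ 1 1 n) mxE.
Qed.

Lemma measurable_rV_cons n : measurable_fun setT (@rV_cons n).
Proof.
apply: measurable_fun_mx => i j; rewrite /rV_cons.
case: (@fintype.splitP 1 n j) => k jk.
  rewrite (_ : j = lshift n k); last exact/val_inj.
  under [X in measurable_fun _ X]eq_fun do rewrite (@row_mxEl _ 1 1 n) mxE.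
  exact: measurable_fst.
rewrite (_ : j = rshift 1 k); last exact/val_inj.
under [X in measurable_fun _ X]eq_fun do rewrite (@row_mxEr _ 1 1 n).
apply: (@measurableT_comp _ _ _ _ _ _ (fun v : 'rV[R]_n => v i k)).
  exact: measurable_coord.
exact: measurable_snd.
Qed.

Lemma measurable_rV_uncons n : measurable_fun setT (@rV_uncons n).
Proof.
apply/measurable_fun_pairP; split; first exact: measurable_coord.
apply: measurable_fun_mx => i j /=.
under [X in measurable_fun _ X]eq_fun do rewrite mxE.
exact: measurable_coord.
Qed.

Section step.
Variables (n : nat) (mu : {sigma_finite_measure set 'rV[R]_n -> \bar R}).

(* the product of the Lebesgue measure on R and mu, on R^(n + 1) = R x R^n *)
Definition lebesgue_step : set 'rV[R]_n.+1 -> \bar R :=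
  pushforward (@lebesgue_measure R \x mu)%E (@rV_cons n).

Let lebesgue_step0 : lebesgue_step set0 = 0%E.
Proof. by rewrite /lebesgue_step /pushforward preimage_set0 measure0. Qed.

Let lebesgue_step_ge0 A : (0 <= lebesgue_step A)%E.
Proof. by rewrite /lebesgue_step /pushforward measure_ge0. Qed.

Let lebesgue_step_sigma_additive : semi_sigma_additive lebesgue_step.
Proof.
have mc (A : set 'rV[R]_n.+1) : measurable A -> measurable (@rV_cons n @^-1` A).
  by move=> mA; rewrite -[X in measurable X]setTI; exact: measurable_rV_cons.
move=> F mF tF mUF; rewrite /lebesgue_step /pushforward preimage_bigcup.
apply: measure_semi_sigma_additive.
- by move=> k; exact: mc.
- apply/trivIsetP => /= i j _ _ ij; rewrite -preimage_setI.
  by move/trivIsetP : tF => /(_ _ _ _ _ ij) ->//; rewrite preimage_set0.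
- by rewrite -preimage_bigcup; exact: mc.
Qed.

HB.instance Definition _ := isMeasure.Build _ _ _ lebesgue_step
  lebesgue_step0 lebesgue_step_ge0 lebesgue_step_sigma_additive.

Let lebesgue_step_sigma_finite : sigma_finite setT lebesgue_step.
Proof.
have /sigma_finiteP[F [TF ndF Foo]] := sigma_finiteT (@lebesgue_measure R).
have /sigma_finiteP[G [TG ndG Goo]] := sigma_finiteT mu.
exists (fun k => @rV_uncons n @^-1` (F k `*` G k)).
  apply/seteqP; split => // v _.
  have [i _ Fi] : (\bigcup_k F k) (v 0 0) by rewrite -TF.
  have [j _ Gj] : (\bigcup_k G k) (@rsubmx _ 1 1 n v) by rewrite -TG.
  exists (maxn i j) => //; split => /=.
    by move: Fi; exact/subsetPset/ndF/leq_maxl.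
  by move: Gj; exact/subsetPset/ndG/leq_maxr.
move=> k; have [mF Fkoo] := Foo k; have [mG Gkoo] := Goo k; split.
  rewrite -[X in measurable X]setTI; apply: measurable_rV_uncons => //.
  exact: measurableX.
rewrite /lebesgue_step /pushforward -comp_preimage.
rewrite (_ : _ \o _ = id); last by apply/funext => p /=; rewrite rV_consK.
by rewrite preimage_id product_measure1E// lte_mul_pinfty// ge0_fin_numE.
Qed.

HB.instance Definition _ := Measure_isSigmaFinite.Build _ _ _ lebesgue_step
  lebesgue_step_sigma_finite.

End step.

Fixpoint lebesgue_rV (n : nat) : {sigma_finite_measure set 'rV[R]_n -> \bar R} :=
  match n return {sigma_finite_measure set 'rV[R]_n -> \bar R} with
  | 0 => \d_(0 : 'rV[R]_0)
  | n'.+1 => lebesgue_step (lebesgue_rV n')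
  end.

End lebesgue_rV.

Lemma lebesgue_rV_box (R : realType) n (a b : 'rV[R]_n) : (forall j, a 0 j <= b 0 j) ->
  lebesgue_rV R n [set x | forall j, x 0 j \in `[a 0 j, b 0 j]] =
    (\prod_(j < n) (b 0 j - a 0 j))%:E.
Proof.
elim: n a b => [|n IH] a b ab.
  rewrite big_ord0 /= diracE mem_set//; by case.
rewrite big_ord_recl.
pose A := [set x : 'rV[R]_n |
  forall j, x 0 j \in `[@rsubmx _ 1 1 n a 0 j, @rsubmx _ 1 1 n b 0 j]].
have mA : measurable A.
  rewrite (_ : A = \bigcap_(j : 'I_n) ((fun x : 'rV[R]_n => x 0 j) @^-1`
      `[@rsubmx _ 1 1 n a 0 j, @rsubmx _ 1 1 n b 0 j])).
    apply: fin_bigcap_measurable => // j _.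
    by rewrite -[X in measurable X]setTI; apply: measurable_coord.
  by apply/seteqP; split => [x /= H j _|x /= H j]; [exact: H|exact: (H j I)].
transitivity ((@lebesgue_measure R \x lebesgue_rV R n)%E
    (`[a 0 0, b 0 0]%classic `*` A)).
  congr (product_measure1 _ _ _).
  apply/seteqP; split=> [[x v] /= H|[x v] /= [H1 H2] j].
    split.
      have := H 0; rewrite /rV_cons/=.
      rewrite (_ : 0 = lshift n (0 : 'I_1) :> 'I_n.+1); last exact/val_inj.
      by rewrite (@row_mxEl _ 1 1 n) mxE.
    move=> j; have := H (rshift 1 j); rewrite /rV_cons/= (@row_mxEr _ 1 1 n).
    by rewrite !mxE.
  rewrite /rV_cons /=.
  case: (@fintype.splitP 1 n j) => k jk.
    rewrite (_ : j = lshift n k); last exact/val_inj.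
    rewrite (@row_mxEl _ 1 1 n) mxE/=.
    by rewrite (_ : lshift n k = 0) //; apply/val_inj => /=; case: k {jk} => -[].
  rewrite (_ : j = rshift 1 k); last exact/val_inj.
  by rewrite (@row_mxEr _ 1 1 n); have := H2 k; rewrite !mxE.
rewrite product_measure1E//.
rewrite /A IH; last by move=> j; rewrite !mxE; exact: ab.
rewrite EFinM; congr mule.
  rewrite [LHS](lebesgue_measure_itv `[a 0 0, b 0 0])/= lte_fin.
  case: ltP => // ba0.
  by rewrite (@le_anti _ _ (a 0 0) (b 0 0)) ?subrr// ab.
congr (_ %:E); apply: eq_bigr => j _; rewrite !mxE.
by rewrite (_ : rshift 1 j = lift ord0 j)//; exact/val_inj.
Qed.

Section euclidean.
Variable R : realType.

(* Euclidean norm on vectors, Frobenius norm on matrices; the library's norm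
   `|x| on 'M[R]_(m, n) is the (equivalent) sup norm. *)
Definition enorm m n (A : 'M[R]_(m, n)) : R :=
  Num.sqrt (\sum_i \sum_j A i j ^+ 2).

Definition dotv n (x y : 'rV[R]_n) : R := \sum_j x 0 j * y 0 j.

Definition eball n (x : 'rV[R]_n) (r : R) : set 'rV[R]_n :=
  [set y | enorm (y - x) < r].

(* Around each boundary point, in the orthonormal coordinates whose last axis
   is nu, Omega is the part of a ball lying strictly above the graph of a
   Lipschitz function of the first N - 1 coordinates. These coordinates are
   encoded by the orthogonal projection y - <y, nu> nu on the hyperplane
   nu^\perp. *)
Definition lipschitz_boundary N (Omega : set 'rV[R]_N) : Prop :=
  forall x, (closure Omega `\` Omega°) x ->
  exists (r k : R) (nu : 'rV[R]_N) (gamma : 'rV[R]_N -> R),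
    [/\ 0 < r, enorm nu = 1,
        (forall y z, `|gamma y - gamma z| <= k * enorm (y - z)) &
        (forall y, eball x r y ->
          (Omega y <-> gamma (y - dotv y nu *: nu) < dotv y nu))].

End euclidean.

Section function_spaces.
Variables (R : realType) (N : nat).
Implicit Types Omega : set 'rV[R]_N.

Local Notation leb := (lebesgue_rV R N).

Definition L1 Omega m n (F : 'rV[R]_N -> 'M[R]_(m, n)) : Prop :=
  forall i j, leb.-integrable Omega (fun x => (F x i j)%:E).

Definition Lp Omega (p : R) m n (F : 'rV[R]_N -> 'M[R]_(m, n)) : Prop :=
  (forall i j, measurable_fun Omega (fun x => F x i j)) /\
  (\int[leb]_(x in Omega) (enorm (F x) `^ p)%:E < +oo)%E.

Definition L1_cvg Omega m n (F_ : nat -> 'rV[R]_N -> 'M[R]_(m, n))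
    (F : 'rV[R]_N -> 'M[R]_(m, n)) : Prop :=
  [/\ forall k, L1 Omega (F_ k), L1 Omega F &
      (\int[leb]_(x in Omega) (enorm (F_ k x - F x))%:E)%E @[k --> \oo] --> 0%E].

(* C^1_c(Omega) *)
Definition C1c Omega (phi : 'rV[R]_N -> R) : Prop :=
  [/\ forall x, differentiable phi x,
      forall j, continuous (fun x => 'D_(delta_mx 0 j : 'rV[R]_N) phi x) &
      exists K, [/\ compact K, K `<=` Omega & forall x, ~ K x -> phi x = 0]].

(* C_0(Omega), the closure of C_c(Omega) for uniform convergence *)
Definition C0 Omega (phi : 'rV[R]_N -> R) : Prop :=
  {within Omega, continuous phi} /\
  forall e, 0 < e -> exists K,
    [/\ compact K, K `<=` Omega & forall x, Omega x -> ~ K x -> `|phi x| <= e].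

End function_spaces.

Section measures.
Variables (R : realType) (N : nat).
Implicit Types Omega : set 'rV[R]_N.

Local Notation leb := (lebesgue_rV R N).
Local Notation charge_rV := ({charge set 'rV[R]_N -> \bar R}).

(* \int_Omega phi dnu for a signed measure nu, via its Jordan decomposition *)
Definition cintegral Omega (nu : charge_rV) (phi : 'rV[R]_N -> R) : R :=
  let P := cid (Hahn_decomposition nu) in
  let nuPN := svalP (cid (svalP P)) in
  \int[jordan_pos nuPN]_(x in Omega) phi x -
  \int[jordan_neg nuPN]_(x in Omega) phi x.

(* M(Omega; R^(m x n)): matrices of finite signed Borel measures; only their
   values on Borel subsets of Omega are ever used. *)
Definition mxmeasure m n := 'I_m -> 'I_n -> charge_rV.

Definition weakstar_cvg Omega m n (mu_ : nat -> mxmeasure m n)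
    (mu : mxmeasure m n) : Prop :=
  forall phi, C0 Omega phi -> forall i j,
    cintegral Omega (mu_ k i j) phi @[k --> \oo] --> cintegral Omega (mu i j) phi.

(* the measure f dx on Omega (the junk value 0 is taken when f is not
   integrable on Omega) *)
Definition charge_of_fun Omega (f : 'rV[R]_N -> R) : charge_rV :=
  match pselect (leb.-integrable setT (EFin \o (f \_ Omega))) with
  | left intf => induced_charge intf
  | right _ => czero
  end.

Definition mxmeasure_of_fun Omega m n (F : 'rV[R]_N -> 'M[R]_(m, n)) :
    mxmeasure m n :=
  fun i j => charge_of_fun Omega (fun x => F x i j).

End measures.

Section SBV.
Variables (R : realType) (N d : nat).
Implicit Types (Omega : set 'rV[R]_N) (u : 'rV[R]_N -> 'cV[R]_d).
Implicit Types (G : 'rV[R]_N -> 'M[R]_(d, N)) (Du Ds : mxmeasure R N d N).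

Local Notation leb := (lebesgue_rV R N).

Definition distr_derivative Omega u Du : Prop :=
  forall phi, C1c Omega phi -> forall i j,
    \int[leb]_(x in Omega) (u x i 0 * 'D_(delta_mx 0 j : 'rV[R]_N) phi x) =
    - cintegral Omega (Du i j) phi.

Definition BV Omega u : Prop :=
  L1 Omega u /\ exists Du, distr_derivative Omega u Du.

(* Du = G dx + Ds on Omega, with Ds concentrated on a Lebesgue-null set *)
Definition lebesgue_decomposition Omega Du G Ds : Prop :=
  [/\ L1 Omega G,
      (exists Z : set 'rV[R]_N, [/\ measurable Z, leb Z = 0%E &
        forall A, measurable A -> A `<=` Omega `\` Z ->
          forall i j, Ds i j A = 0%E]) &
      forall A, measurable A -> A `<=` Omega -> forall i j,
        Du i j A = (\int[leb]_(x in A) (G x i j)%:E + Ds i j A)%E].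

Definition approx_limit u (x : 'rV[R]_N) (z : 'cV[R]_d) : Prop :=
  (((fine (leb (eball x r)))^-1)%:E *
     \int[leb]_(y in eball x r) (enorm (u y - z))%:E)%E @[r --> 0^'+] --> 0%E.

(* the approximate discontinuity set S_u *)
Definition approx_disc_set Omega u : set 'rV[R]_N :=
  [set x | Omega x /\ ~ exists z, approx_limit u x z].

(* the Cantor part of Du, i.e. the restriction of the singular part Ds to
   Omega \ S_u, vanishes *)
Definition SBV Omega u : Prop :=
  BV Omega u /\
  exists Du G Ds, [/\ distr_derivative Omega u Du,
    lebesgue_decomposition Omega Du G Ds &
    forall A, measurable A -> A `<=` Omega `\` approx_disc_set Omega u ->
      forall i j, Ds i j A = 0%E].

(* \nabla u, the density of the absolutely continuous part of Du; it is unique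
   up to Lebesgue-null sets *)
Definition nabla Omega u : 'rV[R]_N -> 'M[R]_(d, N) :=
  xget (fun=> 0) [set G | exists Du Ds,
    distr_derivative Omega u Du /\ lebesgue_decomposition Omega Du G Ds].

End SBV.

(* lim_(n_1) ... lim_(n_k) u [:: n_1; ...; n_k] = l, where cvg v l is the
   notion of convergence of a sequence v to l; each of the inner limits
   v n_1 = lim_(n_2) ... lim_(n_k) u [:: n_1; ...; n_k] is required to exist *)
Fixpoint iter_lim (T : Type) (cvg : (nat -> T) -> T -> Prop) (k : nat)
    (u : seq nat -> T) (l : T) : Prop :=
  match k with
  | 0 => u [::] = l
  | k'.+1 => exists v : nat -> T,
      cvg v l /\ forall n, iter_lim cvg k' (fun s => u (n :: s)) (v n)
  end.

Section structured_deformations.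
Variables (R : realType) (N d L : nat) (Omega : set 'rV[R]_N).

(* (g, G_1, ..., G_L) \in SD_(L,p)(Omega); G_(l + 1) is encoded as G l, for
   l : 'I_L *)
Definition SD (p : R) (g : 'rV[R]_N -> 'cV[R]_d)
    (G : 'I_L -> 'rV[R]_N -> 'M[R]_(d, N)) : Prop :=
  [/\ SBV Omega g,
      forall l : 'I_L, (l.+1 < L)%N -> L1 Omega (G l) &
      forall l : 'I_L, l.+1 = L -> Lp Omega p (G l)].

(* A sequence indexed by N^l is encoded as a function on seq nat, of which only
   the values on lists of length l are relevant. *)
Definition SD_cvg (u : seq nat -> 'rV[R]_N -> 'cV[R]_d)
    (g : 'rV[R]_N -> 'cV[R]_d) (G : 'I_L -> 'rV[R]_N -> 'M[R]_(d, N)) : Prop :=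
  [/\ iter_lim (@L1_cvg R N Omega d 1) L u g,
      forall l : 'I_L, (l.+1 < L)%N ->
        exists gl : seq nat -> 'rV[R]_N -> 'cV[R]_d,
        [/\ forall s, size s = l.+1 -> SBV Omega (gl s),
            forall s, size s = l.+1 ->
              iter_lim (@L1_cvg R N Omega d 1) (L - l.+1)
                (fun t => u (s ++ t)) (gl s) &
            iter_lim (@weakstar_cvg R N Omega d N) l.+1
              (fun s => mxmeasure_of_fun Omega (nabla Omega (gl s)))
              (mxmeasure_of_fun Omega (G l))] &
      forall l : 'I_L, l.+1 = L ->
        iter_lim (@weakstar_cvg R N Omega d N) L
          (fun s => mxmeasure_of_fun Omega (nabla Omega (u s)))
          (mxmeasure_of_fun Omega (G l))].

End structured_deformations.

(* Main.v *)
Require Import Defs.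
From mathcomp Require Import all_boot all_order all_algebra finmap.
From mathcomp Require Import all_classical all_reals all_analysis measurable_realfun.
From mathcomp Require Import ring lra.

Set Implicit Arguments.
Unset Strict Implicit.
Unset Printing Implicit Defensive.

Import Order.TTheory GRing.Theory Num.Theory.
Import numFieldNormedType.Exports.

Local Open Scope classical_set_scope.
Local Open Scope ring_scope.

(* One step, which replaces Alberti's theorem: given g in SBV, H in L^1 and e > 0,
   there is u in SBV with |u - g|_1 <= e and |nabla u - H|_1 <= e. By density of
   simple functions, each entry of H - nabla g is approximated by combinations of
   indicators of boxes. The indicator of a box of small width h in the direction j
   is, up to a jump part carried by finitely many hyperplanes, the gradient of a
   function which is affine on the box with values in [0, h]; summing these gives
   a small correction w. The function u is g + w + c v, where v is a sum of
   Heaviside functions jumping across all the hyperplanes used. Off these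
   hyperplanes w + c v is continuous and creates no Cantor part. A point of the
   hyperplanes is an approximate continuity point of u for at most one c, since v
   jumps there; a finite measure charges only countably many members of a disjoint
   family, so u is in SBV for all but countably many c.
   Iterating the step from g, with target G_1 and e = 1/(n_1 + 1), then G_2 and
   e = 1/(n_2 + 1), and so on, each of the iterated limits of gradients is that of
   a constant sequence except the one where G_l is introduced. *)

(** * Integrals against signed measures *)

(** The parameter c is what lets membership in SBV be checked from the definition. On the
    hyperplanes the jump of w may cancel that of g, so g + w could be approximately continuous at
    points charged by the singular part of its derivative. Ruling this out directly would call for
    traces and the structure of jump sets of BV functions; a generic c replaces that theory by a
    counting argument. All Heaviside functions in v jump upwards, so that they cannot cancel at a
    point lying on several hyperplanes.

    Small values and a prescribed gradient are compatible because jumps cost nothing: the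
    convergences only see u in L^1 and the absolutely continuous part of Du, and the mass of the
    jump part is never estimated.

    [nabla] is selected by choice among the densities coming from any measure that represents the
    derivative. An explicit gradient can replace it only once C^1_c test functions are known to
    determine a signed measure on Omega. *)

Section integrable_real.
Context d (T : measurableType d) (R : realType).
Variables (mu : {measure set T -> \bar R}) (D : set T).
Hypothesis mD : measurable D.
Implicit Types f g : T -> R.
Local Notation integrableR f := (mu.-integrable D (EFin \o f)).

Lemma integrableRD f g : integrableR f -> integrableR g ->
  integrableR (fun x => f x + g x).
Proof.
move=> intf intg; rewrite (_ : EFin \o _ = (EFin \o f) \+ (EFin \o g))%E.
  exact: integrableD.
by apply/funext => x /=; rewrite EFinD.
Qed.

Lemma integrableRB f g : integrableR f -> integrableR g ->
  integrableR (fun x => f x - g x).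
Proof.
move=> intf intg; rewrite (_ : EFin \o _ = (EFin \o f) \- (EFin \o g))%E.
  exact: integrableB.
by apply/funext => x /=; rewrite EFinB.
Qed.

Lemma integrableRZ r f : integrableR f -> integrableR (fun x => r * f x).
Proof.
move=> intf; rewrite (_ : EFin \o _ = (fun x => r%:E * (EFin \o f) x))%E.
  exact: integrableZl.
by apply/funext => x /=; rewrite EFinM.
Qed.

Lemma integrableR_sum (I : Type) (s : seq I) (f : I -> T -> R) :
  (forall i, integrableR (f i)) -> integrableR (fun x => \sum_(i <- s) f i x).
Proof.
move=> intf; elim: s => [|i s IHs].
  under [X in EFin \o X]eq_fun do rewrite big_nil.
  exact: integrable0.
under [X in EFin \o X]eq_fun do rewrite big_cons.
exact: integrableRD.
Qed.

End integrable_real.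

Section bounded_measurable.
Context d (T : measurableType d) (R : realType).
Implicit Types (D : set T) (phi psi : T -> R).

(** A common class for C^1_c functions, their derivatives and C_0 functions: its members are
    integrable against every finite measure and multiply L^1 into L^1. *)
Definition bounded_measurable D phi :=
  measurable_fun D phi /\ exists M, forall x, D x -> `|phi x| <= M.

Lemma bounded_measurable_integrable D (mu : {measure set T -> \bar R}) phi :
  measurable D -> (mu D < +oo)%E ->
  bounded_measurable D phi -> mu.-integrable D (EFin \o phi).
Proof.
move=> mD muoo [mphi [M Mphi]]; apply: measurable_bounded_integrable => //.
exists M; split; first exact: num_real.
by move=> K MK x Dx /=; rewrite (le_trans (Mphi _ Dx))// ltW.
Qed.

Lemma bounded_measurable_cst D (r : R) : bounded_measurable D (cst r).
Proof. by split=> //; exists `|r|. Qed.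

Lemma integrable_bounded_measurable D (mu : {measure set T -> \bar R}) f phi :
  measurable D -> mu.-integrable D (EFin \o f) -> bounded_measurable D phi ->
  mu.-integrable D (EFin \o (fun x => f x * phi x)).
Proof.
move=> mD intf [mphi [M Mphi]].
rewrite (_ : EFin \o _ = (EFin \o f) \* (EFin \o phi))%E; last first.
  by apply/funext => x; rewrite /= EFinM.
apply: integrableMl => //; exists M; split; first exact: num_real.
by move=> K MK x Dx /=; rewrite (le_trans (Mphi _ Dx))// ltW.
Qed.

Lemma eq_measure_Rintegral D (m1 m2 : {measure set T -> \bar R}) phi :
  (forall A, measurable A -> A `<=` D -> m1 A = m2 A) ->
  \int[m1]_(x in D) phi x = \int[m2]_(x in D) phi x.
Proof. by move=> m12; rewrite /Rintegral (eq_measure_integral m2). Qed.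

Lemma Rintegral_measure_add D (m1 m2 : {measure set T -> \bar R}) phi :
  measurable D -> (m1 D < +oo)%E -> (m2 D < +oo)%E ->
  bounded_measurable D phi ->
  \int[measure_add m1 m2]_(x in D) phi x =
  \int[m1]_(x in D) phi x + \int[m2]_(x in D) phi x.
Proof.
move=> mD m1D m2D bphi.
have i1 := bounded_measurable_integrable mD m1D bphi.
have i2 := bounded_measurable_integrable mD m2D bphi.
have mphi : measurable_fun D (EFin \o phi).
  by apply/measurable_EFinP; case: bphi.
rewrite /Rintegral integral_measure_add// fineD//.
- exact: (integrable_fin_num mD i1).
- exact: (integrable_fin_num mD i2).
Qed.

Lemma RintegralDM D (mu : {measure set T -> \bar R}) f g h : measurable D ->
  mu.-integrable D (EFin \o f) -> mu.-integrable D (EFin \o g) ->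
  bounded_measurable D h ->
  \int[mu]_(x in D) ((f x + g x) * h x) =
  \int[mu]_(x in D) (f x * h x) + \int[mu]_(x in D) (g x * h x).
Proof.
move=> mD intf intg bh; under eq_Rintegral do rewrite mulrDl.
by rewrite RintegralD//; exact: integrable_bounded_measurable.
Qed.

Lemma RintegralZM D (mu : {measure set T -> \bar R}) r f h : measurable D ->
  mu.-integrable D (EFin \o f) -> bounded_measurable D h ->
  \int[mu]_(x in D) (r * f x * h x) = r * \int[mu]_(x in D) (f x * h x).
Proof.
move=> mD intf bh; under eq_Rintegral do rewrite -mulrA.
by rewrite RintegralZl//; exact: integrable_bounded_measurable.
Qed.

End bounded_measurable.

Lemma eq_sube_adde (R : realDomainType) (a b c d : \bar R) :
  a \is a fin_num -> b \is a fin_num -> c \is a fin_num -> d \is a fin_num ->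
  (a - b = c - d -> c + b = a + d)%E.
Proof.
case: a b c d => [a| |] [b| |] [c| |] [d| |] // _ _ _ _.
by rewrite -!EFinB -!EFinD => -[?]; congr EFin; lra.
Qed.

Section cintegral_theory.
Variables (R : realType) (N : nat) (Omega : set 'rV[R]_N).
Hypothesis mOmega : measurable Omega.
Local Notation V := 'rV[R]_N.
Implicit Types (phi : V -> R) (nu : {charge set V -> \bar R}).

(** Hides the Hahn decomposition selected inside [cintegral]: all that is used later is that some
    pair of finite measures has difference [nu] and computes the integral. *)
Lemma cintegralE nu phi : exists m1 m2 : {finite_measure set V -> \bar R},
  (forall A, measurable A -> nu A = (m1 A - m2 A)%E) /\
  cintegral Omega nu phi =
    \int[m1]_(x in Omega) phi x - \int[m2]_(x in Omega) phi x.
Proof.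
pose h := svalP (cid (svalP (cid (Hahn_decomposition nu)))).
exists (jordan_pos h), (jordan_neg h); split => // A mA.
by rewrite (jordan_decomp h)// /cadd/= cscaleN1.
Qed.

Lemma finite_measure_lty (m : {finite_measure set V -> \bar R}) :
  (m Omega < +oo)%E.
Proof. by rewrite -ge0_fin_numE// fin_num_measure. Qed.

(** If p - n = m1 - m2 then m1 + n = p + m2, an identity between positive measures, whose integrals
    add up. Thus any decomposition of [nu] on Omega, minimal or not, computes [cintegral]; linearity
    follows from this. *)
Lemma cintegral_diff nu (m1 m2 : {measure set V -> \bar R}) phi :
  (m1 Omega < +oo)%E -> (m2 Omega < +oo)%E ->
  bounded_measurable Omega phi ->
  (forall A, measurable A -> A `<=` Omega -> nu A = (m1 A - m2 A)%E) ->
  cintegral Omega nu phi =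
    \int[m1]_(x in Omega) phi x - \int[m2]_(x in Omega) phi x.
Proof.
move=> m1oo m2oo bphi num; have [p [n [nupn ->]]] := cintegralE nu phi.
have poo := finite_measure_lty p; have noo := finite_measure_lty n.
apply/eqP; rewrite subr_eq addrAC eq_sym subr_eq; apply/eqP.
rewrite -!Rintegral_measure_add//; apply: eq_measure_Rintegral => A mA AO.
have := num A mA AO; rewrite nupn// => nuA.
apply: (eq_trans (measure_addE m1 n A)).
apply: (eq_trans _ (esym (measure_addE p m2 A))); move: nuA.
have fin (m : {measure set V -> \bar R}) :
    (m Omega < +oo)%E -> m A \is a fin_num.
  move=> moo; rewrite ge0_fin_numE//; apply: le_lt_trans moo.
  by rewrite le_measure ?inE.
exact: eq_sube_adde (fin _ poo) (fin _ noo) (fin _ m1oo) (fin _ m2oo).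
Qed.

Lemma eq_cintegral nu1 nu2 phi : bounded_measurable Omega phi ->
  (forall A, measurable A -> A `<=` Omega -> nu1 A = nu2 A) ->
  cintegral Omega nu1 phi = cintegral Omega nu2 phi.
Proof.
move=> bphi nu12; have [p [n [nupn ->]]] := cintegralE nu2 phi.
apply: cintegral_diff; rewrite ?finite_measure_lty// => A mA AO.
by rewrite nu12// nupn.
Qed.

Lemma cintegral_add nu1 nu2 phi : bounded_measurable Omega phi ->
  cintegral Omega (cadd nu1 nu2) phi =
  cintegral Omega nu1 phi + cintegral Omega nu2 phi.
Proof.
move=> bphi.
have [p1 [n1 [nupn1 ->]]] := cintegralE nu1 phi.
have [p2 [n2 [nupn2 ->]]] := cintegralE nu2 phi.
have foo (m m' : {finite_measure set V -> \bar R}) :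
    (measure_add m m' Omega < +oo)%E.
  by rewrite [ltLHS](measure_addE m m') lte_add_pinfty// finite_measure_lty.
rewrite addrACA -opprD -!Rintegral_measure_add ?finite_measure_lty//.
apply: cintegral_diff; [exact: foo|exact: foo|by []|move=> A mA AO].
apply: (@eq_trans _ _ ((p1 A + p2 A) - (n1 A + n2 A))%E); last first.
  by congr (_ - _)%E; apply/esym; exact: measure_addE.
apply: (@eq_trans _ _ ((p1 A - n1 A) + (p2 A - n2 A))%E).
  by congr (_ + _)%E; [exact: nupn1|exact: nupn2].
by rewrite fin_num_oppeD ?fin_num_measure// addeACA.
Qed.

Lemma cintegral_scale r nu phi : bounded_measurable Omega phi ->
  cintegral Omega (cscale r nu) phi = r * cintegral Omega nu phi.
Proof.
move=> bphi; have [p [n [nupn ->]]] := cintegralE nu phi.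
have intm (k : {nonneg R}) (m : {finite_measure set V -> \bar R}) :
    \int[mscale k m]_(x in Omega) phi x =
    k%:num * \int[m]_(x in Omega) phi x.
  have mphi : measurable_fun Omega (EFin \o phi).
    by apply/measurable_EFinP; case: bphi.
  rewrite /Rintegral integralE [in RHS]integralE.
  rewrite !ge0_integral_mscale//; [|exact: measurable_funeneg|exact: measurable_funepos].
  rewrite -muleBr//; last first.
    apply: integrable_add_def => //.
    exact: (bounded_measurable_integrable _ (finite_measure_lty m)).
  rewrite -integralE fineM// integrable_fin_num//.
  exact: (bounded_measurable_integrable _ (finite_measure_lty m)).
have foo (k : {nonneg R}) (m : {finite_measure set V -> \bar R}) :
    (mscale k m Omega < +oo)%E.
  by rewrite /mscale/= lte_mul_pinfty// finite_measure_lty.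
have [r0|r0] := leP 0 r.
  rewrite mulrBr -[r]/(NngNum r0)%:num -!intm.
  apply: cintegral_diff; [exact: foo|exact: foo|by []|move=> A mA AO].
  apply: (@eq_trans _ _ (r%:E * (p A - n A))%E).
    by congr (_ * _)%E; exact: nupn.
  rewrite muleBr//; apply: fin_num_adde_defl; rewrite fin_numN.
  exact: fin_num_measure.
(* A negative factor exchanges the two parts: r (p - n) = (- r) n - (- r) p. *)
have {}r0 : 0 <= - r by rewrite oppr_ge0 ltW.
rewrite -mulrNN opprB mulrBr -[- r]/(NngNum r0)%:num -!intm.
apply: cintegral_diff; [exact: foo|exact: foo|by []|move=> A mA AO].
apply: (@eq_trans _ _ (r%:E * (p A - n A))%E).
  by congr (_ * _)%E; exact: nupn.
have pA : p A \is a fin_num by exact: fin_num_measure.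
have nA : n A \is a fin_num by exact: fin_num_measure.
apply: (@eq_trans _ _ ((- r)%:E * (n A - p A))%E); last first.
  by rewrite muleBr// fin_num_adde_defl// fin_numN.
by rewrite -(fineK pA) -(fineK nA) -!EFinB -!EFinM mulNr -mulrN opprB.
Qed.

End cintegral_theory.

Section matrix_measurable.
Variables (R : realType) (m n : nat).
Local Notation V := 'M[R]_(m, n).

Lemma open_measurable_mx (U : set V) : open U -> measurable U.
Proof. exact: sub_sigma_algebra. Qed.

Lemma open_continuous_measurable_mx (U : set V) (f : V -> R) : open U ->
  (forall x, U x -> {for x, continuous f}) -> measurable_fun U f.
Proof.
move=> oU cf; apply: (measurability _ (RGenOpens.measurableE R)).
move=> _ [_ [a [b ->]] <-]; apply: open_measurable_mx.
rewrite openE => x [Ux fx]; apply: filterI; first exact: open_nbhs_nbhs.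
by apply: (cf _ Ux); apply: open_nbhs_nbhs; split => //; exact: interval_open.
Qed.

Lemma continuous_measurable_mx (f : V -> R) :
  continuous f -> measurable_fun setT f.
Proof.
by move=> cf; exact: (open_continuous_measurable_mx openT (fun x _ => cf x)).
Qed.

End matrix_measurable.

(** * Signed measures with a density *)

Section cintegral_density.
Variables (R : realType) (N : nat) (Omega : set 'rV[R]_N).
Hypothesis mOmega : measurable Omega.
Local Notation V := 'rV[R]_N.
Local Notation leb := (lebesgue_rV R N).

Lemma radon_nikodym_real d (T : measurableType d)
    (mu : {sigma_finite_measure set T -> \bar R})
    (nu : {finite_measure set T -> \bar R}) : nu `<< mu ->
  exists p : T -> R, [/\ mu.-integrable setT (EFin \o p),
    forall A, measurable A -> nu A = (\int[mu]_(x in A) (p x)%:E)%E &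
    forall E phi, measurable E -> nu.-integrable E (EFin \o phi) ->
      \int[nu]_(x in E) phi x = \int[mu]_(x in E) (p x * phi x)].
Proof.
move=> numu.
pose nu' : {charge set T -> \bar R} := charge_of_finite_measure nu.
have numu' : nu' `<< mu by [].
pose f := Radon_Nikodym nu' mu.
have ff x : f x = (fine (f x))%:E by rewrite fineK// Radon_Nikodym_fin_num.
exists (fine \o f); split.
- by apply: (eq_integrable measurableT f); [move=> x _; exact: ff|
     exact: Radon_Nikodym_integrable].
- move=> A mA; rewrite -[LHS]/(nu' A) (Radon_Nikodym_integral numu' mA).
  by apply: eq_integral => x _; rewrite /= -ff.
- move=> E phi mE intphi.
  rewrite /Rintegral -(Radon_Nikodym_change_of_variables numu)//.
  by congr fine; apply: eq_integral => x _; rewrite /= EFinM -ff muleC.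
Qed.

(** Both Jordan parts of h mu are absolutely continuous, so they have Radon-Nikodym densities p and
    n. The functions h and p - n have the same integral over every measurable subset of Omega, hence
    agree almost everywhere. *)
Lemma cintegral_induced (mu : {sigma_finite_measure set V -> \bar R})
    (h : V -> R) (inth : mu.-integrable setT (EFin \o h)) phi :
  bounded_measurable Omega phi ->
  cintegral Omega (induced_charge inth) phi =
  \int[mu]_(x in Omega) (h x * phi x).
Proof.
move=> bphi; rewrite /cintegral.
set nu : {charge set V -> \bar R} := induced_charge inth.
set nuPN := svalP (cid (svalP (cid (Hahn_decomposition nu)))).
have numu : nu `<< mu.
  apply/null_content_dominatesP => A mA muA; apply: null_set_integral => //.
  apply: measurable_funTS; exact: measurable_int inth.
have intm (m : {finite_measure set V -> \bar R}) :
    m.-integrable Omega (EFin \o phi).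
  by apply: bounded_measurable_integrable bphi => //; exact: finite_measure_lty.
have [p [intp pE ->//]] := radon_nikodym_real (jordan_pos_dominates nuPN numu).
have [n [intn nE ->//]] := radon_nikodym_real (jordan_neg_dominates nuPN numu).
have intS f : mu.-integrable setT (EFin \o f) -> mu.-integrable Omega (EFin \o f).
  exact: integrableS.
rewrite -RintegralB//; [|exact/integrable_bounded_measurable/bphi/intS..].
have hpn : ae_eq mu Omega (EFin \o h) (EFin \o (fun x => p x - n x)).
  apply: integral_ae_eq => //; first exact: intS.
    by apply: (measurable_int mu); apply: intS; exact: integrableRB.
  move=> E EO mE; rewrite -[LHS]/(nu E) (jordan_decomp nuPN mE).
  rewrite integralB_EFin//.
  - congr (_ + _)%E; first exact: pE.
    by rewrite /cscale [LHS]mulN1e; congr oppe; exact: nE.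
  - exact: integrableS intp.
  - exact: integrableS intn.
rewrite /Rintegral; congr fine; apply: ae_eq_integral => //.
- by apply/measurable_int/integrableRB => //;
    apply/integrable_bounded_measurable/bphi => //; exact: intS.
- by apply/measurable_int/integrable_bounded_measurable/bphi => //; exact: intS.
apply: filterS hpn => x + Ox => /(_ Ox)[->] /=.
by rewrite mulrBl.
Qed.

Lemma charge_of_funE f (intf : leb.-integrable Omega (EFin \o f)) A :
  measurable A -> A `<=` Omega ->
  charge_of_fun Omega f A = (\int[leb]_(x in A) (f x)%:E)%E.
Proof.
move=> mA AO; rewrite /charge_of_fun; case: pselect => /= [intf'|].
  rewrite /induced_charge; apply: eq_integral => x /[!inE] Ax.
  by rewrite /= patchE mem_set//; exact: AO.
move=> []; rewrite -restrict_EFin.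
exact/(integrable_mkcond _ mOmega).
Qed.

Lemma cintegral_charge_of_fun f phi :
  leb.-integrable Omega (EFin \o f) -> bounded_measurable Omega phi ->
  cintegral Omega (charge_of_fun Omega f) phi =
  \int[leb]_(x in Omega) (f x * phi x).
Proof.
move=> intf bphi; rewrite /charge_of_fun; case: pselect => [intf'|].
  rewrite cintegral_induced//; apply: eq_Rintegral => x xO.
  by rewrite patchE xO.
move=> []; rewrite -restrict_EFin.
exact/(integrable_mkcond _ mOmega).
Qed.

End cintegral_density.

(** * Boxes, slices and integration by parts *)

Section boxes.
Variables (R : realType) (N : nat).
Local Notation V := 'rV[R]_N.
Implicit Types (a b x : V) (j l : 'I_N) (t : R).

Definition cbox a b : set V := [set x | forall j, x 0 j \in `[a 0 j, b 0 j]].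

Definition obox a b : set V := [set x | forall j, x 0 j \in `]a 0 j, b 0 j[].

Lemma coord_measurable j : measurable_fun setT (fun x : V => x 0 j).
Proof. exact: measurable_coord. Qed.

Lemma measurable_cbox a b : measurable (cbox a b).
Proof.
rewrite (_ : cbox a b =
  \bigcap_(j : 'I_N) ((fun x : V => x 0 j) @^-1` `[a 0 j, b 0 j])); last first.
  by apply/seteqP; split => [x /= H j _|x /= H j]; [exact: H|exact: (H j I)].
apply: fin_bigcap_measurable => // j _.
by rewrite -[X in measurable X]setTI; exact: coord_measurable.
Qed.

Lemma measurable_obox a b : measurable (obox a b).
Proof.
rewrite (_ : obox a b =
  \bigcap_(j : 'I_N) ((fun x : V => x 0 j) @^-1` `]a 0 j, b 0 j[)); last first.
  by apply/seteqP; split => [x /= H j _|x /= H j]; [exact: H|exact: (H j I)].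
apply: fin_bigcap_measurable => // j _.
by rewrite -[X in measurable X]setTI; exact: coord_measurable.
Qed.

Lemma cboxI a b a' b' : cbox a b `&` cbox a' b' =
  cbox (\row_j Num.max (a 0 j) (a' 0 j)) (\row_j Num.min (b 0 j) (b' 0 j)).
Proof.
apply/seteqP; split => [x [/= H H'] j|x H]; last split => j.
- by move: (H j) (H' j); rewrite !mxE !in_itv/= ge_max le_min => /andP[-> ->] /andP[-> ->].
- by move: (H j); rewrite !mxE !in_itv/= ge_max le_min => /andP[/andP[-> _] /andP[-> _]].
- by move: (H j); rewrite !mxE !in_itv/= ge_max le_min => /andP[/andP[_ ->] /andP[_ ->]].
Qed.

Lemma oboxI a b a' b' : obox a b `&` obox a' b' =
  obox (\row_j Num.max (a 0 j) (a' 0 j)) (\row_j Num.min (b 0 j) (b' 0 j)).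
Proof.
apply/seteqP; split => [x [/= H H'] j|x H]; last split => j.
- by move: (H j) (H' j); rewrite !mxE !in_itv/= gt_max lt_min => /andP[-> ->] /andP[-> ->].
- by move: (H j); rewrite !mxE !in_itv/= gt_max lt_min => /andP[/andP[-> _] /andP[-> _]].
- by move: (H j); rewrite !mxE !in_itv/= gt_max lt_min => /andP[/andP[_ ->] /andP[_ ->]].
Qed.

(** An open rational box around x inside U is shrunk once more, so that even the closed box stays in
    U. *)
Lemma open_rat_boxes (U : set V) x : open U -> U x ->
  exists a b : 'rV[rat]_N,
    obox (map_mx ratr a) (map_mx ratr b) x /\
    cbox (map_mx ratr a) (map_mx ratr b) `<=` U.
Proof.
move=> oU Ux; have [a [b [abx abU]]] := open_mx_rat_box oU Ux.
have ha (l u : R) : l < u -> {q : rat | l < ratr q < u}.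
  move=> lu; apply/cid; have /rat_in_itvoo[q] := lu.
  by rewrite in_itv/= => ?; exists q.
have ax j : ratr (a 0 j) < x 0 j by have /andP[] := abx 0 j.
have xb j : x 0 j < ratr (b 0 j) by have /andP[] := abx 0 j.
exists (\row_j sval (ha _ _ (ax j))), (\row_j sval (ha _ _ (xb j))); split.
  move=> j; rewrite !mxE in_itv/=.
  by case: (ha _ _ (ax j)) => /= q /andP[_ ->]; case: (ha _ _ (xb j)) => /= r /andP[-> _].
move=> y H; apply: abU => i j; rewrite (ord1 i).
move: (H j); rewrite !mxE in_itv/=.
case: (ha _ _ (ax j)) => /= q /andP[aq _]; case: (ha _ _ (xb j)) => /= r /andP[_ rb].
by move=> /andP[qy yr]; rewrite (lt_le_trans aq)//= (le_lt_trans yr).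
Qed.

Lemma sub_obox_cbox a b : obox a b `<=` cbox a b.
Proof. by move=> x H j; exact: subset_itv_oo_cc (H j). Qed.

(** An open set is the countable union of the rational boxes [B a b] that it contains. Allowing any
    family between open and closed boxes serves both uniqueness arguments: closed boxes for Lebesgue
    measure, open boxes for measures tested on C^1_c. *)
Lemma measurable_generated (G : set (set V)) (B : V -> V -> set V) :
  (forall a b, obox a b `<=` B a b) -> (forall a b, B a b `<=` cbox a b) ->
  (forall a b, G (B a b)) -> G `<=` measurable -> @measurable _ V = <<s G >>.
Proof.
move=> oB cB GB Gm; apply/seteqP; split; last first.
  by apply: smallest_sub => //; exact: sigma_algebra_measurable.
apply: smallest_sub; first exact: smallest_sigma_algebra.
move=> U oU.
pose BQ (ab : 'rV[rat]_N * 'rV[rat]_N) : set V :=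
  B (map_mx ratr ab.1) (map_mx ratr ab.2).
rewrite (_ : U = \bigcup_ab (if pselect (BQ ab `<=` U) then BQ ab else set0)).
  pose T := g_sigma_algebraType G.
  apply: (@countable_bigcupT_measurable _ T _ _ _); first exact: countableP.
  move=> ab; case: pselect => Fab; last exact: measurable0.
  by apply: sub_sigma_algebra; exact: GB.
apply/seteqP; split => [x Ux|x [ab _]]; last by case: pselect => // FU /FU.
have [a [b [abx abU]]] := open_rat_boxes oU Ux.
exists (a, b) => //; case: pselect => //=; first by move=> _; exact: oB.
by move=> []; exact: subset_trans (cB _ _) abU.
Qed.

Lemma cbox_le a b x : cbox a b x -> forall j, a 0 j <= b 0 j.
Proof. by move=> H j; have /andP[] := H j; rewrite !bnd_simp; exact: le_trans. Qed.

Lemma measure_unique_cbox (m1 m2 : {measure set V -> \bar R}) :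
  (forall a b, (forall j, a 0 j <= b 0 j) ->
    (m1 (cbox a b) < +oo)%E /\ m1 (cbox a b) = m2 (cbox a b)) ->
  forall A, measurable A -> m1 A = m2 A.
Proof.
move=> m12 A mA.
pose G := [set B | exists a b, B = cbox a b].
have m12' a b : (m1 (cbox a b) < +oo)%E /\ m1 (cbox a b) = m2 (cbox a b).
  have [->|/set0P[x /cbox_le/m12//]] := eqVneq (cbox a b) set0.
  by rewrite !measure0.
apply: (@measure_unique _ _ _ G (fun n => cbox (const_mx (- n%:R)) (const_mx n%:R))).
- apply: (measurable_generated (@sub_obox_cbox)).
  - by move=> a b.
  - by move=> a b; exists a, b.
  by move=> _ [a [b ->]]; exact: measurable_cbox.
- by move=> _ _ [a [b ->]] [a' [b' ->]]; rewrite cboxI; eexists; eexists.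
- by move=> i; eexists; eexists.
- apply/seteqP; split => // x _.
  pose M := \sum_j `|x 0 j|.
  exists (Num.truncn M).+1 => // j; rewrite !mxE in_itv/= -ler_norml.
  rewrite (@le_trans _ _ M)//; last exact/ltW/truncnS_gt.
  by rewrite /M (bigD1 j)//= lerDl sumr_ge0.
- by move=> _ [a [b ->]]; case: (m12' a b).
- by move=> k; case: (m12' (const_mx (- k%:R)) (const_mx k%:R)).
- exact: mA.
Qed.

End boxes.

Section slicing.
Variables (R : realType) (N : nat).
Local Notation V := 'rV[R]_N.
Local Notation leb := (lebesgue_rV R N).
Local Notation leb1 := (@lebesgue_measure R).
Implicit Types (a b x : V) (j l : 'I_N) (t : R).

Lemma lebesgue_cbox_lty a b : (leb (cbox a b) < +oo)%E.
Proof.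
have [->|/set0P[x /cbox_le ab]] := eqVneq (cbox a b) set0.
  by rewrite measure0.
by rewrite lebesgue_rV_box// ltry.
Qed.

Lemma lebesgue_itv_cc_lty (s t : R) : (leb1 `[s, t]%classic < +oo)%E.
Proof. by rewrite lebesgue_measure_itv/=; case: ifPn => _; rewrite ltry. Qed.

Definition setc j t x : V := \row_l (if l == j then t else x 0 l).

Lemma setcE j t x : setc j t x 0 j = t. Proof. by rewrite mxE eqxx. Qed.

Lemma measurable_setc j :
  measurable_fun setT (fun z : measurableTypeR R * V => setc j z.1 z.2).
Proof.
apply: measurable_fun_mx => i l.
under [X in measurable_fun _ X]eq_fun do rewrite mxE.
case: eqP => _; first exact: measurable_fst.
apply: (@measurableT_comp _ _ _ _ _ _ (fun v : V => v 0 l)).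
  exact: coord_measurable.
exact: measurable_snd.
Qed.

(** Stands for the hyperplane x_j = 0, thickened to unit width: an integral over an
    (N-1)-dimensional face becomes an N-dimensional integral over a box whose side along j is
    [0, 1], of a function constant in x_j. Everything is thus expressed with [lebesgue_rV R N]. *)
Definition slab j : set V := [set x | x 0 j \in `[0, 1]].

Lemma measurable_slab j : measurable (slab j).
Proof.
have := @coord_measurable R N j measurableT _ (measurable_itv `[0, 1]).
by rewrite setTI.
Qed.

Lemma setc_cbox j a b t x : slab j x -> cbox a b (setc j t x) <->
  t \in `[a 0 j, b 0 j] /\ cbox (setc j 0 a) (setc j 1 b) x.
Proof.
move=> sx; split.
  move=> H; split; first by have := H j; rewrite setcE.
  move=> l; rewrite !mxE; case: eqP => [->//|/eqP lj].
  by have := H l; rewrite mxE (negbTE lj).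
move=> [tab H] l; rewrite mxE; case: eqP => [->//|/eqP lj].
by have := H l; rewrite !mxE (negbTE lj).
Qed.

Lemma cbox_slab j a b : cbox (setc j 0 a) (setc j 1 b) `<=` slab j.
Proof. by move=> x /(_ j); rewrite !setcE. Qed.

Lemma measurable_setT_slab j :
  measurable ([set: measurableTypeR R] `*` slab j).
Proof. by apply: measurableX => //; exact: measurable_slab. Qed.

(* Lebesgue measure disintegrates along the lines parallel to the axis [j],
   indexed by their intersections with the slab. *)
Lemma lebesgue_slice j (A : set V) : measurable A ->
  leb A = pushforward (mrestr (leb1 \x leb)%E (measurable_setT_slab j))
    (fun z => setc j z.1 z.2) A.
Proof.
move: A; set push := pushforward _ _.
have [m2 m2E] : exists m2 : {measure set V -> \bar R}, m2 = push :> (set V -> _).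
  unshelve eexists (pushforward (mrestr (leb1 \x leb)%E (measurable_setT_slab j))
    (fun z => setc j z.1 z.2) : {measure set V -> \bar R}).
    exact: measurable_setc.
  by [].
rewrite -m2E; apply: measure_unique_cbox => a b ab; split.
  exact: lebesgue_cbox_lty.
rewrite m2E /push /pushforward /mrestr.
rewrite (_ : _ `&` _ =
    `[a 0 j, b 0 j]%classic `*` cbox (setc j 0 a) (setc j 1 b)); last first.
  apply/seteqP; split => [[t x] [/= H [_ sx]]|[t x] [/= tab H]].
    by have [//] := (setc_cbox a b t sx).1 H.
  have sx := cbox_slab H; split => //.
  exact/setc_cbox.
rewrite [RHS]product_measure1E//; last exact: measurable_cbox.
rewrite lebesgue_rV_box//; last by move=> l; rewrite !mxE; case: ifP.
rewrite [LHS]lebesgue_rV_box//.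
rewrite (bigD1 j)//= [in RHS](bigD1 j)//= !mxE eqxx subr0 mul1r EFinM.
congr (_ * _)%E; last first.
  by congr EFin; apply: eq_bigr => l /negbTE lj; rewrite !mxE lj.
rewrite [RHS](lebesgue_measure_itv `[a 0 j, b 0 j])/= lte_fin.
by case: ltgtP (ab j) => // ->; rewrite subrr.
Qed.

(** Change of variables along [lebesgue_slice], then Fubini on the product of a segment and a box of
    unit width along j. Boundedness of f on the box gives the integrability that Fubini asks for. *)
Lemma integral_cbox_slice j a b (f : V -> R) :
  measurable_fun setT f -> (exists M, forall x, cbox a b x -> `|f x| <= M) ->
  (\int[leb]_(x in cbox a b) (f x)%:E =
   \int[leb]_(x in cbox (setc j 0 a) (setc j 1 b))
     \int[leb1]_(t in `[a 0%R j, b 0%R j]) (f (setc j t x))%:E)%E.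
Proof.
move=> mf [M fM].
pose m0 := mrestr (leb1 \x leb)%E (measurable_setT_slab j).
pose st (z : measurableTypeR R * V) := setc j z.1 z.2.
pose S := [set: measurableTypeR R] `*` slab j.
pose Q : set (measurableTypeR R * V) :=
  `[a 0 j, b 0 j]%classic `*` cbox (setc j 0 a) (setc j 1 b).
have mQ : measurable Q by apply: measurableX => //; exact: measurable_cbox.
have mP : measurable (st @^-1` cbox a b).
  rewrite -[X in measurable X]setTI; apply: measurable_setc => //.
  exact: measurable_cbox.
have PQ : st @^-1` cbox a b `&` S = Q.
  apply/seteqP; split => [[t x] [/= H [_ sx]]|[t x] [/= tab H]].
    by have [//] := (setc_cbox a b t sx).1 H.
  have sx := cbox_slab H; split => //.
  exact/setc_cbox.
have Qoo : ((leb1 \x leb)%E Q < +oo)%E.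
  rewrite [ltLHS]product_measure1E//; last exact: measurable_cbox.
  rewrite lte_mul_pinfty//; last exact: lebesgue_cbox_lty.
  rewrite ge0_fin_numE//; exact: lebesgue_itv_cc_lty.
have mfst : measurable_fun setT (f \o st).
  by apply: measurableT_comp => //; exact: measurable_setc.
have bf : bounded_measurable Q (f \o st).
  by split; [exact: measurable_funTS|exists M; rewrite -PQ => z [+ _]; exact: fM].
have intQ : (leb1 \x leb)%E.-integrable Q (EFin \o (f \o st)).
  exact: (bounded_measurable_integrable mQ Qoo bf).
have m0P : m0 (st @^-1` cbox a b) = leb (cbox a b).
  by rewrite (lebesgue_slice j (measurable_cbox a b)).
have intP : m0.-integrable (st @^-1` cbox a b) (EFin \o (f \o st)).
  apply: bounded_measurable_integrable => //.
    by rewrite [ltLHS]m0P; exact: lebesgue_cbox_lty.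
  by split; [exact: measurable_funTS|exists M => z; exact: fM].
transitivity (\int[pushforward m0 st]_(x in cbox a b) (f x)%:E)%E.
  apply: eq_measure_integral; first exact: measurable_setc.
  by move=> ? A mA _; exact: lebesgue_slice.
rewrite (integral_pushforward (measurable_setc j))//; last 2 first.
- exact/measurable_EFinP.
- exact: measurable_cbox.
(* The restricted measure [m0] ignores the complement of [S]; dropping it leaves the product set
   [Q]. *)
rewrite (@negligible_integral _ _ _ m0 _ (~` S))//; last 2 first.
- by apply: measurableC; exact: measurable_setT_slab.
- transitivity ((leb1 \x leb)%E (~` S `&` S)); first by [].
  by rewrite setICl measure0.
rewrite setDE setCK PQ.
transitivity (\int[(leb1 \x leb)%E]_(z in Q) (f (st z))%:E)%E.
  apply: eq_measure_integral => A mA AQ.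
  transitivity ((leb1 \x leb)%E (A `&` S)); first by [].
  rewrite setIidl//.
  by apply: (subset_trans AQ); rewrite -PQ => ? [].
rewrite integral_mkcond.
rewrite -integral21_prod_meas1; last first.
  exact/(integrable_mkcond _ mQ).
rewrite [RHS]integral_mkcond; apply: eq_integral => x _.
rewrite /fubini_G patchE; case: ifPn => xab; last first.
  rewrite (eq_integral (cst 0%E)) ?integral0// => t _.
  rewrite patchE; case: ifPn => //; rewrite inE => -[_ /=].
  by move/mem_set; rewrite (negbTE xab).
rewrite [RHS]integral_mkcond; apply: eq_integral => t _.
rewrite !patchE; congr (if _ then _ else _).
by rewrite !mem_setE/= /Q in_setX (_ : (x \in _) = true)// andbT mem_setE.
Qed.

End slicing.

Section axis_derivative.
Variables (R : realType) (N : nat).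
Local Notation V := 'rV[R]_N.
Local Notation leb := (lebesgue_rV R N).
Implicit Types (a b x : V) (j l : 'I_N) (t : R) (psi : V -> R).

Definition axis j : V := delta_mx 0 j.

Lemma setcD j s t x : setc j (s + t) x = s *: axis j + setc j t x.
Proof.
apply/rowP => l; rewrite !mxE eqxx/= eq_sym.
by case: eqP => _; rewrite ?mulr1 ?mulr0 ?add0r.
Qed.

Lemma setc_continuous j x : continuous (fun t => setc j t x).
Proof.
move=> t; rewrite (_ : (fun t => _) = (fun t => t *: axis j + setc j 0 x)).
  apply: cvgD; last exact: cvg_cst.
  by apply: cvgZr_tmp; exact: cvg_id.
by apply/funext => s; rewrite -{1}[s]addr0 setcD.
Qed.

Lemma derivable_setc psi j x t : derivable psi (setc j t x) (axis j) ->
  derivable (fun s => psi (setc j s x)) t 1.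
Proof.
rewrite /derivable => d1; set d := (fun _ : R => _).
set d' := (fun _ : R => _) in d1; suff -> : d = d' by [].
by apply/funext => h; rewrite /d /d' /= [h%:A](mulr1) setcD.
Qed.

Lemma derive_setc psi j x t :
  derive1 (fun s => psi (setc j s x)) t = 'D_(axis j) psi (setc j t x).
Proof.
by rewrite /derive1 /derive; under eq_fun do rewrite setcD.
Qed.

Lemma compact_cbox a b : compact (cbox a b).
Proof.
apply: (@rV_compact _ _ (fun i => `[a 0 i, b 0 i]%classic)) => i.
exact: segment_compact.
Qed.

Lemma continuous_cbox_bounded a b psi : continuous psi ->
  exists M, forall x, cbox a b x -> `|psi x| <= M.
Proof.
move=> cpsi.
have : compact (psi @` cbox a b).
  apply: continuous_compact; last exact: compact_cbox.
  exact: continuous_subspaceT.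
move=> /compact_bounded[M [_ MM]]; exists (M + 1) => x xab.
by apply: (MM (M + 1)); [rewrite ltrDl|exists x].
Qed.

(** The divergence theorem on a box for the field psi e_j: the fundamental theorem of calculus on
    each line parallel to the axis j. The two face integrals are written on the box of unit width
    along j. *)
Lemma integral_cbox_derive j a b psi : (forall l, a 0 l <= b 0 l) ->
  continuous psi -> (forall x, derivable psi x (axis j)) ->
  continuous ('D_(axis j) psi) ->
  \int[leb]_(x in cbox a b) 'D_(axis j) psi x =
  \int[leb]_(x in cbox (setc j 0 a) (setc j 1 b)) psi (setc j (b 0 j) x) -
  \int[leb]_(x in cbox (setc j 0 a) (setc j 1 b)) psi (setc j (a 0 j) x).
Proof.
move=> ab cpsi dpsi cdpsi.
have mpsi : measurable_fun setT psi by exact: continuous_measurable_mx.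
have mdpsi : measurable_fun setT ('D_(axis j) psi).
  exact: continuous_measurable_mx.
set B1 := cbox (setc j 0 a) (setc j 1 b).
have mB1 : measurable B1 by exact: measurable_cbox.
have line t : leb.-integrable B1 (fun x => (psi (setc j t x))%:E).
  apply: bounded_measurable_integrable => //; first exact: lebesgue_cbox_lty.
  split.
    apply: measurable_funTS; apply: measurableT_comp => //.
    exact: (measurableT_comp (measurable_setc j) (pair1_measurable t)).
  have [M psiM] := continuous_cbox_bounded (setc j t a) (setc j t b) cpsi.
  exists M => x xB; apply: psiM => l; rewrite mxE.
  move: (xB l); rewrite !mxE; case: eqP => // _ _.
  by rewrite in_itv/= lexx.
rewrite /Rintegral (integral_cbox_slice j)//; last exact: continuous_cbox_bounded.
rewrite -fineB; [|exact: integrable_fin_num..].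
rewrite -integralB_EFin//; [|exact: line..].
congr fine; apply: eq_integral => x _.
(* A degenerate side is treated apart, since the fundamental theorem is stated on a nontrivial
   segment. *)
have := ab j; rewrite le_eqVlt => /predU1P[<-|abj].
  by rewrite set_itv1 integral_set1 -EFinB subrr.
have dF t : derivable (fun s => psi (setc j s x)) t 1.
  exact/derivable_setc/dpsi.
have cF : continuous (fun t => psi (setc j t x)).
  move=> t; apply: (@continuous_comp _ _ _ (fun t => setc j t x) psi).
    exact: setc_continuous.
  exact: cpsi.
have cdF : continuous (fun t => 'D_(axis j) psi (setc j t x)).
  move=> t; apply: (@continuous_comp _ _ _ (fun t => setc j t x)
    ('D_(axis j) psi)); first exact: setc_continuous.
  exact: cdpsi.
have H1 : {within `[a 0 j, b 0 j],
    continuous (fun t => 'D_(axis j) psi (setc j t x))}.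
  exact: continuous_subspaceT.
have H2 : derivable_oo_LRcontinuous (fun t => psi (setc j t x)) (a 0 j) (b 0 j).
  split => [t _| |]; first exact: dF.
    exact/cvg_at_right_filter/cF.
  exact/cvg_at_left_filter/cF.
apply: (continuous_FTC2 abj H1 H2) => t _; exact: derive_setc.
Qed.

End axis_derivative.

(** * Functions smooth off finitely many hyperplanes *)

Section piecewise.

Lemma coord_le_norm (R : realType) n (x : 'rV[R]_n) j : `|x 0 j| <= `|x|.
Proof.
have /mapP[k Hk ->] : `|x 0 j| \in [seq `|x i.1 i.2| | i : 'I_1 * 'I_n].
  by apply/mapP; exists (0, j) => //=; rewrite mem_enum.
by rewrite [leRHS]/Num.norm /= mx_normrE; apply/bigmax_geP; right => /=; exists k.
Qed.

(** Additivity applied to 0 = 0 + 0. *)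
Lemma cintegral0 (R : realType) n (D : set 'rV[R]_n) phi : measurable D ->
  bounded_measurable D phi -> cintegral D czero phi = 0.
Proof.
move=> mD bphi; have := cintegral_add mD czero czero bphi.
rewrite -(@eq_cintegral _ _ _ mD czero)//; first by lra.
by move=> A mA AD; rewrite [RHS]adde0.
Qed.

Variables (R : realType) (N : nat) (Omega : set 'rV[R]_N).
Hypotheses (Omega_open : open Omega) (Omega_bounded : bounded_set Omega).
Local Notation V := 'rV[R]_N.
Local Notation leb := (lebesgue_rV R N).
Local Notation charge_rV := ({charge set V -> \bar R}).
Implicit Types (a b x : V) (j l : 'I_N) (t : R) (phi : V -> R).
Implicit Types (T : seq ('I_N * R)).

Let mOmega : measurable Omega. Proof. exact: open_measurable_mx. Qed.

(** The inequality is strict so that the hyperplanes x_l = M and x_l = - M miss Omega; the jump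
    function is built on this. *)
Lemma bounded_cbox : exists2 M : R, 0 < M &
  forall x, Omega x -> forall j, `|x 0 j| < M.
Proof.
have [M [_ MO]] := Omega_bounded.
exists (`|M| + 2); first by rewrite ltr_wpDl.
move=> x Ox j; apply: (le_lt_trans (coord_le_norm _ _)).
have MM : M < `|M| + 1 by rewrite (le_lt_trans (ler_norm _))// ltrDl.
by rewrite (le_lt_trans (MO _ MM x Ox))// ltrD2l ltr1n.
Qed.

Lemma Omega_lty : (leb Omega < +oo)%E.
Proof.
have [M M0 MO] := bounded_cbox.
apply: le_lt_trans (lebesgue_cbox_lty (const_mx (- M)) (const_mx M)).
apply: le_measure; rewrite ?inE//; first exact: measurable_cbox.
by move=> x Ox j; rewrite !mxE in_itv/= -ler_norml ltW// MO.
Qed.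

Lemma continuous_bounded_measurable phi : continuous phi ->
  bounded_measurable Omega phi.
Proof.
move=> cphi; split.
  by apply: measurable_funTS; exact: continuous_measurable_mx.
have [M M0 MO] := bounded_cbox.
have [K phiK] := continuous_cbox_bounded (const_mx (- M)) (const_mx M) cphi.
exists K => x Ox; apply: phiK => j.
by rewrite !mxE in_itv/= -ler_norml ltW// MO.
Qed.

Section C1c_theory.
Variables (phi : V -> R).
Hypothesis phiC : C1c Omega phi.

Lemma C1c_continuous : continuous phi.
Proof. by move=> x; apply: differentiable_continuous; case: phiC. Qed.

Lemma C1c_derivable x j : derivable phi x (axis R j).
Proof. by case: phiC => dphi _ _; exact: diff_derivable. Qed.

Lemma C1c_derive_continuous j : continuous ('D_(axis R j) phi).
Proof. by case: phiC => _ cdphi _; exact: cdphi. Qed.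

Lemma C1c_out x : ~ Omega x -> phi x = 0.
Proof. by case: phiC => _ _ [K [_ KO K0]] Ox; apply: K0 => /KO. Qed.

Lemma C1c_derive_out j x : ~ Omega x -> 'D_(axis R j) phi x = 0.
Proof.
case: phiC => _ _ [K [cK KO K0]] Ox.
have : nbhs x (~` K).
  apply: open_nbhs_nbhs; split; last by move=> /KO.
  by apply: closed_openC; apply: compact_closed => //; exact: norm_hausdorff.
move=> nK.
rewrite (@near_eq_derive _ _ _ _ (cst 0)) ?derive_cst//.
by near=> y; apply: K0; near: y.
Unshelve. all: by end_near. Qed.

Lemma C1c_bounded_measurable : bounded_measurable Omega phi.
Proof. exact/continuous_bounded_measurable/C1c_continuous. Qed.

Lemma C1c_derive_bounded_measurable j :
  bounded_measurable Omega ('D_(axis R j) phi).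
Proof. exact/continuous_bounded_measurable/C1c_derive_continuous. Qed.

End C1c_theory.

Definition hyperplanes T : set V := [set x | exists2 p, p \in T & x 0 p.1 = p.2].

(* [w] is smooth off the hyperplanes in [T], and its distributional derivative
   is [F dx + sigma], with [sigma] carried by these hyperplanes. *)
Record piecewise_C1 T (w : V -> R) (F : 'I_N -> V -> R)
    (sigma : 'I_N -> charge_rV) : Prop := PiecewiseC1 {
  pw_integrable : leb.-integrable Omega (EFin \o w) ;
  pw_grad_integrable : forall j, leb.-integrable Omega (EFin \o F j) ;
  pw_continuous : forall x, ~ hyperplanes T x -> {for x, continuous w} ;
  pw_singular : forall j A, measurable A -> A `<=` ~` hyperplanes T ->
    sigma j A = 0%E ;
  pw_parts : forall phi, C1c Omega phi -> forall j,
    \int[leb]_(x in Omega) (w x * 'D_(axis R j) phi x) =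
    - (\int[leb]_(x in Omega) (F j x * phi x)) - cintegral Omega (sigma j) phi }.

Lemma piecewise_C1_mono T T' w F sigma : {subset T <= T'} ->
  piecewise_C1 T w F sigma -> piecewise_C1 T' w F sigma.
Proof.
move=> TT'; have TT : hyperplanes T `<=` hyperplanes T'.
  by move=> x [p pT xp]; exists p => //; exact: TT'.
move=> [wi Fi cw s0 parts]; split => //.
  by move=> x xT; apply: cw => /TT.
by move=> j A mA AT; apply: s0 => // x /AT + /TT.
Qed.

Lemma piecewise_C1_add T w F sigma w' F' sigma' :
  piecewise_C1 T w F sigma -> piecewise_C1 T w' F' sigma' ->
  piecewise_C1 T (fun x => w x + w' x) (fun j x => F j x + F' j x)
    (fun j => cadd (sigma j) (sigma' j)).
Proof.
move=> [wi Fi cw s0 parts] [wi' Fi' cw' s0' parts']; split.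
- exact: integrableRD.
- by move=> j; exact: integrableRD.
- by move=> x xT; exact: (continuousD (cw _ xT) (cw' _ xT)).
- move=> j A mA AT.
  apply: (@eq_trans _ _ (0 + 0)%E); last by rewrite adde0.
  by congr (_ + _)%E; [exact: s0|exact: s0'].
- move=> phi phiC j.
  have bphi := C1c_bounded_measurable phiC.
  have bdphi := C1c_derive_bounded_measurable phiC j.
  rewrite RintegralDM//.
  rewrite [in RHS]RintegralDM//.
  rewrite parts// parts'// cintegral_add//; lra.
Qed.

Lemma piecewise_C1_scale r T w F sigma : piecewise_C1 T w F sigma ->
  piecewise_C1 T (fun x => r * w x) (fun j x => r * F j x)
    (fun j => cscale r (sigma j)).
Proof.
move=> [wi Fi cw s0 parts]; split.
- exact: integrableRZ.
- by move=> j; exact: integrableRZ.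
- move=> x xT; apply: (@continuousM _ _ (cst r)); last exact: (cw _ xT).
  exact: cst_continuous.
- move=> j A mA AT; apply: (@eq_trans _ _ (r%:E * 0)%E); last by rewrite mule0.
  by congr (_ * _)%E; exact: s0.
- move=> phi phiC j.
  have bphi := C1c_bounded_measurable phiC.
  have bdphi := C1c_derive_bounded_measurable phiC j.
  rewrite RintegralZM//.
  rewrite [in RHS]RintegralZM//.
  rewrite parts// cintegral_scale//; lra.
Qed.

Lemma piecewise_C1_0 T : piecewise_C1 T (cst 0) (fun _ => cst 0)
  (fun _ => czero).
Proof.
split.
- exact: (bounded_measurable_integrable mOmega Omega_lty
    (bounded_measurable_cst _ 0)).
- move=> j; exact: (bounded_measurable_integrable mOmega Omega_lty
    (bounded_measurable_cst _ 0)).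
- by move=> x _; exact: cst_continuous.
- by [].
- move=> phi phiC j.
  have int0 (f : V -> R) : \int[leb]_(x in Omega) (0 * f x) = 0.
    by under eq_Rintegral do rewrite mul0r; rewrite Rintegral_cst// mul0r.
  rewrite !int0 (cintegral0 mOmega (C1c_bounded_measurable phiC)).
  by rewrite oppr0 addr0.
Qed.

End piecewise.

(** * Affine functions cut off by the indicator of a box *)

Section box_piece.
Variables (R : realType) (N : nat) (Omega : set 'rV[R]_N).
Hypotheses (Omega_open : open Omega) (Omega_bounded : bounded_set Omega).
Local Notation V := 'rV[R]_N.
Local Notation leb := (lebesgue_rV R N).
Local Notation charge_rV := ({charge set V -> \bar R}).
Implicit Types (a b x : V) (j k l : 'I_N) (t : R) (phi : V -> R).
Implicit Types (T : seq ('I_N * R)).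

Let mOmega : measurable Omega. Proof. exact: open_measurable_mx. Qed.

Lemma cintegral_pushforward (f : V -> V) (mf : measurable_fun setT f)
    (nu nu' : charge_rV) phi :
  measurable_fun setT phi -> bounded_measurable Omega phi ->
  (forall A, measurable A -> nu' A = nu (f @^-1` A)) ->
  cintegral Omega nu' phi = cintegral (f @^-1` Omega) nu (phi \o f).
Proof.
move=> mphi [_ [M phiM]] nu'E.
have [p [n [nupn ->]]] := cintegralE (f @^-1` Omega) nu (phi \o f).
have mpre A : measurable A -> measurable (f @^-1` A).
  by move=> mA; rewrite -[X in measurable X]setTI; exact: mf.
have bphif : bounded_measurable (f @^-1` Omega) (phi \o f).
  split; first by apply: measurable_funTS; exact: measurableT_comp.
  by exists M => x; exact: phiM.
have E (m : {finite_measure set V -> \bar R}) :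
    \int[m]_(x in f @^-1` Omega) (phi \o f) x =
    \int[pushforward m f]_(x in Omega) phi x.
  rewrite /Rintegral integral_pushforward//; first exact/measurable_EFinP.
  apply: bounded_measurable_integrable => //; first exact: mpre.
  by apply: finite_measure_lty; exact: mpre.
rewrite !E.
have push (m : {finite_measure set V -> \bar R}) :
    exists m' : {measure set V -> \bar R}, m' = pushforward m f :> (set V -> _).
  by unshelve eexists (pushforward m f : {measure set V -> \bar R}).
have [p' p'E] := push p; have [n' n'E] := push n.
rewrite -p'E -n'E; apply: cintegral_diff => //.
- by rewrite p'E; apply: finite_measure_lty; exact: mpre.
- by rewrite n'E; apply: finite_measure_lty; exact: mpre.
- by split; [exact: measurable_funTS|exists M].
- by move=> A mA AO; rewrite nu'E// nupn ?p'E ?n'E//; exact: mpre.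
Qed.

(** The surface measure with weight h on the face x_j = t of the box, obtained without surface
    measure: the image under the projection [setc j t] of the measure with density h(setc j t x) on
    the box of unit width along j. *)
Lemma face_charge j t a b (h : V -> R) : continuous h ->
  exists nu : charge_rV,
    (forall A, measurable A -> A `<=` [set x : V | x 0 j != t] -> nu A = 0%E) /\
    forall phi, C1c Omega phi -> cintegral Omega nu phi =
      \int[leb]_(x in cbox (setc j 0 a) (setc j 1 b))
        (h (setc j t x) * phi (setc j t x)).
Proof.
move=> ch; set B := cbox _ _.
have mB : measurable B by exact: measurable_cbox.
have mst : measurable_fun setT (setc j t : V -> V).
  exact: (measurableT_comp (@measurable_setc R N j) (pair1_measurable t)).
have bline (f : V -> R) : continuous f ->
    bounded_measurable B (fun x => f (setc j t x)).
  move=> cf; split.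
    apply: measurable_funTS; apply: measurableT_comp mst.
    exact: continuous_measurable_mx.
  have [M fM] := continuous_cbox_bounded (setc j t a) (setc j t b) cf.
  exists M => x xB; apply: fM => l; rewrite mxE.
  move: (xB l); rewrite !mxE; case: eqP => // _ _.
  by rewrite in_itv/= lexx.
have inth : leb.-integrable setT (EFin \o ((fun x => h (setc j t x)) \_ B)).
  rewrite -restrict_EFin; apply/(integrable_mkcond _ mB).
  exact: (bounded_measurable_integrable mB (lebesgue_cbox_lty _ _) (bline _ ch)).
pose nu0 : charge_rV := induced_charge inth.
unshelve eexists (pushforward nu0 (setc j t) : charge_rV); first exact: mst.
split => [A mA Aj|phi phiC].
  apply: (eq_trans _ (charge0 nu0)); congr (induced_charge inth _).
  by apply/seteqP; split => // x /Aj/=; rewrite setcE eqxx.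
have mphi : measurable_fun setT phi.
  by apply: continuous_measurable_mx; exact: C1c_continuous phiC.
have bphi := C1c_bounded_measurable Omega_bounded phiC.
rewrite (@cintegral_pushforward _ mst nu0)//.
have mpre : measurable (setc j t @^-1` Omega).
  by rewrite -[X in measurable X]setTI; exact: mst.
rewrite cintegral_induced//; last first.
  split; first by apply: measurable_funTS; exact: measurableT_comp.
  by case: bphi => _ [M phiM]; exists M => x; exact: phiM.
(* The left side keeps only the points that project into Omega; at the others phi vanishes, so the
   integrands agree everywhere. *)
rewrite [LHS]Rintegral_mkcond [RHS]Rintegral_mkcond.
apply: eq_Rintegral => x _; rewrite !patchE.
case: ifPn => xO; first by case: ifP => _; rewrite ?mul0r.
case: ifP => // _; rewrite (C1c_out phiC) ?mulr0//.
by move=> Oy; move/negP: xO; apply; rewrite inE.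
Qed.

Lemma is_derive_coord k x v : is_derive x v (fun y : V => y 0 k) (v 0 k).
Proof.
have H : h^-1 *: ((fun y : V => y 0 k) (h *: v + x) - x 0 k) @[h --> 0^']
    --> v 0 k.
  apply: cvg_near_cst; near=> h.
  have h0 : h != 0 by near: h; exact: nbhs_dnbhs_neq.
  by rewrite /= !mxE addrK; exact: (mulKf h0).
split; first by apply/cvg_ex; exists (v 0 k).
exact: cvg_lim H.
Unshelve. all: by end_near. Qed.

(** Used with (1, - c), the ramp of a sawtooth starting at height c, and with (0, 1), the constant
    that turns the indicator of a box into a Heaviside function on Omega. *)
Definition affine (alpha beta : R) k x := alpha * x 0 k + beta.

Lemma affine_continuous alpha beta k : continuous (affine alpha beta k).
Proof.
move=> x.
apply: (@continuousD _ _ _ (fun x : V => alpha * x 0 k) (cst beta)).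
  apply: (@continuousM _ _ (cst alpha) (fun x : V => x 0 k)).
    exact: cst_continuous.
  exact: coord_continuous.
exact: cst_continuous.
Qed.

Lemma is_derive_affine alpha beta k j x :
  is_derive x (axis R j) (affine alpha beta k) (alpha * (j == k)%:R).
Proof.
have H := is_deriveD (is_deriveZ alpha (is_derive_coord k x (axis R j)))
  (is_derive_cst beta x (axis R j)).
apply: (is_derive_eq H); rewrite addr0 mxE eqxx/= eq_sym.
by [].
Qed.

(** Off the hyperplanes that contain its faces, the indicator of a box is locally constant. *)
Lemma cbox_piece_continuous a b (h : V -> R) x : continuous h ->
  (forall l, x 0 l != a 0 l /\ x 0 l != b 0 l) ->
  {for x, continuous (fun y => \1_(cbox a b) y * h y)}.
Proof.
move=> ch xab.
have [c xc] : exists c : R, \forall y \near x, \1_(cbox a b) y = c.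
  have [xB|xB] := pselect (cbox a b x).
    exists 1; suff : \forall y \near x, forall j, (y : V) 0 j \in `]a 0 j, b 0 j[.
      by apply: filterS => y /sub_obox_cbox yB; rewrite indicE mem_set.
    apply: (@filter_forall V 'I_N (fun j y => y 0 j \in `]a 0 j, b 0 j[)
      (nbhs x) (nbhs_filter x)) => j.
      apply: (@coord_continuous _ _ _ 0 j x `]a 0 j, b 0 j[%classic).
      apply: open_nbhs_nbhs; split; first exact: interval_open.
      have [xa xb] := xab j; have := xB j; rewrite !in_itv/= => /andP[ax bx].
      by rewrite /= in_itv/= !lt_neqAle ax bx eq_sym xa xb.
  have [l xl] : exists l, ~ (x 0 l \in `[a 0 l, b 0 l]).
    by apply: contra_notP xB => /forallNP H l; apply: contrapT.
  exists 0; suff : \forall y \near x, ~ ((y : V) 0 l \in `[a 0 l, b 0 l]).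
    by apply: filterS => y yl; rewrite indicE memNset// => /(_ l).
  apply: (@coord_continuous _ _ _ 0 l x (~` `[a 0 l, b 0 l]%classic)).
  apply: open_nbhs_nbhs; split => //; apply: closed_openC.
  exact: interval_closed.
have cch : {for x, continuous (fun y => c * h y)}.
  by apply: (@continuousM _ _ (cst c)); [exact: cst_continuous|exact: ch].
have E : \forall y \near x, c * h y = \1_(cbox a b) y * h y.
  by apply: filterS xc => y ->.
rewrite /prop_for /continuous_at -(nbhs_singleton E).
by apply: cvg_trans cch; exact: (@near_eq_cvg _ _ (nbhs x) _
  (fun y => c * h y) (fun y => \1_(cbox a b) y * h y) E).
Qed.

(** The product rule and [integral_cbox_derive] applied to the affine function times phi. The face
    terms form [sigma]: plus the weighted measure of the lower face, minus that of the upper one, as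
    the function jumps up at the former and down at the latter where it is positive. *)
Lemma piecewise_C1_box T a b alpha beta k : (forall l, a 0 l <= b 0 l) ->
  (forall l, (l, a 0 l) \in T /\ (l, b 0 l) \in T) ->
  exists sigma, piecewise_C1 Omega T
    (fun x => \1_(cbox a b) x * affine alpha beta k x)
    (fun j x => \1_(cbox a b) x * (alpha * (j == k)%:R)) sigma.
Proof.
move=> ab abT.
have caff := @affine_continuous alpha beta k.
have mB : measurable (cbox a b) by exact: measurable_cbox.
have [sa saP] := choice (fun j => face_charge j (a 0 j) a b caff).
have [sb sbP] := choice (fun j => face_charge j (b 0 j) a b caff).
exists (fun j => cadd (sa j) (cscale (-1) (sb j))).
have intB (f : V -> R) : continuous f ->
    leb.-integrable Omega (EFin \o (fun x => \1_(cbox a b) x * f x)).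
  move=> cf; have bf := continuous_bounded_measurable Omega_bounded cf.
  have intf := bounded_measurable_integrable mOmega
    (Omega_lty Omega_open Omega_bounded) bf.
  under [X in _.-integrable _ (EFin \o X)]eq_fun do rewrite mulrC.
  apply: integrable_bounded_measurable => //; split.
    exact: measurable_funTS.
  by exists 1 => x _; rewrite indicE; case: (_ \in _); rewrite ?normr1 ?normr0.
split.
- exact: intB.
- by move=> j; apply: intB; exact: cst_continuous.
- move=> x xT; apply: cbox_piece_continuous => // l.
  by have [aT bT] := abT l; split; apply/eqP => xl; apply: xT;
    [exists (l, a 0 l)|exists (l, b 0 l)].
- move=> j A mA AT; apply: (@eq_trans _ _ (0 + (-1)%:E * 0)%E); last first.
    by rewrite mule0 adde0.
  have [aT bT] := abT j; congr (_ + _ * _)%E.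
    apply: (saP j).1 => // x /AT xT; apply/eqP => xa; apply: xT.
    by exists (j, a 0 j).
  apply: (sbP j).1 => // x /AT xT; apply/eqP => xb; apply: xT.
  by exists (j, b 0 j).
- move=> phi phiC j.
  have bphi := C1c_bounded_measurable Omega_bounded phiC.
  rewrite cintegral_add// cintegral_scale//.
  rewrite (saP j).2// (sbP j).2//.
  set Ia := \int[_]_(x in cbox _ _) _; set Ib := \int[_]_(x in cbox _ _) _.
  pose psi x := affine alpha beta k x * phi x.
  have dphi x : derivable phi x (axis R j) by exact: (C1c_derivable phiC).
  have daff x := is_derive_affine alpha beta k j x.
  have daff' x : derivable (affine alpha beta k) x (axis R j).
    by case: (daff x).
  have dpsi x : derivable psi x (axis R j).
    exact: (derivableM (daff' x) (dphi x)).
  have psiE x : 'D_(axis R j) psi x = affine alpha beta k x *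
      'D_(axis R j) phi x + (alpha * (j == k)%:R) * phi x.
    rewrite (deriveM (daff' x) (dphi x)) derive_val.
    by rewrite -[LHS]/(affine alpha beta k x * _ + phi x * _) [X in _ + X]mulrC.
  have cphi := C1c_continuous phiC.
  have cdphi : continuous ('D_(axis R j) phi).
    exact: (C1c_derive_continuous phiC).
  have cpsi : continuous psi.
    by move=> x; exact: (continuousM (caff x) (cphi x)).
  have cdpsi : continuous ('D_(axis R j) psi).
    rewrite (_ : 'D_(axis R j) psi = fun x => affine alpha beta k x *
      'D_(axis R j) phi x + (alpha * (j == k)%:R) * phi x).
      2: by apply/funext => x; exact: psiE.
    move=> x.
    apply: (@continuousD _ _ _ (fun x => affine alpha beta k x *
      'D_(axis R j) phi x) (fun x => (alpha * (j == k)%:R) * phi x)).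
      exact: (continuousM (caff x) (cdphi x)).
    apply: (@continuousM _ _ (cst (alpha * (j == k)%:R)) phi).
      exact: cst_continuous.
    exact: cphi.
  have E : \int[leb]_(x in cbox a b) 'D_(axis R j) psi x = Ib - Ia.
    exact: (integral_cbox_derive ab cpsi dpsi cdpsi).
  suff : \int[leb]_(x in cbox a b) 'D_(axis R j) psi x =
      \int[leb]_(x in Omega) (\1_(cbox a b) x * affine alpha beta k x *
        'D_(axis R j) phi x) +
      \int[leb]_(x in Omega) (\1_(cbox a b) x * (alpha * (j == k)%:R) * phi x).
    by rewrite E => E'; lra.
  rewrite -RintegralD//; last 2 first.
  - apply: integrable_bounded_measurable; [exact: mOmega|exact: intB|].
    exact: C1c_derive_bounded_measurable.
  - apply: integrable_bounded_measurable; [exact: mOmega| |exact: bphi].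
    by apply: intB; exact: cst_continuous.
  (* The box may leave Omega: there phi and its derivative vanish, so integrating over the box or
     over Omega is the same. *)
  rewrite [LHS]Rintegral_mkcond [RHS]Rintegral_mkcond.
  apply: eq_Rintegral => x _; rewrite !patchE indicE psiE.
  case: ifPn => xB; case: ifPn => // xO; rewrite ?mul0r ?addr0 ?mul1r//.
  have nOx : ~ Omega x by move=> Ox; move/negP: xO; apply; rewrite inE.
  by rewrite (C1c_out phiC)// (C1c_derive_out phiC)// !mulr0 addr0.
Qed.

End box_piece.

(** * Approximating integrable fields by gradients *)

Section gradient_approximation.
Variables (R : realType) (N : nat) (Omega : set 'rV[R]_N).
Hypotheses (Omega_open : open Omega) (Omega_bounded : bounded_set Omega).
Local Notation V := 'rV[R]_N.
Local Notation leb := (lebesgue_rV R N).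
Implicit Types (a b x : V) (j k l : 'I_N) (t : R) (f g w : V -> R).
Implicit Types (T : seq ('I_N * R)).

Let mOmega : measurable Omega. Proof. exact: open_measurable_mx. Qed.
Let Omega_fin : (leb Omega < +oo)%E. Proof. exact: Omega_lty. Qed.
Local Notation integrable f := (leb.-integrable Omega (EFin \o f)).

Definition L1norm f := \int[leb]_(x in Omega) `|f x|.

Lemma L1norm_ge0 f : 0 <= L1norm f.
Proof. exact: Rintegral_ge0. Qed.

Lemma le_L1norm f g : integrable f -> integrable g ->
  (forall x, Omega x -> `|f x| <= `|g x|) -> L1norm f <= L1norm g.
Proof. by move=> fi gi fg; apply: le_Rintegral => //; exact: integrable_norm. Qed.

Lemma eq_L1norm f g : (forall x, Omega x -> f x = g x) -> L1norm f = L1norm g.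
Proof. by move=> fg; apply: eq_Rintegral => x /[!inE] /fg ->. Qed.

Lemma L1normD f g : integrable f -> integrable g ->
  L1norm (fun x => f x + g x) <= L1norm f + L1norm g.
Proof.
move=> fi gi; rewrite -RintegralD//; [|exact: integrable_norm..].
apply: le_Rintegral => //; first exact/integrable_norm/integrableRD.
  by apply: integrableRD => //; exact: integrable_norm.
by move=> x _; exact: ler_normD.
Qed.

Lemma L1normZ r f : integrable f -> L1norm (fun x => r * f x) = `|r| * L1norm f.
Proof.
move=> fi; rewrite -RintegralZl//; last exact: integrable_norm.
by apply: eq_Rintegral => x _; rewrite normrM.
Qed.

Definition piecewise T w F := exists sigma, piecewise_C1 Omega T w F sigma.

Lemma piecewise_sum (I : eqType) (r : seq I) T (w : I -> V -> R)
    (F : I -> 'I_N -> V -> R) :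
  {in r, forall i, piecewise T (w i) (F i)} ->
  piecewise T (fun x => \sum_(i <- r) w i x) (fun l x => \sum_(i <- r) F i l x).
Proof.
elim: r => [|i r IHr] H.
  exists (fun=> czero).
  rewrite (_ : (fun x => _) = cst 0); last by apply/funext => x; rewrite big_nil.
  rewrite (_ : (fun l x => _) = fun=> cst 0); last first.
    by apply/funext => l; apply/funext => x; rewrite big_nil.
  exact: piecewise_C1_0.
have [s sP] := IHr (fun i' kr => H i' (mem_behead (s := i :: r) kr)).
have [s' s'P] := H i (mem_head i r).
exists (fun j => cadd (s' j) (s j)).
rewrite (_ : (fun x => _) = fun x => w i x + \sum_(i <- r) w i x); last first.
  by apply/funext => x; rewrite big_cons.
rewrite (_ : (fun l x => _) = fun l x => F i l x + \sum_(i <- r) F i l x).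
  exact: piecewise_C1_add.
by apply/funext => l; apply/funext => x; rewrite big_cons.
Qed.

(** The field f e_j is an L^1 limit of gradients of piecewise smooth functions tending to 0 in L^1;
    the boolean under [*+] is the Kronecker symbol. This property is stable under linear
    combinations and L^1 limits, so that only boxes call for a construction. *)
Definition gradient_approx j f := forall e, 0 < e ->
  exists T w F, [/\ piecewise T w F, L1norm w <= e &
    forall l, L1norm (fun x => F l x - f x *+ (l == j)) <= e].

Lemma piecewise_integrable T w F : piecewise T w F ->
  integrable w /\ forall l, integrable (F l).
Proof. by move=> [s [wi Fi _ _ _]]. Qed.

Lemma integrable_mulrb f (b : bool) : integrable f ->
  integrable (fun x => f x *+ b).
Proof.
by case: b => // _; exact: (bounded_measurable_integrable mOmega Omega_fin
    (bounded_measurable_cst _ 0)).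
Qed.

Lemma gradient_approx_close j f : integrable f ->
  (forall e, 0 < e -> exists g, [/\ integrable g, gradient_approx j g &
    L1norm (fun x => g x - f x) <= e]) ->
  gradient_approx j f.
Proof.
move=> fi H e e0; have e20 : 0 < e / 2 by rewrite divr_gt0.
have [g [gi gj gf]] := H _ e20; have [T [w [F [pw wn Fn]]]] := gj _ e20.
have [wi Fi] := piecewise_integrable pw.
exists T, w, F; split => //; first by rewrite (le_trans wn)// ler_pdivrMr// ler_pMr// ler1n.
move=> l; rewrite [e]splitr.
rewrite (@eq_L1norm _ (fun x => (F l x - g x *+ (l == j)) +
    (g x - f x) *+ (l == j))); last first.
  by move=> x _; rewrite mulrnBl addrA subrK.
apply: (le_trans (L1normD _ _)).
- by apply: integrableRB => //; exact: integrable_mulrb.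
- by apply: integrable_mulrb; exact: integrableRB.
rewrite lerD// (le_trans _ gf)//; apply: le_L1norm.
- by apply: integrable_mulrb; exact: integrableRB.
- exact: integrableRB.
- by move=> x _; case: (l == j) => //; rewrite mulr0n normr0.
Qed.

Lemma gradient_approxD j f g : integrable f -> integrable g ->
  gradient_approx j f -> gradient_approx j g ->
  gradient_approx j (fun x => f x + g x).
Proof.
move=> fi gi fj gj e e0; have e20 : 0 < e / 2 by rewrite divr_gt0.
have [T [w [F [[s pw] wn Fn]]]] := fj _ e20.
have [T' [w' [F' [[s' pw'] wn' Fn']]]] := gj _ e20.
have [wi Fi] := piecewise_integrable (ex_intro _ s pw).
have [wi' Fi'] := piecewise_integrable (ex_intro _ s' pw').
exists (T ++ T'), (fun x => w x + w' x), (fun l x => F l x + F' l x); split.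
- exists (fun j => cadd (s j) (s' j)); apply: piecewise_C1_add => //.
    by apply: piecewise_C1_mono pw => p pT; rewrite mem_cat pT.
  by apply: piecewise_C1_mono pw' => p pT; rewrite mem_cat pT orbT.
- by rewrite [e]splitr (le_trans (L1normD _ _))// lerD.
- move=> l; rewrite [e]splitr.
  rewrite (@eq_L1norm _ (fun x => (F l x - f x *+ (l == j)) +
    (F' l x - g x *+ (l == j)))); last first.
    by move=> x _; rewrite mulrnDl; ring.
  apply: (le_trans (L1normD _ _)).
  + by apply: integrableRB => //; exact: integrable_mulrb.
  + by apply: integrableRB => //; exact: integrable_mulrb.
  + by rewrite lerD.
Qed.

Lemma gradient_approxZ j r f : integrable f ->
  gradient_approx j f -> gradient_approx j (fun x => r * f x).
Proof.
move=> fi fj e e0; have d0 : 0 < e / (`|r| + 1).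
  by rewrite divr_gt0// ltr_wpDl.
have rd : `|r| * (e / (`|r| + 1)) <= e.
  have r0 : 0 < `|r| + 1 by rewrite ltr_wpDl.
  by rewrite mulrCA -[leRHS]mulr1 ler_pM2l// ler_pdivrMr// mul1r lerDl.
have [T [w [F [[s pw] wn Fn]]]] := fj _ d0.
have [wi Fi] := piecewise_integrable (ex_intro _ s pw).
exists T, (fun x => r * w x), (fun l x => r * F l x); split.
- by exists (fun j => cscale r (s j)); exact: piecewise_C1_scale.
- by rewrite L1normZ// (le_trans _ rd)// ler_wpM2l.
- move=> l.
  rewrite (@eq_L1norm _ (fun x => r * (F l x - f x *+ (l == j)))); last first.
    by move=> x _; rewrite mulrBr mulrnAr.
  rewrite L1normZ; first by rewrite (le_trans _ rd)// ler_wpM2l.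
  by apply: integrableRB => //; exact: integrable_mulrb.
Qed.

Lemma eq_gradient_approx j f g : (forall x, Omega x -> f x = g x) ->
  gradient_approx j f -> gradient_approx j g.
Proof.
move=> fg fj e /fj[T [w [F [pw wn Fn]]]]; exists T, w, F; split => // l.
rewrite (le_trans _ (Fn l))// le_eqVlt; apply/orP; left; apply/eqP.
by apply: eq_L1norm => x /fg ->.
Qed.

Lemma gradient_approx0 j : gradient_approx j (cst 0).
Proof.
move=> e e0; exists [::], (cst 0), (fun=> cst 0); split.
- by exists (fun=> czero); exact: piecewise_C1_0.
- by rewrite /L1norm /= normr0 Rintegral_cst// mul0r ltW.
- move=> l; rewrite (@eq_L1norm _ (cst 0)).
    by rewrite /L1norm /= normr0 Rintegral_cst// mul0r ltW.
  by move=> x _ /=; rewrite mul0rn subr0.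
Qed.

Lemma gradient_approx_sum j (I : Type) (s : seq I) (f : I -> V -> R) :
  (forall i, integrable (f i)) -> (forall i, gradient_approx j (f i)) ->
  gradient_approx j (fun x => \sum_(i <- s) f i x).
Proof.
move=> fi fj; elim: s => [|i s IHs].
  apply: eq_gradient_approx (gradient_approx0 j) => x _.
  by rewrite big_nil.
apply: (@eq_gradient_approx _ (fun x => f i x + \sum_(i <- s) f i x)).
  by move=> x _; rewrite big_cons.
by apply: gradient_approxD => //; exact: integrableR_sum.
Qed.

End gradient_approximation.

Section gradient_density.
Variables (R : realType) (N : nat) (Omega : set 'rV[R]_N).
Hypotheses (Omega_open : open Omega) (Omega_bounded : bounded_set Omega).
Local Notation V := 'rV[R]_N.
Local Notation leb := (lebesgue_rV R N).
Implicit Types (a b x : V) (j k l : 'I_N) (t : R) (f g w : V -> R).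

Let mOmega : measurable Omega. Proof. exact: open_measurable_mx. Qed.
Let Omega_fin : (leb Omega < +oo)%E. Proof. exact: Omega_lty. Qed.
Local Notation integrable f := (leb.-integrable Omega (EFin \o f)).

Lemma integrable_indic_Omega (A : set V) : measurable A -> integrable (\1_A : V -> R).
Proof.
move=> mA; apply: bounded_measurable_integrable => //; split.
  exact: measurable_funTS.
by exists 1 => x _; rewrite indicE; case: (_ \in _); rewrite ?normr1 ?normr0.
Qed.

Lemma integrable_indic_cbox a b : leb.-integrable setT (EFin \o (\1_(cbox a b) : V -> R)).
Proof.
apply/integrableP; split; first (apply/measurable_EFinP;
  by apply: measurable_indic; exact: measurable_cbox).
under eq_integral do rewrite /= ger0_norm//.
rewrite integral_indic//; last exact: measurable_cbox.
by rewrite setIT lebesgue_cbox_lty.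
Qed.

Lemma Rintegral_cbox a b : (forall l, a 0 l <= b 0 l) ->
  \int[leb]_(x in setT) (\1_(cbox a b) x) = \prod_(l < N) (b 0 l - a 0 l).
Proof.
move=> ab; rewrite /Rintegral integral_indic ?setIT//; last exact: measurable_cbox.
by rewrite [X in fine X]lebesgue_rV_box.
Qed.

Lemma interval_cover n (c : nat -> R) t : (0 < n)%N -> c 0%N <= t <= c n ->
  exists2 r, (r < n)%N & c r <= t <= c r.+1.
Proof.
elim: n => // n IHn _ /andP[c0t tcn].
have [cnt|tcn'] := leP (c n) t; first by exists n => //; rewrite cnt.
have n0 : (0 < n)%N by case: n tcn' {IHn tcn} => // /(le_lt_trans c0t); rewrite ltxx.
have [|r rn crt] := IHn n0 _; first by rewrite c0t ltW.
by exists r => //; rewrite ltnS ltnW.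
Qed.

(** A sawtooth: the box is cut into M slabs of width d across the axis j, and w = x_j - c_r on the
    r-th slab. Its gradient is e_j on each slab whatever d, while its values are at most d. *)
Lemma gradient_approx_cbox j a b : (forall l, a 0 l <= b 0 l) ->
  gradient_approx Omega j (\1_(cbox a b)).
Proof.
move=> ab e e0.
pose P := \prod_(l < N | l != j) (b 0 l - a 0 l).
pose W := b 0 j - a 0 j.
have W0 : 0 <= W by rewrite subr_ge0.
have P0 : 0 <= P by apply: prodr_ge0 => l _; rewrite subr_ge0.
(* The norm of w is at most d times the volume W P, that is W (W P) / M, which this M brings below
   e. *)
pose M := (Num.truncn (W * (W * P) / e)).+1.
have M0 : 0 < M%:R :> R by rewrite ltr0n.
pose d := W / M%:R.
have d0 : 0 <= d by rewrite divr_ge0// ltW.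
have Md : M%:R * d = W by rewrite mulrCA divff ?mulr1// gt_eqF.
pose c r := a 0 j + r%:R * d.
have cS r : c r.+1 = c r + d by rewrite /c -natr1 mulrDl mul1r addrA.
pose B r := cbox (setc j (c r) a) (setc j (c r.+1) b).
have Bab r l : setc j (c r) a 0 l <= setc j (c r.+1) b 0 l.
  by rewrite !mxE; case: eqP => // _; rewrite cS lerDl.
have intB r : \int[leb]_(x in setT) (\1_(B r) x) = d * P.
  rewrite Rintegral_cbox// (bigD1 j)//= !mxE eqxx cS addrAC subrr add0r.
  by congr (_ * _); apply: eq_bigr => l /negbTE lj; rewrite !mxE lj.
have intBab : \int[leb]_(x in setT) (\1_(cbox a b) x) = W * P.
  by rewrite Rintegral_cbox// (bigD1 j).
(* Neighbouring closed slabs share a face, so S is larger than the indicator of the box there. Both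
   have integral W P and S is the larger one, so their L^1 distance is zero. *)
pose S x : R := \sum_(r < M) \1_(B r) x.
have Si : leb.-integrable setT (EFin \o S).
  by apply: integrableR_sum => // r; exact: integrable_indic_cbox.
have intS : \int[leb]_(x in setT) S x = W * P.
  rewrite -Md -mulrA /S; elim: (M) => [|n IHn].
    under eq_Rintegral do rewrite big_ord0.
    by rewrite Rintegral_cst// !mul0r.
  under eq_Rintegral do rewrite big_ord_recr/=.
  rewrite RintegralD//; last exact: integrable_indic_cbox.
    by rewrite IHn intB -natr1 mulrDl mul1r.
  by apply: integrableR_sum => // r; exact: integrable_indic_cbox.
have S1 x : \1_(cbox a b) x <= S x.
  rewrite indicE; have [|_] := boolP (x \in cbox a b).
    2: by rewrite sumr_ge0.
  rewrite inE => xab.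
  have [|r rM crx] := @interval_cover M c (x 0 j) isT.
    rewrite /c mul0r addr0 Md /W addrC subrK.
    by have := xab j; rewrite in_itv.
  rewrite /S (bigD1 (Ordinal rM))//= indicE mem_set ?lerDl ?sumr_ge0//.
  move=> l; rewrite !mxE; case: eqP => [->|_]; last exact: xab.
  by rewrite in_itv.
(* Norms on Omega are bounded by integrals over the whole space, where the volumes of the slabs are
   explicit. *)
have leS f : leb.-integrable setT (EFin \o f) -> (forall x, 0 <= f x) ->
    L1norm Omega f <= \int[leb]_(x in setT) f x.
  move=> fi f0; rewrite /L1norm /Rintegral fine_le//.
  - apply: integrable_fin_num => //; apply: (integrableS measurableT) => //.
    exact: integrable_norm.
  - exact: integrable_fin_num.
  under eq_integral do rewrite ger0_norm//.
  apply: ge0_subset_integral => //; first exact: measurable_int fi.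
  by move=> x _; rewrite lee_fin.
pose w x : R := \sum_(r < M) \1_(B r) x * affine 1 (- c r) j x.
pose F l x : R := \sum_(r < M) \1_(B r) x * (1 * (l == j)%:R).
pose T := [seq (l, a 0 l) | l <- enum 'I_N] ++ [seq (l, b 0 l) | l <- enum 'I_N]
  ++ [seq (j, c r) | r <- iota 0 M.+1].
have pw : piecewise Omega T w F.
  apply: (@piecewise_sum _ _ _ _ _ 'I_M _ T
    (fun r x => \1_(B r) x * affine 1 (- c r) j x)
    (fun r l x => \1_(B r) x * (1 * (l == j)%:R))) => // r _.
  have rM := ltn_ord r.
  apply: piecewise_C1_box => // l; rewrite !mxE !mem_cat; split; case: eqP => [->|_].
  - by rewrite (map_f (fun r => (j, c r))) ?orbT// mem_iota/= ltnW.
  - by rewrite (map_f (fun l => (l, a 0 l))) ?mem_enum.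
  - by rewrite (map_f (fun r => (j, c r))) ?orbT// mem_iota.
  - by rewrite (map_f (fun l => (l, b 0 l))) ?mem_enum ?orbT.
have [wi Fi] := piecewise_integrable pw.
exists T, w, F; split => //.
- have dSi : leb.-integrable setT (EFin \o (fun x => d * S x)) by exact: integrableRZ.
  have dS0 x : 0 <= d * S x by rewrite mulr_ge0// sumr_ge0.
  apply: (@le_trans _ _ (L1norm Omega (fun x => d * S x))).
    apply: le_L1norm => //; first exact: (integrableS measurableT).
    move=> x _; rewrite (ger0_norm (dS0 x)) (le_trans (ler_norm_sum _ _ _))//.
    rewrite mulr_sumr ler_sum// => r _.
    rewrite indicE; have [|_] := boolP (x \in B r); last first.
      by rewrite mul0r normr0 mulr0.
    rewrite inE => /(_ j); rewrite !mxE eqxx in_itv/= cS => /andP[cx xc].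
    by rewrite mul1r mulr1 /affine mul1r ger0_norm ?subr_ge0// lerBlDl.
  apply: (le_trans (leS _ dSi dS0)); rewrite RintegralZl// intS.
  rewrite /d mulrAC ler_pdivrMr// mulrC -ler_pdivrMl// mulrC.
  by rewrite [leLHS]mulrC ltW// /M truncnS_gt.
- move=> l; have [->|lj] := eqVneq l j; last first.
    rewrite (@eq_L1norm _ _ _ _ (cst 0)).
      by rewrite /L1norm /= normr0 Rintegral_cst// mul0r ltW.
    move=> x _; rewrite mulr0n subr0 /F big1// => r _.
    by rewrite (negbTE lj) !mulr0.
  rewrite (@eq_L1norm _ _ _ _ (fun x => S x - \1_(cbox a b) x)); last first.
    move=> x _; rewrite mulr1n /F /S; congr (_ - _).
    by apply: eq_bigr => r _; rewrite eqxx !mulr1.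
  have SBi := integrableRB measurableT Si (integrable_indic_cbox a b).
  apply: (le_trans (leS _ SBi _)); first by move=> x; rewrite subr_ge0.
  rewrite RintegralB//; last exact: integrable_indic_cbox.
  by rewrite intS intBab subrr ltW.
Qed.

End gradient_density.

Section gradient_dense.
Variables (R : realType) (N : nat) (Omega : set 'rV[R]_N).
Hypotheses (Omega_open : open Omega) (Omega_bounded : bounded_set Omega).
Local Notation V := 'rV[R]_N.
Local Notation leb := (lebesgue_rV R N).
Implicit Types (a b x : V) (j l : 'I_N) (t : R) (f g w : V -> R).

Let mOmega : measurable Omega. Proof. exact: open_measurable_mx. Qed.
Let Omega_fin : (leb Omega < +oo)%E. Proof. exact: Omega_lty. Qed.
Local Notation integrable f := (leb.-integrable Omega (EFin \o f)).

(** Dynkin's pi-lambda theorem from the closed boxes, which are stable under intersection: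
    complements by linearity, disjoint unions by an L^1 limit. *)
Lemma gradient_approx_indic j (A : set V) : measurable A ->
  gradient_approx Omega j (\1_A).
Proof.
pose G := [set B : set V | exists a b, B = cbox a b].
pose P (A : set V) := gradient_approx Omega j (\1_A).
have indic_int := integrable_indic_Omega Omega_open Omega_bounded.
have PG : G `<=` P.
  move=> _ [a [b ->]].
  have [->|/set0P[x /cbox_le]] := eqVneq (cbox a b) set0; last first.
    exact: gradient_approx_cbox.
  rewrite /P indic0; exact: gradient_approx0.
(* On Omega, the indicator of the whole space is that of a large box. *)
have PT : P setT.
  have [M M0 MO] := bounded_cbox Omega_bounded.
  apply: (@eq_gradient_approx _ _ _ _ (\1_(cbox (const_mx (- M)) (const_mx M)))).
    move=> x Ox; rewrite !indicE in_setT mem_set// => l.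
    by rewrite !mxE in_itv/= -ler_norml ltW// MO.
  apply: gradient_approx_cbox => // l.
  by rewrite !mxE ge0_cp// ltW.
have mG : @measurable _ V = <<s G >>.
  apply: (measurable_generated (@sub_obox_cbox R N)).
  - by move=> a b.
  - by move=> a b; exists a, b.
  - by move=> _ [a [b ->]]; exact: measurable_cbox.
move=> mA; suff : <<s G >> `<=` P by apply; rewrite -mG.
apply: (dynkin_induction mG) => //.
- by move=> _ _ [a [b ->]] [a' [b' ->]]; rewrite cboxI; eexists; eexists.
- move=> S mS PS.
  apply: (@eq_gradient_approx _ _ _ _ (fun x => \1_setT x + (-1) * \1_S x)).
    move=> x _; rewrite !indicE in_setT in_setC.
    by case: (x \in S); rewrite /= ?mulr1 ?mulr0 ?subrr ?addr0.
  apply: gradient_approxD => //; first exact: indic_int.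
    by apply: integrableRZ => //; exact: indic_int.
  by apply: gradient_approxZ => //; exact: indic_int.
move=> F mF tF PF.
set U := \bigcup_k F k.
have mU : measurable U by exact: bigcup_measurable.
pose h n x : R := \sum_(k < n) \1_(F k) x.
have hi n : integrable (h n) by apply: integrableR_sum => // k; exact: indic_int.
have hP n : gradient_approx Omega j (h n).
  by apply: gradient_approx_sum => // k; [exact: indic_int|exact: PF].
have hU n x : h n x <= \1_U x.
  rewrite /h; have [[k Fkx]|nF] := pselect (exists k : 'I_n, F k x).
    rewrite (bigD1 k)//= big1 ?addr0; last first.
      move=> i ik; rewrite indicE memNset// => Fix; move/eqP: ik; apply.
      apply/val_inj/eqP; apply: contraT => ik.
      have /trivIsetP/(_ i k I I ik)/seteqP[H _] := tF.
      by have := H x (conj Fix Fkx).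
    by rewrite !indicE !mem_set//; exists k.
  rewrite big1// => k _; rewrite indicE memNset// => Fkx; apply: nF; by exists k.
(* The distance from a partial sum to the indicator of the union is the mass in Omega of the
   remaining sets, which tends to 0 by additivity since Omega has finite measure. *)
have normE n : L1norm Omega (fun x => h n x - \1_U x) =
    fine (leb (U `&` Omega)) - \sum_(k < n) fine (leb (F k `&` Omega)).
  transitivity (\int[leb]_(x in Omega) (\1_U x - h n x)).
    by apply: eq_Rintegral => x _; rewrite distrC ger0_norm ?subr_ge0.
  rewrite RintegralB//; last exact: indic_int.
  congr (_ - _); first by rewrite /Rintegral integral_indic.
  rewrite /h; elim: n => [|n IHn].
    under eq_Rintegral do rewrite big_ord0.
    by rewrite Rintegral_cst// mul0r big_ord0.
  under eq_Rintegral do rewrite big_ord_recr/=.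
  rewrite big_ord_recr/= RintegralD//; last exact: indic_int.
    by rewrite IHn; congr (_ + _); rewrite /Rintegral integral_indic.
  by apply: integrableR_sum => // k; exact: indic_int.
have fin (A' : set V) : measurable A' -> leb (A' `&` Omega) \is a fin_num.
  move=> mA'; rewrite ge0_fin_numE//; apply: le_lt_trans Omega_fin.
  by rewrite le_measure ?inE//; exact: measurableI.
have cvgU : \sum_(0 <= k < n) fine (leb (F k `&` Omega)) @[n --> \oo] -->
    fine (leb (U `&` Omega)).
  have mFO i : measurable (F i `&` Omega) by exact: measurableI.
  have tFO : trivIset [set: nat] (fun i => F i `&` Omega).
    exact: trivIset_setIr.
  have := @measure_semi_sigma_additive _ _ _ leb (fun i : nat => F i `&` Omega)
    mFO.
  rewrite -setI_bigcupl => /(_ tFO (measurableI _ _ mU mOmega)) H.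
  have {}H : (\sum_(0 <= i < n) leb (F i `&` Omega))%E @[n --> \oo] -->
      (fine (leb (U `&` Omega)))%:E by rewrite fineK ?fin.
  apply: cvg_trans (fine_cvg H).
  apply: near_eq_cvg; apply: nearW => n /=.
  elim: n => [|n IHn]; first by rewrite !big_geq.
  rewrite !big_nat_recr//= fineD ?IHn//; last exact: fin.
  by apply/sum_fin_numP => i _ _; exact: fin.
apply: gradient_approx_close => //; first exact: indic_int.
move=> e e0; move/cvgrPdist_le : cvgU => /(_ e e0)[n _ /(_ n)].
rewrite /= leqnn => /(_ isT) dn; exists (h n); split => //.
by rewrite normE -(big_mkord xpredT (fun i : nat => fine (leb (F i `&` Omega)))) (le_trans (ler_norm _)).
Qed.

Import HBSimple.

Lemma gradient_dense j f : integrable f -> gradient_approx Omega j f.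
Proof.
move=> fi; apply: gradient_approx_close => // e e0.
have [g [gi _ gf]] := approximation_sfun_integrable mOmega fi.
have /fine_cvgP[_ /cvgrPdist_le/(_ e e0)[n _ /(_ n)]/=] := gf.
rewrite leqnn => /(_ isT) gn; exists (g n); split.
- exact: gi.
- have mgy y : measurable (g n @^-1` [set y]) by [].
  suff H : gradient_approx Omega j (fun x : V =>
      \sum_(y <- fset_set (range (g n))) y * \1_(g n @^-1` [set y]) x).
    apply: eq_gradient_approx H => x _.
    by rewrite [RHS]fimfunE fsbig_finite.
  apply: gradient_approx_sum => // y.
    by apply: integrableRZ => //; exact: integrable_indic_Omega.
  apply: gradient_approxZ => //; first exact: integrable_indic_Omega.
  exact: gradient_approx_indic.
- move: gn; rewrite sub0r normrN; apply: le_trans.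
  apply: le_trans (ler_norm _); rewrite le_eqVlt; apply/orP; left; apply/eqP.
  by congr fine; apply: eq_integral => x _; rewrite /= distrC.
Qed.

End gradient_dense.

(** * Uniqueness of the distributional derivative *)

Section bump.
Variable R : realType.
Implicit Types (s t h : R).

(** A C^1 function that vanishes exactly on the nonpositive half-line. As test functions are only
    C^1, bumps can be built from it with polynomials. *)
Definition posq t : R := Num.max 0 t ^+ 2.

Lemma posq_ge0 t : 0 <= posq t. Proof. exact: sqr_ge0. Qed.

Lemma is_derive_posq t : is_derive t 1 posq (2 * Num.max 0 t).
Proof.
have H : h^-1 *: (posq (h *: 1 + t) - posq t) @[h --> 0^'] --> 2 * Num.max 0 t.
  apply/cvgrPdist_le => e e0; near=> h.
  have h0 : h != 0 by near: h; exact: nbhs_dnbhs_neq.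
  have he : `|h| <= e.
    near: h; apply: dnbhs0_le => //.
  rewrite [_ *: _](_ : _ = h^-1 * (posq (h + t) - posq t)); last first.
    by rewrite [h%:A]mulr1.
  rewrite -(ler_pM2l (x := `|h|)) ?normr_gt0// -normrM mulrBr mulVKf//.
  (* In each of the sign cases for t and t + h, the first-order remainder of [posq] is at most
     h^2. *)
  apply: (@le_trans _ _ (h ^+ 2)).
    rewrite /posq /Num.max; do 2 case: ltP => ?; rewrite ler_norml; apply/andP; split; nra.
  by rewrite -real_normK ?num_real// expr2 ler_wpM2l.
split; first by apply/cvg_ex; exists (2 * Num.max 0 t).
exact: cvg_lim H.
Unshelve. all: by end_near. Qed.

Definition C1R (g : R -> R) := exists2 g' : R -> R,
  continuous g' & forall t, is_derive t 1 g (g' t).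

Lemma C1R_posq : C1R posq.
Proof.
exists (fun t => 2 * Num.max 0 t); last exact: is_derive_posq.
move=> t; apply: (@continuousM _ _ (cst 2) (fun t => Num.max 0 t)).
  exact: cst_continuous.
apply: (@continuous_max _ _ (cst 0) id); first exact: cst_continuous.
by move=> ?; exact: cvg_id.
Qed.

Lemma C1R_affine s t : C1R (fun u => s + t * u).
Proof.
exists (cst t); first exact: cst_continuous.
move=> u; have := is_deriveD (is_derive_cst s u 1) (is_deriveZ t (is_derive_id u 1)).
by move=> /is_derive_eq; apply; rewrite add0r; exact: mulr1.
Qed.

Lemma C1R_comp (f g : R -> R) : C1R f -> C1R g -> C1R (g \o f).
Proof.
move=> [f' cf' df] [g' cg' dg]; exists (fun t => g' (f t) * f' t).
  move=> t; apply: (@continuousM _ _ (g' \o f) f'); last exact: cf'.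
  apply: continuous_comp; last exact: cg'.
  apply: differentiable_continuous; apply/derivable1_diffP.
  by case: (df t).
by move=> t; exact: is_derive1_comp (dg (f t)) (df t).
Qed.

End bump.

Section C1V.
Variables (R : realType) (N : nat).
Local Notation V := 'rV[R]_N.
Implicit Types (f g : V -> R) (j : 'I_N).

Definition C1V f := (forall x, differentiable f x) /\
  forall j, continuous ('D_(axis R j) f).

Lemma C1V_derivable f j x : C1V f -> derivable f x (axis R j).
Proof. by move=> [df _]; exact: diff_derivable. Qed.

Lemma C1V_continuous f : C1V f -> continuous f.
Proof. by move=> [df _] x; exact: differentiable_continuous. Qed.

Lemma C1V_coord k : C1V (fun x => x 0 k).
Proof.
split=> [x|j]; first exact: differentiable_coord.
rewrite (_ : 'D_(axis R j) _ = cst (axis R j 0 k)); first exact: cst_continuous.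
by apply/funext => x; case: (is_derive_coord k x (axis R j)).
Qed.

Lemma C1V_cst (c : R) : C1V (cst c).
Proof.
split=> [x|j]; first exact: differentiable_cst.
rewrite (_ : 'D_(axis R j) _ = cst 0); first exact: cst_continuous.
by apply/funext => x; rewrite derive_cst.
Qed.

Lemma C1V_mul f g : C1V f -> C1V g -> C1V (fun x => f x * g x).
Proof.
move=> fC gC; split=> [x|j].
  by apply: differentiableM; [case: fC|case: gC].
rewrite (_ : 'D_(axis R j) _ =
    fun x => f x * 'D_(axis R j) g x + g x * 'D_(axis R j) f x).
  move=> x; apply: (@continuousD _ _ _ (fun x => f x * 'D_(axis R j) g x)
     (fun x => g x * 'D_(axis R j) f x)).
    by apply: continuousM; [exact: C1V_continuous|case: gC => _; exact].
  by apply: continuousM; [exact: C1V_continuous|case: fC => _; exact].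
apply/funext => x.
have df : derivable f x (axis R j) by exact: C1V_derivable.
have dg : derivable g x (axis R j) by exact: C1V_derivable.
by rewrite (deriveM df dg).
Qed.

Lemma C1V_comp f (g : R -> R) : C1R g -> C1V f -> C1V (fun x => g (f x)).
Proof.
move=> [g' cg' dg] fC.
have dgf t : differentiable g t by apply/derivable1_diffP; case: (dg t).
split=> [x|j]; first by apply: differentiable_comp => //; case: fC.
rewrite (_ : 'D_(axis R j) _ = fun x => 'D_(axis R j) f x * g' (f x)).
  move=> x; apply: (@continuousM _ _ ('D_(axis R j) f) (fun x => g' (f x))).
    by case: fC => _; exact.
  by apply: (@continuous_comp _ _ _ f g'); [exact: C1V_continuous|exact: cg'].
apply/funext => x; have [df _] := fC.
rewrite deriveE; last exact: differentiable_comp.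
rewrite (@diff_comp _ _ _ _ f g)//= [in RHS]deriveE// deriv1E; last first.
  by apply/derivable1_diffP.
by congr (_ * _); rewrite derive1E; case: (dg (f x)).
Qed.

Lemma C1V_prod (I : Type) (s : seq I) (f : I -> V -> R) :
  (forall i, C1V (f i)) -> C1V (fun x => \prod_(i <- s) f i x).
Proof.
move=> fC; elim: s => [|i s IHs].
  rewrite (_ : (fun x => _) = cst 1); first exact: C1V_cst.
  by apply/funext => x; rewrite big_nil.
rewrite (_ : (fun x => _) = fun x => f i x * \prod_(i <- s) f i x).
  exact: C1V_mul.
by apply/funext => x; rewrite big_cons.
Qed.

Lemma posq_eq0 (t : R) : (posq t == 0) = (t <= 0).
Proof. by rewrite /posq sqrf_eq0; case: leP => [|t0]; [rewrite eqxx|rewrite gt_eqF]. Qed.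

Lemma obox_bump (Omega : set V) (a b : V) : cbox a b `<=` Omega ->
  exists phi : nat -> V -> R, [/\ forall n, C1c Omega (phi n),
    forall n x, 0 <= phi n x <= 1 &
    forall x, phi n x @[n --> \oo] --> (\1_(obox a b) x : R)].
Proof.
move=> abO.
(* B is positive exactly on the open box. Then [phi n] is a C^1 function of B which is 0 where B = 0
   and 1 as soon as n B >= 1, so at each point the sequence is eventually constant. *)
pose B (x : V) : R := \prod_(j < N) (posq (x 0 j - a 0 j) * posq (b 0 j - x 0 j)).
pose phi (n : nat) (x : V) : R := 1 - posq (1 - n%:R * B x).
have B0 x : 0 <= B x by apply: prodr_ge0 => j _; rewrite mulr_ge0 ?posq_ge0.
have Bn0 x : (B x != 0) = (x \in obox a b).
  apply/idP/idP => [/prodf_neq0 H|/set_mem H].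
    rewrite inE => j; have := H j isT; rewrite mulf_eq0 negb_or !posq_eq0.
    by rewrite -!ltNge !subr_gt0 in_itv.
  apply/prodf_neq0 => j _; rewrite mulf_eq0 negb_or !posq_eq0 -!ltNge !subr_gt0.
  by have := H j; rewrite in_itv.
have posq1 n x : posq (1 - n%:R * B x) <= 1.
  rewrite /posq expr_le1// ?le_max ?lexx// ge_max ler01/= gerBl.
  by rewrite mulr_ge0.
have CB : C1V B.
  apply: C1V_prod => j; apply: C1V_mul.
    apply: (@C1V_comp (fun x => x 0 j) (fun u => posq (u - a 0 j))).
      have := C1R_comp (C1R_affine (- a 0 j) 1) (@C1R_posq R).
      rewrite (_ : _ \o _ = fun u => posq (u - a 0 j))//.
      by apply/funext => u /=; rewrite mul1r addrC.
    exact: C1V_coord.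
  apply: (@C1V_comp (fun x => x 0 j) (fun u => posq (b 0 j - u))).
    have := C1R_comp (C1R_affine (b 0 j) (-1)) (@C1R_posq R).
    rewrite (_ : _ \o _ = fun u => posq (b 0 j - u))//.
    by apply/funext => u /=; rewrite mulN1r.
  exact: C1V_coord.
have Cphi n : C1V (phi n).
  apply: (@C1V_comp B (fun u => 1 - posq (1 - n%:R * u))) => //.
  have := C1R_comp (C1R_comp (C1R_affine 1 (- n%:R)) (@C1R_posq R))
    (C1R_affine 1 (-1)).
  rewrite (_ : _ \o _ = fun u => 1 - posq (1 - n%:R * u))//.
  by apply/funext => u /=; rewrite mulN1r mulNr.
exists phi; split.
- move=> n; have [dphi cphi] := Cphi n; split => //.
  exists (cbox a b); split => //; first exact: compact_cbox.
  move=> x xB; have : B x == 0.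
    by apply/negPn; rewrite Bn0; apply/negP => /set_mem/sub_obox_cbox.
  move=> /eqP; rewrite /phi => ->.
  by rewrite mulr0 subr0 /posq max_r// expr1n subrr.
- by move=> n x; rewrite /phi subr_ge0 posq1/= gerBl posq_ge0.
- move=> x; rewrite indicE -Bn0; have [Bx0|Bx0] /= := eqVneq (B x) 0.
    apply: cvg_near_cst; apply: nearW => n; rewrite /phi Bx0.
    by rewrite mulr0 subr0 /posq max_r// expr1n subrr.
  have Bgt0 : 0 < B x by rewrite lt_neqAle eq_sym Bx0 B0.
  apply: cvg_near_cst; exists (Num.truncn (B x)^-1).+1 => // n /= Bn.
  rewrite /phi (_ : posq _ = 0) ?subr0//; apply/eqP; rewrite posq_eq0 subr_le0.
  rewrite -ler_pdivrMr// div1r (le_trans (ltW (truncnS_gt _)))//.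
  by rewrite ler_nat.
Qed.

End C1V.

Section uniqueness.
Variables (R : realType) (N : nat) (Omega : set 'rV[R]_N).
Hypotheses (Omega_open : open Omega) (Omega_bounded : bounded_set Omega).
Local Notation V := 'rV[R]_N.
Local Notation charge_rV := ({charge set V -> \bar R}).
Implicit Types (a b x : V) (A : set V).

Let mOmega : measurable Omega. Proof. exact: open_measurable_mx. Qed.

Lemma measure_obox_cvg (m : {measure set V -> \bar R}) a b (phi : nat -> V -> R) :
  (m Omega < +oo)%E -> cbox a b `<=` Omega ->
  (forall n, measurable_fun setT (phi n)) -> (forall n x, 0 <= phi n x <= 1) ->
  (forall x, phi n x @[n --> \oo] --> (\1_(obox a b) x : R)) ->
  \int[m]_(x in Omega) phi n x @[n --> \oo] --> fine (m (obox a b)).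
Proof.
move=> moo abO mphi phi01 phicvg.
have mO : measurable (obox a b) by exact: measurable_obox.
have [//| | | |//|_ _] := @dominated_convergence _ _ _ m Omega mOmega
  (fun n x => (phi n x)%:E) (fun x => (\1_(obox a b) x)%:E) (cst 1%E).
- by move=> n; apply/measurable_EFinP/measurable_funTS.
- by apply/measurable_EFinP/measurable_funTS.
- by apply: aeW => x _; apply/cvg_EFin; [exact: nearW|exact: phicvg].
- exact: (bounded_measurable_integrable mOmega moo (bounded_measurable_cst _ 1)).
- apply: aeW => x n _ /=; have /andP[p0 p1] := phi01 n x.
  by rewrite lee_fin ger0_norm.
rewrite integral_indic// setIidl; last first.
  by apply: subset_trans abO; exact: sub_obox_cbox.
rewrite -[X in _ --> X](@fineK _ (m (obox a b))); first exact: fine_cvg.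
rewrite ge0_fin_numE//; apply: le_lt_trans moo.
rewrite le_measure ?inE//.
by apply: subset_trans abO; exact: sub_obox_cbox.
Qed.

(** Bumps converge to the indicator of an open box whose closure lies in Omega, so the measures
    agree on such boxes; then on Borel subsets of each of them; then on A, since countably many of
    them cover Omega. *)
Lemma measure_unique_C1c (m1 m2 : {measure set V -> \bar R}) :
  (m1 Omega < +oo)%E -> (m2 Omega < +oo)%E ->
  (forall phi, C1c Omega phi ->
    \int[m1]_(x in Omega) phi x = \int[m2]_(x in Omega) phi x) ->
  forall A, measurable A -> A `<=` Omega -> m1 A = m2 A.
Proof.
move=> m1oo m2oo m12.
have fin (m : {measure set V -> \bar R}) A : (m Omega < +oo)%E ->
    measurable A -> A `<=` Omega -> m A \is a fin_num.
  move=> moo mA AO; rewrite ge0_fin_numE//; apply: le_lt_trans moo.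
  by rewrite le_measure ?inE.
have subO a b : cbox a b `<=` Omega -> obox a b `<=` Omega.
  by apply: subset_trans; exact: sub_obox_cbox.
have boxE a b : cbox a b `<=` Omega -> m1 (obox a b) = m2 (obox a b).
  move=> abO; have [phi [phiC phi01 phicvg]] := obox_bump abO.
  have mphi n : measurable_fun setT (phi n).
    by apply: continuous_measurable_mx; exact: C1c_continuous (phiC n).
  have c1 := measure_obox_cvg m1oo abO mphi phi01 phicvg.
  have c2 := measure_obox_cvg m2oo abO mphi phi01 phicvg.
  have mo : measurable (obox a b) by exact: measurable_obox.
  rewrite -[LHS]fineK; last by apply: fin => //; exact: subO.
  rewrite -[RHS]fineK; last by apply: fin => //; exact: subO.
  congr EFin; apply: (cvg_unique _ c1) => //.
  have -> : (fun n => \int[m1]_(x in Omega) phi n x) =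
      fun n => \int[m2]_(x in Omega) phi n x by apply/funext => n; exact: m12.
  exact: c2.
(* Restricted to one such box, the two measures are finite and agree on the open boxes, which are
   stable under intersection and generate the Borel sets. *)
have localE a b : cbox a b `<=` Omega -> forall A, measurable A ->
    m1 (A `&` obox a b) = m2 (A `&` obox a b).
  move=> abO A mA.
  have mab : measurable (obox a b) by exact: measurable_obox.
  pose G := [set B : set V | exists a b, B = obox a b].
  have oO c d : m1 (obox c d `&` obox a b) = m2 (obox c d `&` obox a b).
    rewrite oboxI; have [xE|] := eqVneq (obox c d `&` obox a b) set0.
      by rewrite -oboxI xE !measure0.
    move=> _; apply: boxE; apply: (subset_trans _ abO) => x H l.
    by move: (H l); rewrite !mxE !in_itv/= ge_max le_min =>
      /andP[/andP[_ ->] /andP[_ ->]].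
  have := @measure_unique _ _ _ G
    (fun n : nat => obox (const_mx (- n%:R)) (const_mx n%:R)) _ _ _ _
    (mrestr m1 mab) (mrestr m2 mab).
  apply => //.
  - apply: (measurable_generated (B := @obox R N)).
    + by move=> c d.
    + by move=> c d; exact: sub_obox_cbox.
    + by move=> c d; exists c, d.
    + by move=> _ [c [d ->]]; exact: measurable_obox.
  - by move=> _ _ [c [d ->]] [c' [d' ->]]; rewrite oboxI; eexists; eexists.
  - by move=> i; eexists; eexists.
  - apply/seteqP; split => // x _.
    pose M := \sum_l `|x 0 l|.
    exists (Num.truncn M).+1 => // l; rewrite !mxE in_itv/= -ltr_norml.
    rewrite (@le_lt_trans _ _ M)//; last exact: truncnS_gt.
    by rewrite /M (bigD1 l)//= lerDl sumr_ge0.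
  - by move=> _ [c [d ->]]; exact: oO.
  - move=> k; apply: le_lt_trans m1oo; rewrite /= /mrestr le_measure ?inE//.
      by apply: measurableI => //; exact: measurable_obox.
    by apply: (subset_trans _ (subO _ _ abO)); exact: subIsetr.
move=> A mA AO.
pose good (ab : V * V) := `[< cbox ab.1 ab.2 `<=` Omega >].
(* Rational boxes are enumerated by their codes; a number that codes no box, or a box whose closure
   leaves Omega, contributes the empty set. Overlaps are then removed by [seqDU]. *)
pose Bq (q : option ('rV[rat]_N * 'rV[rat]_N)) : set V := if q is Some ab then
  if good (map_mx ratr ab.1, map_mx ratr ab.2) then
    obox (map_mx ratr ab.1) (map_mx ratr ab.2) else set0 else set0.
pose B (n : nat) : set V := Bq (choice.unpickle n).
have BE n A' : measurable A' -> m1 (A' `&` B n) = m2 (A' `&` B n).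
  move=> mA'; rewrite /B; case: choice.unpickle => [[a b]|] /=; last first.
    by rewrite setI0 !measure0.
  case: ifP => [/asboolP abO|_]; first exact: localE.
  by rewrite setI0 !measure0.
have mB n : measurable (B n).
  rewrite /B; case: choice.unpickle => [[a b]|] /=; last exact: measurable0.
  by case: ifP => // _; exact: measurable_obox.
have AB : A = \bigcup_n (A `&` seqDU B n).
  rewrite -setI_bigcupr -seqDU_bigcup_eq; apply/seteqP; split => [x Ax|x [] //].
  split => //; have [a [b [abx abO]]] := open_rat_boxes Omega_open (AO _ Ax).
  exists (choice.pickle (a, b)) => //; rewrite /B choice.pickleK /=.
  by rewrite ifT//; apply/asboolP.
have mAB n : measurable (A `&` seqDU B n).
  by apply: measurableI => //; exact: seqDU_measurable.
have tAB : trivIset setT (fun n => A `&` seqDU B n).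
  by apply: trivIset_setIl; exact: trivIset_seqDU.
have mU : measurable (\bigcup_n (A `&` seqDU B n)) by exact: bigcup_measurable.
rewrite AB !measure_bigcup//; apply: eq_eseriesr => n _.
have -> : A `&` seqDU B n = (A `&` seqDU B n) `&` B n.
  apply/seteqP; split => x; last by case.
  by move=> [Ax Bx]; split => //; case: Bx.
exact: BE.
Qed.

Lemma eq_adde_sube (a b c d : \bar R) :
  a \is a fin_num -> b \is a fin_num -> c \is a fin_num -> d \is a fin_num ->
  (a + d = c + b -> a - b = c - d)%E.
Proof.
case: a b c d => [a| |] [b| |] [c| |] [d| |] // _ _ _ _.
by rewrite -!EFinB -!EFinD => -[?]; congr EFin; lra.
Qed.

(** Moving the negative parts across reduces the claim to the positive measures p1 + n2 and p2 +
    n1. *)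
Lemma charge_unique_C1c (nu1 nu2 : charge_rV) :
  (forall phi, C1c Omega phi ->
    cintegral Omega nu1 phi = cintegral Omega nu2 phi) ->
  forall A, measurable A -> A `<=` Omega -> nu1 A = nu2 A.
Proof.
move=> nu12 A mA AO.
have [p1 [n1 [nupn1 _]]] := cintegralE Omega nu1 (cst 0).
have [p2 [n2 [nupn2 _]]] := cintegralE Omega nu2 (cst 0).
have foo (m m' : {finite_measure set V -> \bar R}) :
    (measure_add m m' Omega < +oo)%E.
  rewrite [ltLHS](measure_addE m m') lte_add_pinfty//;
    exact: finite_measure_lty.
have := @measure_unique_C1c (measure_add p1 n2) (measure_add p2 n1)
  (foo _ _) (foo _ _) _ A mA AO.
rewrite [X in (_ -> X = _) -> _](measure_addE p1 n2) [X in (_ -> _ = X) -> _](measure_addE p2 n1).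
move=> H; rewrite nupn1// nupn2//.
have fin (m : {finite_measure set V -> \bar R}) : m A \is a fin_num.
  exact: fin_num_measure.
apply: eq_adde_sube => //; apply: H => phi phiC.
have bphi := C1c_bounded_measurable Omega_bounded phiC.
rewrite !Rintegral_measure_add//; try exact: finite_measure_lty.
have := nu12 _ phiC.
rewrite (@cintegral_diff _ _ _ mOmega nu1 p1 n1)//; try exact: finite_measure_lty.
  rewrite (@cintegral_diff _ _ _ mOmega nu2 p2 n2)//; try exact: finite_measure_lty.
    by move=> E; lra.
  by move=> ? ? _; exact: nupn2.
by move=> ? ? _; exact: nupn1.
Qed.

End uniqueness.

(** * The absolutely continuous part of the derivative *)

Section nabla_theory.
Variables (R : realType) (N d : nat) (Omega : set 'rV[R]_N).
Hypotheses (Omega_open : open Omega) (Omega_bounded : bounded_set Omega).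
Local Notation V := 'rV[R]_N.
Local Notation leb := (lebesgue_rV R N).
Implicit Types (u : V -> 'cV[R]_d) (G H : V -> 'M[R]_(d, N)) (phi : V -> R).

Let mOmega : measurable Omega. Proof. exact: open_measurable_mx. Qed.

(** Off a suitable compact set phi is at most 1; on it phi is bounded by compactness. *)
Lemma C0_bounded_measurable phi : C0 Omega phi -> bounded_measurable Omega phi.
Proof.
move=> [cphi phi0]; split.
  apply: open_continuous_measurable_mx => // x Ox.
  by move: cphi; rewrite continuous_open_subspace// => /(_ x); apply; rewrite inE.
have [K [cK KO phiK]] := phi0 1 ltr01.
have /compact_bounded[M [_ MM]] : compact (phi @` K).
  by apply: continuous_compact => //; exact: continuous_subspaceW cphi.
exists (`|M| + 1) => x Ox; have [Kx|Kx] := pselect (K x); last first.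
  by rewrite (le_trans (phiK _ Ox Kx))// lerDr.
apply: (MM (`|M| + 1)); last by exists x.
by rewrite (le_lt_trans (ler_norm _))// ltrDl.
Qed.

(** The predicate from which [nabla] picks a function by choice. *)
Definition ac_density u G := exists Du Ds,
  distr_derivative Omega u Du /\ lebesgue_decomposition Omega Du G Ds.

(** The derivative is the same measure on Borel subsets of Omega in both decompositions. Removing
    from A the two null sets that carry the singular parts changes neither integral and leaves only
    the densities. *)
Lemma ac_density_unique u G H : ac_density u G -> ac_density u H ->
  forall A, measurable A -> A `<=` Omega -> forall i j,
  (\int[leb]_(x in A) (G x i j)%:E = \int[leb]_(x in A) (H x i j)%:E)%E.
Proof.
move=> [Du [Ds [uDu [Gi [Z [mZ Z0 DsZ]] DuE]]]].
move=> [Du' [Ds' [uDu' [Hi [Z' [mZ' Z0' DsZ']] DuE']]]].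
move=> A mA AO i j.
have DD' : forall B, measurable B -> B `<=` Omega -> Du i j B = Du' i j B.
  apply: (charge_unique_C1c Omega_open Omega_bounded) => phi phiC.
  by apply/eqP; rewrite -eqr_opp -uDu// -uDu'.
have mZZ : measurable (Z `|` Z') by exact: measurableU.
have ZZ0 : leb (Z `|` Z') = 0%E.
  apply/eqP; rewrite eq_le measure_ge0 andbT.
  by rewrite (le_trans (measureU2 _ _ _))// [X in (X + _)%E]Z0 [X in (_ + X)%E]Z0' adde0.
pose E := A `\` (Z `|` Z').
have mE : measurable E by exact: measurableD.
have EO : E `<=` Omega by move=> x [/AO].
rewrite (negligible_integral mZZ mA _ ZZ0); last exact: integrableS (Gi i j).
rewrite [RHS](negligible_integral mZZ mA _ ZZ0); last exact: integrableS (Hi i j).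
have := DD' E mE EO; rewrite DuE// DuE'// DsZ//; last first.
  by move=> x [Ax ZZx]; split; [exact: AO|move=> Zx; apply: ZZx; left].
rewrite DsZ' ?adde0//.
by move=> x [Ax ZZx]; split; [exact: AO|move=> Zx; apply: ZZx; right].
Qed.

Lemma nabla_ac_density u G : ac_density u G -> ac_density u (nabla Omega u).
Proof.
move=> uG; rewrite /nabla; apply: (@xgetPex _ _ [set G | ac_density u G]).
by exists G.
Qed.

Lemma ac_density_L1 u G : ac_density u G -> L1 Omega G.
Proof. by move=> [Du [Ds [_ []]]]. Qed.

Lemma cintegral_nabla u G phi i j : ac_density u G ->
  bounded_measurable Omega phi ->
  cintegral Omega (mxmeasure_of_fun Omega (nabla Omega u) i j) phi =
  \int[leb]_(x in Omega) (G x i j * phi x).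
Proof.
move=> uG bphi; have uN := nabla_ac_density uG.
have Gi := ac_density_L1 uG i j; have Ni := ac_density_L1 uN i j.
rewrite -(cintegral_charge_of_fun mOmega Gi bphi).
apply: eq_cintegral => // A mA AO.
rewrite (charge_of_funE mOmega Ni)// (charge_of_funE mOmega Gi)//.
exact: (ac_density_unique uN uG).
Qed.

(** L^1 convergence of densities implies weak-star convergence because functions of C_0 are
    bounded. *)
Lemma weakstar_cvg_nabla (u : nat -> V -> 'cV[R]_d) (G : nat -> V -> 'M[R]_(d, N))
    (H : V -> 'M[R]_(d, N)) :
  (forall n, ac_density (u n) (G n)) -> L1 Omega H ->
  (forall n i j, L1norm Omega (fun x => G n x i j - H x i j) <= n.+1%:R^-1) ->
  weakstar_cvg Omega (fun n => mxmeasure_of_fun Omega (nabla Omega (u n)))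
    (mxmeasure_of_fun Omega H).
Proof.
move=> uG Hi GH phi /C0_bounded_measurable bphi i j.
rewrite (cintegral_charge_of_fun mOmega (Hi i j) bphi).
have -> : (fun n => cintegral Omega (mxmeasure_of_fun Omega (nabla Omega (u n)) i j) phi) =
    (fun n => \int[leb]_(x in Omega) (G n x i j * phi x)).
  by apply/funext => n; exact: cintegral_nabla.
have [mphi [M phiM]] := bphi.
have Gi n := ac_density_L1 (uG n) i j.
apply/cvgrPdist_le => e e0.
have Me0 : 0 < e / (`|M| + 1) by rewrite divr_gt0// ltr_wpDl.
near=> n.
have iG := integrable_bounded_measurable mOmega (Gi n) bphi.
have iH := integrable_bounded_measurable mOmega (Hi i j) bphi.
rewrite distrC -RintegralB//.
have di : leb.-integrable Omega (EFin \o (fun x => G n x i j - H x i j)).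
  exact: (integrableRB mOmega (Gi n) (Hi i j)).
have dip := integrable_bounded_measurable mOmega di bphi.
rewrite (@eq_Rintegral _ _ _ _ _ (fun x => (G n x i j - H x i j) * phi x)); last first.
  by move=> x _; rewrite mulrBl.
apply: (le_trans (le_normr_Rintegral mOmega dip)).
apply: (@le_trans _ _ (\int[leb]_(x in Omega) ((`|M| + 1) * `|G n x i j - H x i j|))).
  apply: le_Rintegral => //.
  - exact: integrable_norm.
  - by apply: integrableRZ => //; exact: integrable_norm.
  move=> x Ox; rewrite normrM mulrC ler_wpM2r// (le_trans (phiM _ Ox))//.
  by rewrite (le_trans (ler_norm _))// lerDl.
rewrite RintegralZl//; last exact: integrable_norm.
rewrite mulrC -ler_pdivlMr ?ltr_wpDl//.
apply: (le_trans (GH n i j)).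
near: n; have := near_infty_natSinv_lt (PosNum Me0).
by apply: filterS => n /= /ltW.
Unshelve. all: by end_near. Qed.

End nabla_theory.

(** * Approximate limits *)

Section enorm_theory.
Variable R : realType.

Lemma entry_le_enorm m n (A : 'M[R]_(m, n)) i j : `|A i j| <= enorm A.
Proof.
rewrite /enorm -sqrtr_sqr ler_wsqrtr// (bigD1 i)//= (bigD1 j)//= -addrA lerDl.
rewrite addr_ge0// sumr_ge0// => k _; rewrite ?sqr_ge0//.
by rewrite sumr_ge0// => l _; rewrite sqr_ge0.
Qed.

Lemma enorm_ge0 m n (A : 'M[R]_(m, n)) : 0 <= enorm A.
Proof. exact: sqrtr_ge0. Qed.

Lemma sum_le_sqr_sum (I : finType) (f g : I -> R) : (forall i, 0 <= g i) ->
  (forall i, f i <= g i ^+ 2) -> \sum_i f i <= (\sum_i g i) ^+ 2.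
Proof.
move=> g0 fg; rewrite [leRHS]expr2 mulr_suml ler_sum// => i _.
rewrite (le_trans (fg i))// expr2 ler_wpM2l// (bigD1 i)//= lerDl.
by rewrite sumr_ge0.
Qed.

Lemma enorm_le_sum m n (A : 'M[R]_(m, n)) : enorm A <= \sum_i \sum_j `|A i j|.
Proof.
have S0 : 0 <= \sum_i \sum_j `|A i j|.
  by rewrite sumr_ge0// => i _; rewrite sumr_ge0.
rewrite -[leRHS]ger0_norm// -sqrtr_sqr ler_wsqrtr//.
apply: sum_le_sqr_sum => [i|i]; first by rewrite sumr_ge0.
by apply: sum_le_sqr_sum => // j; rewrite -normrX ler_norm.
Qed.

Lemma enorm_measurable d (T : measurableType d) (D : set T) m n
    (F : T -> 'M[R]_(m, n)) :
  (forall i j, measurable_fun D (fun x => F x i j)) ->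
  measurable_fun D (fun x => enorm (F x)).
Proof.
move=> mF; rewrite /enorm.
apply: (measurableT_comp (f := @Num.sqrt R)); first (apply:
  continuous_measurable_fun; exact: sqrt_continuous).
apply: measurable_sum => i; apply: measurable_sum => j.
exact: measurable_funX.
Qed.

End enorm_theory.

Section approximate_limits.
Variables (R : realType) (N : nat) (Omega : set 'rV[R]_N).
Hypothesis Omega_open : open Omega.
Local Notation V := 'rV[R]_N.
Local Notation leb := (lebesgue_rV R N).
Implicit Types (x y : V) (f g : V -> R) (r : R).

Let mOmega : measurable Omega. Proof. exact: open_measurable_mx. Qed.

Lemma eball_cbox x r : eball x r `<=` cbox (x - const_mx r) (x + const_mx r).
Proof.
move=> y /= yr l; rewrite in_itv/= !mxE.
have := le_lt_trans (entry_le_enorm (y - x) 0 l) yr.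
by rewrite !mxE ltr_distlC => /andP[h1 h2]; lra.
Qed.

Lemma measurable_eball x r : measurable (eball x r).
Proof.
have : measurable_fun setT (fun y : V => enorm (y - x)).
  apply: enorm_measurable => i j; under eq_fun do rewrite !mxE.
  by apply: measurable_funB => //; exact: measurable_coord.
move=> /(_ measurableT `]-oo, r[%classic (measurable_itv _)); rewrite setTI.
by congr measurable; apply/seteqP; split => y; rewrite /= in_itv.
Qed.

Lemma eball_lty x r : (leb (eball x r) < +oo)%E.
Proof.
apply: le_lt_trans (lebesgue_cbox_lty (x - const_mx r) (x + const_mx r)).
rewrite le_measure ?inE//; [exact: measurable_eball|exact: measurable_cbox|].
exact: eball_cbox.
Qed.

(** The Euclidean norm is at most the sum of the N entries, hence at most r N / (N + 1). Dividing by
    N + 1 rather than N makes this strictly less than r and covers N = 0. *)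
Lemma cbox_eball x y r s : 0 < r -> cbox (x + const_mx (- s)) (x + const_mx s) y ->
  s <= r / N.+1%:R -> eball x r y.
Proof.
move=> r0 xy sr; rewrite /eball/= (le_lt_trans (enorm_le_sum _))//.
rewrite big_ord1 (@le_lt_trans _ _ (\sum_(l < N) (r / N.+1%:R)))//.
  apply: ler_sum => l _; apply: le_trans sr.
  move: (xy l); rewrite !mxE in_itv/= ler_norml => /andP[h1 h2].
  by apply/andP; split; lra.
have -> : \sum_(l < N) (r / N.+1%:R) = r * (N%:R / N.+1%:R).
  by rewrite sumr_const card_ord -[LHS]mulr_natr -mulrA; congr (_ * _); rewrite mulrC.
by rewrite -[ltRHS]mulr1 ltr_pM2l// ltr_pdivrMr// mul1r ltr_nat.
Qed.

Lemma near_eball (U : set V) x : nbhs x U ->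
  \forall r \near 0^'+, eball x r `<=` U.
Proof.
move=> /nbhs_ballP[e /= e0 eU]; near=> r => y /= yr.
apply: eU; split => // i j; rewrite (ord1 i) /ball/=.
have := le_lt_trans (entry_le_enorm (y - x) 0 j) yr.
rewrite !mxE distrC => /lt_le_trans; apply.
by near: r; exact: nbhs_right_le.
Unshelve. all: by end_near. Qed.

Definition average f x r : \bar R :=
  (((fine (leb (eball x r)))^-1)%:E * \int[leb]_(y in eball x r) (f y)%:E)%E.

(** The scalar form of [approx_limit], to which [approx_limitP] reduces it entry by entry. *)
Definition approx_null f x := average f x r @[r --> 0^'+] --> 0%E.

Lemma average_inv_ge0 x r : 0 <= (fine (leb (eball x r)))^-1.
Proof. by rewrite invr_ge0 fine_ge0. Qed.

Lemma approx_null_le f g x : Omega x -> measurable_fun Omega f ->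
  measurable_fun Omega g -> (forall y, Omega y -> 0 <= f y <= g y) ->
  approx_null g x -> approx_null f x.
Proof.
move=> Ox mf mg fg g0.
have nO := near_eball (open_nbhs_nbhs (conj Omega_open Ox)).
apply: (squeeze_cvge _ (cvg_cst 0%E) g0); near=> r.
have rO : eball x r `<=` Omega by near: r.
have me := measurable_eball x r.
apply/andP; split.
  rewrite mule_ge0 ?lee_fin ?average_inv_ge0//.
  by apply: integral_ge0 => y /rO /fg /andP[+ _]; rewrite lee_fin.
rewrite lee_wpmul2l ?lee_fin ?average_inv_ge0//.
apply: ge0_le_integral => //.
- by move=> y /rO /fg /andP[+ _]; rewrite lee_fin.
- by apply/measurable_EFinP; exact: measurable_funS mf.
- by apply/measurable_EFinP; exact: measurable_funS mg.
- by move=> y /rO /fg /andP[_]; rewrite lee_fin.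
Unshelve. all: by end_near. Qed.

Lemma approx_nullD f g x : Omega x -> measurable_fun Omega f ->
  measurable_fun Omega g -> (forall y, 0 <= f y) -> (forall y, 0 <= g y) ->
  approx_null f x -> approx_null g x -> approx_null (fun y => f y + g y) x.
Proof.
move=> Ox mf mg f0 g0 fx gx.
have nO := near_eball (open_nbhs_nbhs (conj Omega_open Ox)).
rewrite /approx_null -[X in _ --> X]adde0.
have fgx : (average f x r + average g x r)%E @[r --> 0^'+] --> (0 + 0)%E.
  exact: cvgeD.
apply: cvg_trans fgx; apply: near_eq_cvg; near=> r.
have rO : eball x r `<=` Omega by near: r.
have me := measurable_eball x r.
rewrite /average -ge0_muleDr; try by apply: integral_ge0 => y _; rewrite lee_fin.
congr (_ * _)%E; rewrite -ge0_integralD//.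
- by move=> y _; rewrite lee_fin.
- by apply/measurable_EFinP; exact: measurable_funS mf.
- by move=> y _; rewrite lee_fin.
- by apply/measurable_EFinP; exact: measurable_funS mg.
Unshelve. all: by end_near. Qed.

Lemma cvge0_leP (T : Type) (F : set_system T) (FF : Filter F) (h : T -> \bar R) :
  (forall t, 0 <= h t)%E -> h @ F --> 0%E <->
  forall e : R, 0 < e -> \forall t \near F, (h t <= e%:E)%E.
Proof.
move=> h0; split=> [/fine_cvgP[hfin /cvgrPdist_le hc] e e0|H].
  apply: filterS2 hfin (hc e e0) => t ft.
  rewrite sub0r normrN /= ger0_norm ?fine_ge0// => he.
  by rewrite -(fineK ft) lee_fin.
have hfin : \forall t \near F, h t \is a fin_num.
  by apply: filterS (H 1 ltr01) => t ht; rewrite ge0_fin_numE// (le_lt_trans ht)// ltry.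
apply/fine_cvgP; split => //; apply/cvgrPdist_le => e e0.
apply: filterS2 hfin (H e e0) => t ft ht.
by rewrite sub0r normrN /= ger0_norm ?fine_ge0// -lee_fin fineK.
Qed.

Lemma average_ge0 f x r : (forall y, 0 <= f y) -> (0 <= average f x r)%E.
Proof.
move=> f0; rewrite mule_ge0 ?lee_fin ?average_inv_ge0//.
by apply: integral_ge0 => y _; rewrite lee_fin.
Qed.

Lemma approx_null_continuous f x : Omega x -> measurable_fun Omega f ->
  (forall y, 0 <= f y) -> f x = 0 -> {for x, continuous f} -> approx_null f x.
Proof.
move=> Ox mf f0 fx0 cf.
have nO := near_eball (open_nbhs_nbhs (conj Omega_open Ox)).
apply/cvge0_leP => [r|e e0]; first exact: average_ge0.
have fe : \forall y \near x, f y <= e.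
  move/cvgrPdist_le : cf => /(_ e e0); apply: filterS => y.
  by rewrite fx0 sub0r normrN ger0_norm.
have nfe := near_eball fe.
near=> r.
have rO : eball x r `<=` Omega by near: r.
have rfe : eball x r `<=` [set y | f y <= e] by near: r.
have me := measurable_eball x r.
apply: (@le_trans _ _ (((fine (leb (eball x r)))^-1)%:E *
    \int[leb]_(y in eball x r) cst e%:E y)%E).
  rewrite lee_wpmul2l ?lee_fin ?average_inv_ge0//.
  apply: ge0_le_integral => //.
  - by move=> y _; rewrite lee_fin.
  - by apply/measurable_EFinP; exact: measurable_funS mf.
have lfin : leb (eball x r) \is a fin_num by rewrite ge0_fin_numE ?eball_lty.
have -> : (\int[leb]_(y in eball x r) cst e%:E y =
    (e * fine (leb (eball x r)))%:E)%E.
  by rewrite integral_cst// EFinM fineK.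
rewrite -EFinM lee_fin.
(* The convention that the inverse of 0 is 0 settles the case of a null ball. *)
have [->|l0] := eqVneq (fine (leb (eball x r))) 0.
  by rewrite invr0 mul0r ltW.
by rewrite mulrCA mulVf// mulr1.
Unshelve. all: by end_near. Qed.

(** If c > 0, the part of the ball lying in Q, a fraction at least k of it, keeps the averages of f
    above k c, against a limit equal to 0. *)
Lemma approx_null_density f x (Q : set V) (k c : R) : Omega x ->
  measurable_fun Omega f -> measurable Q -> 0 < k ->
  (forall y, 0 <= f y) ->
  (\forall r \near 0^'+, 0 < fine (leb (eball x r)) /\
    k * fine (leb (eball x r)) <= fine (leb (Q `&` eball x r))) ->
  (\forall y \near x, Q y -> f y = c) ->
  approx_null f x -> c <= 0.
Proof.
move=> Ox mf mQ k0 f0 kQ fc fx; rewrite leNgt; apply/negP => c0.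
have nO := near_eball (open_nbhs_nbhs (conj Omega_open Ox)).
have nfc := near_eball fc.
move/cvge0_leP : fx => /(_ (fun r => average_ge0 x r f0)) H.
have kc0 : 0 < k * c / 2 by rewrite divr_gt0// mulr_gt0.
have {H} := H _ kc0 => fx.
have : \forall r \near (0 : R)^'+, False; last by move=> /filter_ex[].
near=> r.
have rO : eball x r `<=` Omega by near: r.
have rfc : eball x r `<=` [set y | Q y -> f y = c] by near: r.
have [b0 kr] : 0 < fine (leb (eball x r)) /\
  k * fine (leb (eball x r)) <= fine (leb (Q `&` eball x r)) by near: r.
have me := measurable_eball x r.
have mQe : measurable (Q `&` eball x r) by exact: measurableI.
have : (average f x r <= (k * c / 2)%:E)%E by near: r.
apply/negP; rewrite -ltNge.
have Qfin : leb (Q `&` eball x r) \is a fin_num.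
  rewrite ge0_fin_numE//; apply: le_lt_trans (eball_lty x r).
  by rewrite le_measure ?inE//; exact: subIsetr.
apply: (@lt_le_trans _ _ (((fine (leb (eball x r)))^-1)%:E *
    (c * fine (leb (Q `&` eball x r)))%:E)%E).
  rewrite -EFinM lte_fin [ltRHS]mulrC ltr_pdivlMr//.
  rewrite (@lt_le_trans _ _ (c * (k * fine (leb (eball x r)))))//; last first.
    by rewrite ler_pM2l.
  by rewrite mulrA [c * k]mulrC ltr_pM2r// ltr_pdivrMr// ltr_pMr ?mulr_gt0// ltr1n.
rewrite lee_wpmul2l ?lee_fin ?average_inv_ge0//.
rewrite EFinM fineK// -integral_cst//.
apply: (@le_trans _ _ (\int[leb]_(y in Q `&` eball x r) (f y)%:E)%E).
  rewrite le_eqVlt; apply/orP; left; apply/eqP.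
  by apply: eq_integral => y /[!inE] -[Qy yr]; rewrite (rfc _ yr Qy).
apply: ge0_subset_integral => //.
- by apply/measurable_EFinP; exact: measurable_funS mf.
- by move=> y _; rewrite lee_fin.
Unshelve. all: by end_near. Qed.

Lemma approx_null_sum (I : Type) (s : seq I) (f : I -> V -> R) x : Omega x ->
  (forall i, measurable_fun Omega (f i)) -> (forall i y, 0 <= f i y) ->
  (forall i, approx_null (f i) x) ->
  approx_null (fun y => \sum_(i <- s) f i y) x.
Proof.
move=> Ox mf f0 fx; elim: s => [|i s IHs].
  have -> : (fun y => \sum_(i <- [::]) f i y) = cst 0.
    by apply/funext => y; rewrite big_nil.
  by apply: approx_null_continuous => // ; exact: cst_continuous.
have -> : (fun y => \sum_(i <- i :: s) f i y) =
    fun y => f i y + \sum_(i <- s) f i y.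
  by apply/funext => y; rewrite big_cons.
apply: approx_nullD => //; last by move=> y; rewrite sumr_ge0.
exact: measurable_sum.
Qed.

Lemma approx_limitP d (u : V -> 'cV[R]_d) x z : Omega x ->
  (forall i, measurable_fun Omega (fun y => u y i 0)) ->
  approx_limit u x z <-> forall i, approx_null (fun y => `|u y i 0 - z i 0|) x.
Proof.
move=> Ox mu.
have mi i : measurable_fun Omega (fun y => `|u y i 0 - z i 0|).
  by apply: measurableT_comp => //; exact: measurable_funB.
have me : measurable_fun Omega (fun y => enorm (u y - z)).
  apply: enorm_measurable => i j; rewrite (ord1 j).
  by under eq_fun do rewrite !mxE; exact: measurable_funB.
split => [uz i|uz].
  apply: approx_null_le uz => // y _; rewrite normr_ge0/=.
  by have := entry_le_enorm (u y - z) i 0; rewrite !mxE.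
have H : approx_null (fun y => \sum_i `|u y i 0 - z i 0|) x.
  exact: approx_null_sum.
apply: approx_null_le H => //; first exact: measurable_sum.
move=> y _; rewrite enorm_ge0/= (le_trans (enorm_le_sum _))//.
by apply: ler_sum => i _; rewrite big_ord1 !mxE.
Qed.

End approximate_limits.

(** * Functions that jump across hyperplanes *)

Section jumps.
Variables (R : realType) (N : nat) (Omega : set 'rV[R]_N).
Hypotheses (Omega_open : open Omega) (Omega_bounded : bounded_set Omega).
Local Notation V := 'rV[R]_N.
Local Notation leb := (lebesgue_rV R N).
Implicit Types (x y : V) (j l : 'I_N) (T : seq ('I_N * R)).

Let mOmega : measurable Omega. Proof. exact: open_measurable_mx. Qed.

(** A point may lie on several hyperplanes; on each of these two orthants one stays on a single side
    of all of them. The large and strict inequalities match Heaviside functions that take the value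
    1 on their hyperplane. *)
Definition above x : set V := [set y | forall l, x 0 l <= y 0 l].
Definition below x : set V := [set y | forall l, y 0 l < x 0 l].

Lemma forall_measurable (P : 'I_N -> set V) :
  (forall l, measurable (P l)) -> measurable [set y | forall l, P l y].
Proof.
move=> mP; rewrite (_ : [set y | _] = \bigcap_(l : 'I_N) P l).
  exact: fin_bigcap_measurable.
by apply/seteqP; split => [y H l _|y H l]; [exact: H|exact: (H l I)].
Qed.

Lemma measurable_above x : measurable (above x).
Proof.
apply: forall_measurable => l.
have := @coord_measurable R N l measurableT `[x 0 l, +oo[%classic (measurable_itv _).
rewrite setTI; congr measurable.
by apply/seteqP; split => y; rewrite /= in_itv/= andbT.
Qed.

Lemma measurable_below x : measurable (below x).
Proof.
apply: forall_measurable => l.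
have := @coord_measurable R N l measurableT `]-oo, x 0 l[%classic (measurable_itv _).
by rewrite setTI; congr measurable.
Qed.

(** Q and the ball contain a common cube of side s = r / (2 (N + 1)), and the ball lies in a cube of
    side 2 r; the ratio of the sides is 1 / (4 (N + 1)). *)
Lemma quadrant_density x (Q : set V) (lo hi : R -> R) : measurable Q ->
  (forall r, 0 < r -> [/\ - (r / N.+1%:R) <= lo r, hi r <= r / N.+1%:R,
    hi r - lo r = r / N.+1%:R / 2 &
    cbox (x + const_mx (lo r)) (x + const_mx (hi r)) `<=` Q]) ->
  \forall r \near 0^'+, 0 < fine (leb (eball x r)) /\
    (4 * N.+1%:R)^-1 ^+ N * fine (leb (eball x r)) <=
    fine (leb (Q `&` eball x r)).
Proof.
move=> mQ H; near=> r.
have r0 : 0 < r by near: r; exact: nbhs_right_gt.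
have [rlo hir lohi BQ] := H r r0.
set B := cbox _ _ in BQ; pose s := r / N.+1%:R / 2.
have s0 : 0 < s by rewrite !divr_gt0// ltr0n.
have mB : measurable B by exact: measurable_cbox.
have me := measurable_eball x r.
have mQe : measurable (Q `&` eball x r) by exact: measurableI.
have lohi' : lo r <= hi r by rewrite -subr_ge0 lohi ltW.
have Be : B `<=` eball x r.
  move=> y yB; apply: (@cbox_eball _ _ _ _ _ (r / N.+1%:R)) => // l.
  have := yB l; rewrite !in_itv/= !mxE => /andP[h1 h2].
  by rewrite (le_trans _ h1) ?lerD2l//= (le_trans h2)// lerD2l.
have lB : leb B = (s ^+ N)%:E.
  rewrite lebesgue_rV_box; last by move=> l; rewrite !mxE lerD2l.
  congr EFin; rewrite (eq_bigr (fun=> s)); last first.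
    by move=> l _; rewrite !mxE opprD addrACA subrr add0r lohi.
  by rewrite prodr_const card_ord.
have lQ : s ^+ N <= fine (leb (Q `&` eball x r)).
  rewrite -lee_fin fineK; last first.
    rewrite ge0_fin_numE//; apply: le_lt_trans (eball_lty x r).
    by rewrite le_measure ?inE//; exact: subIsetr.
  rewrite -lB le_measure ?inE//.
  by move=> y yB; split; [exact: BQ|exact: Be].
have le1 : fine (leb (eball x r)) <= (2 * r) ^+ N.
  rewrite -lee_fin fineK; last by rewrite ge0_fin_numE ?eball_lty.
  apply: (@le_trans _ _ (leb (cbox (x - const_mx r) (x + const_mx r)))).
    rewrite le_measure ?inE//; first exact: measurable_cbox.
    exact: eball_cbox.
  rewrite lebesgue_rV_box; last by move=> l; rewrite !mxE; lra.
  rewrite (eq_bigr (fun=> 2 * r)); last by move=> l _; rewrite !mxE; lra.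
  by rewrite prodr_const card_ord.
split.
  apply: (@lt_le_trans _ _ (s ^+ N)); first exact: exprn_gt0.
  rewrite -lee_fin fineK; last by rewrite ge0_fin_numE ?eball_lty.
  by rewrite -lB le_measure ?inE.
apply: le_trans lQ; apply: (@le_trans _ _ ((4 * N.+1%:R)^-1 ^+ N * (2 * r) ^+ N)).
  by rewrite ler_wpM2l// exprn_ge0// invr_ge0 mulr_ge0.
rewrite -exprMn (_ : (4 * N.+1%:R)^-1 * (2 * r) = s)// /s.
have : N.+1%:R != 0 :> R by rewrite pnatr_eq0.
by move: (N.+1%:R) => n n0; field.
Unshelve. all: by end_near. Qed.

Lemma above_density x : \forall r \near 0^'+, 0 < fine (leb (eball x r)) /\
    (4 * N.+1%:R)^-1 ^+ N * fine (leb (eball x r)) <=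
    fine (leb (above x `&` eball x r)).
Proof.
apply: (@quadrant_density _ _ (fun r => r / N.+1%:R / 2) (fun r => r / N.+1%:R)).
  exact: measurable_above.
move=> r r0; have d0 : 0 < r / N.+1%:R by rewrite divr_gt0// ltr0n.
move: d0; set d := r / _ => d0; split; try by lra.
by move=> y yB l; have := yB l; rewrite in_itv/= !mxE => /andP[h _]; lra.
Qed.

Lemma below_density x : \forall r \near 0^'+, 0 < fine (leb (eball x r)) /\
    (4 * N.+1%:R)^-1 ^+ N * fine (leb (eball x r)) <=
    fine (leb (below x `&` eball x r)).
Proof.
apply: (@quadrant_density _ _ (fun r => - (r / N.+1%:R)) (fun r => - (r / N.+1%:R / 2))).
  exact: measurable_below.
move=> r r0; have d0 : 0 < r / N.+1%:R by rewrite divr_gt0// ltr0n.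
move: d0; set d := r / _ => d0; split; try by lra.
by move=> y yB l; have := yB l; rewrite in_itv/= !mxE => /andP[_ h]; lra.
Qed.

Definition quadrant_jump (v : V -> R) x := exists p q : R, [/\ p != q,
  \forall y \near x, above x y -> v y = p & \forall y \near x, below x y -> v y = q].

(** Both orthants have positive lower density at x, so an approximate limit s of c v equals both c p
    and c q, where p and q are distinct. *)
Lemma quadrant_jump_approx_null v x c s : Omega x -> measurable_fun Omega v ->
  quadrant_jump v x -> approx_null (fun y => `|c * v y - s|) x -> c = 0.
Proof.
move=> Ox mv [p [q [pq vp vq]]] H.
have mf : measurable_fun Omega (fun y => `|c * v y - s|).
  by apply: measurableT_comp => //; apply: measurable_funB => //; exact: measurable_funM.
have k0 : 0 < (4 * N.+1%:R)^-1 ^+ N :> R.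
  by rewrite exprn_gt0// invr_gt0 mulr_gt0// ltr0n.
have cp : `|c * p - s| <= 0.
  apply: (approx_null_density Omega_open Ox mf (measurable_above x) k0 _
    (above_density x) _ H) => //.
  by apply: filterS vp => y vp /vp ->.
have cq : `|c * q - s| <= 0.
  apply: (approx_null_density Omega_open Ox mf (measurable_below x) k0 _
    (below_density x) _ H) => //.
  by apply: filterS vq => y vq /vq ->.
move: cp cq; rewrite !normr_le0 !subr_eq0 => /eqP cp /eqP cq.
have : c * (p - q) = 0 by rewrite mulrBr cp cq subrr.
by move/eqP; rewrite mulf_eq0 subr_eq0 (negbTE pq) orbF => /eqP.
Qed.

End jumps.

Section heaviside.
Variables (R : realType) (N : nat) (Omega : set 'rV[R]_N).
Hypotheses (Omega_open : open Omega) (Omega_bounded : bounded_set Omega).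
Local Notation V := 'rV[R]_N.
Implicit Types (x y : V) (j l : 'I_N) (T : seq ('I_N * R)).

(** Near x only the hyperplanes through x separate the two orthants. The two values count the
    hyperplanes with height at most, respectively below, the coordinate of x; they differ because
    all jumps are upwards. *)
Lemma quadrant_jump_heaviside T (v : V -> R) x :
  (\forall y \near x, v y = \sum_(p <- T) (p.2 <= y 0 p.1)%R%:R) ->
  hyperplanes T x -> quadrant_jump v x.
Proof.
move=> vE [p pT xp].
have near_coord l (U : set R) : nbhs (x 0 l) U ->
    \forall y \near x, U ((y : V) 0 l).
  by move=> xU; exact: (@coord_continuous _ _ _ 0 l x U xU).
exists (\sum_(p <- T) (p.2 <= x 0 p.1)%R%:R), (\sum_(p <- T) (p.2 < x 0 p.1)%R%:R).
have le_lt (q : 'I_N * R) : ((q.2 < x 0 q.1)%R%:R <= (q.2 <= x 0 q.1)%R%:R :> R).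
  by case: ltgtP.
split.
- rewrite gt_eqF// -subr_gt0 -sumrB (big_rem p)//= xp lexx ltxx subr0.
  by rewrite ltr_pwDl// sumr_ge0// => q _; rewrite subr_ge0.
- have : \forall y \near x, {in T, forall q, x 0 q.1 < q.2 -> (y : V) 0 q.1 < q.2}.
    elim: T {vE pT le_lt} => [|q T IHT].
      by apply: (@filterE V (nbhs x) (nbhs_filter x)) => y q; rewrite in_nil.
    have qn : \forall y \near x, x 0 q.1 < q.2 -> (y : V) 0 q.1 < q.2.
      have [xq|xq] := ltP (x 0 q.1) q.2; last by apply: (@filterE V (nbhs x) (nbhs_filter x)).
      by apply: filterS (near_coord _ _ (lt_nbhsl xq)) => y.
    apply: filterS2 qn IHT => y yq yT q'; rewrite inE => /predU1P[->//|].
    exact: yT.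
  apply: filterS2 vE => y -> yT xy; rewrite big_seq [RHS]big_seq.
  apply: eq_bigr => q qT; congr (nat_of_bool _)%:R.
  apply/idP/idP => [|/le_trans]; last by apply; exact: xy.
  by apply: contraTT; rewrite -!ltNge; exact: yT.
- have : \forall y \near x, {in T, forall q, q.2 < x 0 q.1 -> q.2 < (y : V) 0 q.1}.
    elim: T {vE pT le_lt} => [|q T IHT].
      by apply: (@filterE V (nbhs x) (nbhs_filter x)) => y q; rewrite in_nil.
    have qn : \forall y \near x, q.2 < x 0 q.1 -> q.2 < (y : V) 0 q.1.
      have [xq|xq] := ltP q.2 (x 0 q.1); last by apply: (@filterE V (nbhs x) (nbhs_filter x)).
      by apply: filterS (near_coord _ _ (lt_nbhsr xq)) => y.
    apply: filterS2 qn IHT => y yq yT q'; rewrite inE => /predU1P[->//|].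
    exact: yT.
  apply: filterS2 vE => y -> yT xy; rewrite big_seq [RHS]big_seq.
  apply: eq_bigr => q qT; congr (nat_of_bool _)%:R.
  apply/idP/idP => [qy|/(yT _ qT)/ltW//].
  exact: le_lt_trans qy (xy _).
Qed.

Lemma jump_function T : exists T' (v : V -> R), [/\ {subset T <= T'},
  piecewise Omega T' v (fun=> cst 0) &
  forall x, Omega x -> hyperplanes T' x -> quadrant_jump v x].
Proof.
have [M M0 MO] := bounded_cbox Omega_bounded.
(* Each Heaviside function is realized on Omega by the indicator of a box inside the cube [-M, M]^N.
   The other faces of the box lie on hyperplanes x_l = M or x_l = - M, which are added to the list
   and do not meet Omega. *)
pose T' := T ++ [seq (l, - M) | l <- enum 'I_N] ++ [seq (l, M) | l <- enum 'I_N].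
pose a (p : 'I_N * R) : V := setc p.1 (Num.max p.2 (- M)) (const_mx (- M)).
(* The leading factor removes heights at or above M, where the Heaviside function vanishes on Omega
   and the corners of the box need not be ordered. *)
pose w (p : 'I_N * R) (x : V) : R := (p.2 < M)%R%:R *
  (\1_(cbox (a p) (const_mx M)) x * affine 0 1 p.1 x).
have wE p x : Omega x -> w p x = (p.2 <= x 0 p.1)%R%:R.
  move=> Ox; rewrite /w /affine mul0r add0r mulr1.
  have [pM|pM] := ltP p.2 M; last first.
    rewrite mul0r leNgt (lt_le_trans _ pM)//.
    by have := MO x Ox p.1; rewrite ltr_norml => /andP[].
  rewrite mul1r indicE; congr (nat_of_bool _)%:R; apply/idP/idP => [/set_mem|px].
    by move=> /(_ p.1); rewrite !mxE eqxx in_itv/= ge_max => /andP[/andP[]].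
  rewrite inE => l; have := MO x Ox l.
  rewrite !mxE in_itv/= ltr_norml => /andP[/ltW Mx /ltW xM]; rewrite xM andbT.
  by case: eqP => [->|//]; rewrite ge_max px; have := MO x Ox p.1;
    rewrite ltr_norml => /andP[/ltW].
exists T', (fun x => \sum_(p <- T) w p x); split.
- by move=> p pT; rewrite mem_cat pT.
- have : {in T, forall p, piecewise Omega T' (w p) (fun=> cst 0)}.
    move=> p pT; have [pM|pM] := ltP p.2 M; last first.
      exists (fun=> czero); rewrite (_ : w p = cst 0); last first.
        by apply/funext => x; rewrite /w ltNge pM mul0r.
      exact: piecewise_C1_0.
    have [|l|s sP] := @piecewise_C1_box _ _ _ Omega_open Omega_bounded T' (a p)
        (const_mx M) 0 1 p.1.
    + move=> l; rewrite !mxE; case: ifP => _; last by rewrite ge0_cp// ltW.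
      by rewrite ge_max !ltW// (lt_trans _ M0)// oppr_lt0.
    + rewrite !mxE !mem_cat; split; last first.
        by rewrite (map_f (fun l => (l, M))) ?mem_enum ?orbT.
      have lM : (l, - M) \in [seq (l, - M) | l <- enum 'I_N].
        by rewrite (map_f (fun l => (l, - M))) ?mem_enum.
      case: eqP => [->|_]; last by rewrite lM orbT.
      rewrite /Num.max; case: ltP => _; last by rewrite -surjective_pairing pT.
      by rewrite (map_f (fun l => (l, - M))) ?mem_enum ?orbT.
    exists (fun j => cscale 1 (s j)).
    rewrite (_ : w p = fun x => 1 * (\1_(cbox (a p) (const_mx M)) x *
        affine 0 1 p.1 x)); last by apply/funext => x; rewrite /w pM.
    rewrite (_ : (fun=> cst 0) = fun j x => 1 *
        (\1_(cbox (a p) (const_mx M)) x * (0 * (j == p.1)%:R))).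
      exact: piecewise_C1_scale.
    by apply/funext => j; apply/funext => x; rewrite mul0r !mulr0.
  move=> /piecewise_sum [] // s sP; exists s.
  rewrite (_ : (fun=> cst 0) = fun l x => \sum_(p <- T) (cst 0 x : R)) //.
  by apply/funext => l; apply/funext => x; rewrite big1.
- move=> x Ox [p pT' xp]; apply: (@quadrant_jump_heaviside T).
    apply: filterS (open_nbhs_nbhs (conj Omega_open Ox)) => y Oy.
    by apply: eq_bigr => q _; exact: wE.
  move: pT'; rewrite !mem_cat => /or3P[pT|/mapP[l _ pl]|/mapP[l _ pl]].
  + by exists p.
  + have := MO x Ox l; rewrite -[l]/((l, - M).1) -pl xp pl /=.
    by rewrite normrN ger0_norm ?ltxx// ltW.
  + have := MO x Ox l; rewrite -[l]/((l, M).1) -pl xp pl /=.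
    by rewrite ger0_norm ?ltxx// ltW.
Qed.

End heaviside.

Lemma countable_setU (K : Type) (A B : set K) :
  countable A -> countable B -> countable (A `|` B).
Proof.
move=> cA cB; rewrite -bigcup2E; apply: bigcup_countable => // -[|[|n]] _ //=.
Qed.

(** * Disjoint families charged by a finite measure *)

Section countable_support.
Variables (R : realType) (d : measure_display) (X : measurableType d).
Variables (K : choiceType) (B : set K) (A : K -> set X).
Hypotheses (mA : forall c, measurable (A c)) (tA : trivIset B A).

Lemma finite_measure_countable (mu : {finite_measure set X -> \bar R}) :
  countable [set c | B c /\ mu (A c) != 0%E].
Proof.
have muT : mu setT \is a fin_num by exact: fin_num_measure.
rewrite (_ : [set c | _] =
    \bigcup_n [set c | B c /\ (n.+1%:R^-1%:E <= mu (A c))%E]); last first.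
  apply/seteqP; split=> [c [Bc Ac]|c [n _ [Bc Ac]]]; last first.
    split => //; apply/eqP => A0; move: Ac; rewrite A0 lee_fin leNgt.
    by rewrite invr_gt0 ltr0n.
  have Ac0 : 0 < fine (mu (A c)).
    by rewrite fine_gt0// lt0e Ac measure_ge0/= -ge0_fin_numE// fin_num_measure.
  exists (Num.truncn (fine (mu (A c)))^-1) => //; split => //.
  rewrite -(fineK (fin_num_measure _ _ (mA c))) lee_fin.
  by rewrite invf_ple ?posrE// ltW// truncnS_gt.
apply: bigcup_countable => // n _; apply: finite_set_countable.
(* More than (n + 1) mu(X) disjoint sets of mass at least 1 / (n + 1) would exceed the total
   mass. *)
apply: contrapT => /(infinite_set_fset (Num.truncn (n.+1%:R * fine (mu setT))).+1).
move=> [Y YB Yn].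
have : (mu (\bigcup_(c in [set` Y]) A c) <= mu setT)%E.
  by rewrite le_measure ?inE//; apply: fin_bigcup_measurable.
apply/negP; rewrite -ltNge measure_fin_bigcup//; last first.
  by apply: sub_trivIset tA => c /YB[].
rewrite fsbig_finite//= set_fsetK.
apply: (@lt_le_trans _ _ (\sum_(c <- Y) n.+1%:R^-1%:E)%E); last first.
  by rewrite big_seq [leRHS]big_seq; apply: lee_sum => c /YB[].
rewrite sumEFin -(fineK muT) lte_fin big_const_seq count_predT iter_addr_0.
rewrite -[ltRHS]mulr_natl ltr_pdivlMr ?ltr0n// mulrC.
by rewrite (lt_le_trans (truncnS_gt _))// ler_nat.
Qed.

Lemma charge_countable (nu : {charge set X -> \bar R}) :
  countable [set c | B c /\ nu (A c) != 0%E].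
Proof.
have [p [n nuE]] : exists p n : {finite_measure set X -> \bar R},
    forall C, measurable C -> nu C = (p C - n C)%E.
  pose h := svalP (cid (svalP (cid (Hahn_decomposition nu)))).
  exists (jordan_pos h), (jordan_neg h) => C mC.
  by rewrite (jordan_decomp h)// /cadd/= cscaleN1.
apply: (@sub_countable _ _ _ ([set c | B c /\ p (A c) != 0%E] `|`
    [set c | B c /\ n (A c) != 0%E])); last first.
  by apply: countable_setU; exact: finite_measure_countable.
apply: subset_card_le => c [Bc nuA].
have [p0|p0] := eqVneq (p (A c)) 0%E; last by left.
have [n0|n0] := eqVneq (n (A c)) 0%E; last by right.
by move: nuA; rewrite nuE// p0 n0 sube0 eqxx.
Qed.

End countable_support.

(** * Perturbation of an SBV function by jumps *)

Section hyperplanes_theory.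
Variables (R : realType) (N : nat) (Omega : set 'rV[R]_N).
Hypotheses (Omega_open : open Omega) (Omega_bounded : bounded_set Omega).
Local Notation V := 'rV[R]_N.
Local Notation leb := (lebesgue_rV R N).
Implicit Types (x : V) (T : seq ('I_N * R)).

Lemma hyperplanes_cons p T :
  hyperplanes (p :: T) = [set x : V | x 0 p.1 = p.2] `|` hyperplanes T.
Proof.
apply/seteqP; split=> [x [q]|x [xp|[q qT xq]]].
- by rewrite inE => /predU1P[->|qT] xq; [left|right; exists q].
- by exists p; rewrite ?mem_head.
- by exists q; rewrite // inE qT orbT.
Qed.

Lemma measurable_hyperplanes T : measurable (hyperplanes T : set V).
Proof.
elim: T => [|p T mT].
  rewrite (_ : hyperplanes [::] = set0)//.
  by apply/seteqP; split => // x [p]; rewrite in_nil.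
rewrite hyperplanes_cons; apply: measurableU => //.
have := @coord_measurable R N p.1 measurableT [set p.2] (measurable_set1 _).
by rewrite setTI.
Qed.

(** Inside the bounded set Omega, a hyperplane is contained in a box with one side of length
    zero. *)
Lemma hyperplanes_null T : exists Z : set V,
  [/\ measurable Z, leb Z = 0%E & Omega `&` hyperplanes T `<=` Z].
Proof.
have [M M0 MO] := bounded_cbox Omega_bounded.
elim: T => [|p T [Z [mZ Z0 TZ]]].
  by exists set0; split => // x [_ [p]]; rewrite in_nil.
pose P := cbox (setc p.1 p.2 (const_mx (- M))) (setc p.1 p.2 (const_mx M)).
have mP : measurable P by exact: measurable_cbox.
have P0 : leb P = 0%E.
  rewrite lebesgue_rV_box => [|l].
    by rewrite (bigD1 p.1)//= !setcE subrr mul0r.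
  by rewrite !mxE; case: eqP => // _; rewrite ge0_cp// ltW.
exists (P `|` Z); split.
- exact: measurableU.
- apply/eqP; rewrite eq_le measure_ge0 andbT.
  by rewrite (le_trans (measureU2 _ _ _))// [X in (X + _)%E]P0 [X in (_ + X)%E]Z0 adde0.
- move=> x [Ox]; rewrite hyperplanes_cons => -[xp|xT]; last by right; exact: TZ.
  left => l; rewrite in_itv/= !mxE; case: eqP => [->|_]; first by rewrite xp lexx.
  by rewrite -ler_norml ltW// MO.
Qed.

End hyperplanes_theory.

Section perturbation.
Variables (R : realType) (N d : nat) (Omega : set 'rV[R]_N).
Hypotheses (Omega_open : open Omega) (Omega_bounded : bounded_set Omega).
Local Notation V := 'rV[R]_N.
Local Notation leb := (lebesgue_rV R N).
Local Notation charge_rV := ({charge set V -> \bar R}).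
Implicit Types (x y : V) (i : 'I_d) (j l : 'I_N) (T : seq ('I_N * R)).

Let mOmega : measurable Omega. Proof. exact: open_measurable_mx. Qed.

Definition perturb (g : V -> 'cV[R]_d) (w : 'I_d -> V -> R) x : 'cV[R]_d :=
  \col_i (g x i 0 + w i x).

Variables (g : V -> 'cV[R]_d) (Du Ds : mxmeasure R N d N)
  (G : V -> 'M[R]_(d, N)).
Hypotheses (gi : L1 Omega g) (gDu : distr_derivative Omega g Du)
  (DuE : lebesgue_decomposition Omega Du G Ds).

Lemma perturb_decomposition T (w : 'I_d -> V -> R) (F : 'I_d -> 'I_N -> V -> R)
    (s : 'I_d -> 'I_N -> charge_rV) :
  (forall i, piecewise_C1 Omega T (w i) (F i) (s i)) ->
  exists Du', [/\ L1 Omega (perturb g w), distr_derivative Omega (perturb g w) Du' &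
    lebesgue_decomposition Omega Du' (fun x => \matrix_(i, j) (G x i j + F i j x))
      (fun i j => cadd (Ds i j) (s i j))].
Proof.
move=> wP; have [Gi [Z [mZ Z0 DsZ]] DuA] := DuE.
have wi i := pw_integrable (wP i); have Fi i := pw_grad_integrable (wP i).
have ui : L1 Omega (perturb g w).
  move=> i k; rewrite (ord1 k); have := integrableRD mOmega (gi i 0) (wi i).
  by congr (integrable _ _ _); apply/funext => x /=; rewrite mxE.
exists (fun i j => cadd (Du i j) (cadd (charge_of_fun Omega (F i j)) (s i j))).
split => //.
- move=> phi phiC i j.
  have bphi := C1c_bounded_measurable Omega_bounded phiC.
  have bdphi := C1c_derive_bounded_measurable Omega_bounded phiC j.
  rewrite !cintegral_add//.
  rewrite (cintegral_charge_of_fun mOmega (Fi i j) bphi).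
  have := pw_parts (wP i) phiC j; have := gDu phiC i j => E1 E2.
  transitivity (\int[leb]_(x in Omega)
      ((g x i 0 + w i x) * 'D_(delta_mx 0 j : V) phi x)).
    by apply: eq_Rintegral => x _; rewrite mxE.
  apply: (eq_trans (RintegralDM mOmega (gi i 0) (wi i) bdphi)).
  by move: E1 E2; rewrite /axis => -> ->; lra.
- split.
  + move=> i j; have := integrableRD mOmega (Gi i j) (Fi i j).
    by congr (integrable _ _ _); apply/funext => x /=; rewrite mxE.
  + have [P [mP P0 TP]] := hyperplanes_null Omega_bounded T.
    exists (Z `|` P); split.
    * exact: measurableU.
    * apply/eqP; rewrite eq_le measure_ge0 andbT.
      by rewrite (le_trans (measureU2 _ _ _))// [X in (X + _)%E]Z0 [X in (_ + X)%E]P0 adde0.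
    * move=> A mA AZP i j; apply: (@eq_trans _ _ (0 + 0)%E); last by rewrite adde0.
      congr (_ + _)%E.
        by apply: DsZ => // x /AZP[Ox ZPx]; split => // Zx; apply: ZPx; left.
      apply: (pw_singular (wP i)) => // x /AZP[Ox ZPx] xT.
      by apply: ZPx; right; exact: TP.
  + move=> A mA AO i j.
    apply: (@eq_trans _ _ (\int[leb]_(x in A) (G x i j)%:E + Ds i j A +
        (\int[leb]_(x in A) (F i j x)%:E + s i j A))%E).
      congr (_ + (_ + _))%E; first exact: DuA.
      exact: charge_of_funE (Fi i j) _ mA AO.
    have -> : (\int[leb]_(x in A) (((\matrix_(i, j) (G x i j + F i j x)) i j)%:E) =
        \int[leb]_(x in A) (G x i j)%:E + \int[leb]_(x in A) (F i j x)%:E)%E.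
      rewrite -integralD_EFin//; last 2 first.
      * exact: integrableS (Gi i j).
      * exact: integrableS (Fi i j).
      by apply: eq_integral => x _; rewrite mxE.
    by rewrite addeACA.
Qed.

Lemma measurable_perturb (w : 'I_d -> V -> R) i :
  (forall i, measurable_fun Omega (w i)) ->
  measurable_fun Omega (fun x => perturb g w x i 0).
Proof.
move=> mw; under eq_fun do rewrite mxE; apply: measurable_funD => //.
by have /integrableP[/measurable_EFinP] := gi i 0.
Qed.

(** An approximate limit z of g + w at x would give g the approximate limit z - w(x), by continuity
    of w: a continuous perturbation removes no point of the discontinuity set. *)
Lemma perturb_approx_disc_set (w : 'I_d -> V -> R) x : Omega x ->
  (forall i, measurable_fun Omega (w i)) -> (forall i, {for x, continuous (w i)}) ->
  approx_disc_set Omega g x -> approx_disc_set Omega (perturb g w) x.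
Proof.
move=> Ox mw cw [_ Sg]; split; first exact: Ox.
move=> -[z uz]; apply: Sg.
have mg i : measurable_fun Omega (fun y => g y i 0).
  by have /integrableP[/measurable_EFinP] := gi i 0.
move: uz; rewrite (approx_limitP Omega_open)//; last by move=> i; exact: measurable_perturb.
move=> uz; exists (z - \col_i w i x).
rewrite (approx_limitP Omega_open)// => i.
have mu : measurable_fun Omega (fun y => `|perturb g w y i 0 - z i 0|).
  by apply: measurableT_comp => //; apply: measurable_funB => //; exact: measurable_perturb.
have mwx : measurable_fun Omega (fun y => `|w i y - w i x|).
  by apply: measurableT_comp => //; exact: measurable_funB.
apply: (approx_null_le Omega_open Ox _ _ _
  (approx_nullD Omega_open Ox mu mwx _ _ (uz i) _)) => //.
- by apply: measurableT_comp => //; exact: measurable_funB.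
- exact: measurable_funD.
- move=> y _; rewrite normr_ge0 /= !mxE.
  rewrite (_ : g y i 0 - _ = (g y i 0 + w i y - z i 0) - (w i y - w i x)); last by ring.
  exact: ler_normB.
- apply: (approx_null_continuous Omega_open Ox) => //; first by rewrite subrr normr0.
  apply: (@continuous_comp _ _ _ (fun y => w i y - w i x) (fun t => `|t|)).
    by apply: (@continuousB _ _ _ (w i) (cst (w i x))); [exact: cw|exact: cst_continuous].
  exact: norm_continuous.
Qed.

End perturbation.

Section jump_perturbation.
Variables (R : realType) (N d : nat) (Omega : set 'rV[R]_N).
Hypotheses (Omega_open : open Omega) (Omega_bounded : bounded_set Omega).
Local Notation V := 'rV[R]_N.
Local Notation charge_rV := ({charge set V -> \bar R}).
Implicit Types (x y : V) (i : 'I_d) (j l : 'I_N) (T : seq ('I_N * R)).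

Let mOmega : measurable Omega. Proof. exact: open_measurable_mx. Qed.

(** The two functions differ by (c - c') v in each entry, so this difference would have an
    approximate limit at a point where v jumps. *)
Lemma quadrant_jump_approx_limit (g : V -> 'cV[R]_d)
    (w : 'I_d -> V -> R) (v : V -> R) x (c c' : R) i :
  L1 Omega g -> (forall i, measurable_fun Omega (w i)) -> measurable_fun Omega v ->
  Omega x -> quadrant_jump v x ->
  ~ approx_disc_set Omega (perturb g (fun i y => w i y + c * v y)) x ->
  ~ approx_disc_set Omega (perturb g (fun i y => w i y + c' * v y)) x -> c = c'.
Proof.
move=> gi mw mv Ox vx.
pose u (c : R) := perturb g (fun i y => w i y + c * v y).
have lim (t : R) : ~ approx_disc_set Omega (u t) x -> exists z, approx_limit (u t) x z.
  by move=> tx; apply: contrapT => H; apply: tx.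
move=> /lim[z uz] /lim[z' uz'].
have mu t k : measurable_fun Omega (fun y => u t y k 0).
  apply: measurable_perturb => // k'; apply: measurable_funD => //.
  exact: measurable_funM.
move: uz uz'; rewrite !(approx_limitP Omega_open)// => /(_ i) uz /(_ i) uz'.
have mz t (s : R) : measurable_fun Omega (fun y => `|u t y i 0 - s|).
  by apply: measurableT_comp => //; apply: measurable_funB.
apply/eqP; rewrite -subr_eq0; apply/eqP.
apply: (quadrant_jump_approx_null Omega_open Ox mv vx (s := z i 0 - z' i 0)).
apply: (approx_null_le Omega_open Ox _ _ _
  (approx_nullD Omega_open Ox _ _ _ _ uz uz')) => //.
- apply: measurableT_comp => //; apply: measurable_funB => //.
  exact: measurable_funM.
- exact: measurable_funD.
- move=> y _; rewrite normr_ge0/=.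
  rewrite (_ : _ - _ = (u c y i 0 - z i 0) - (u c' y i 0 - z' i 0)).
    exact: ler_normB.
  by rewrite !mxE; ring.
Qed.

(* On the hyperplanes where [v] jumps, approximate continuity of [w + c v] holds
   for at most one [c]; hence only countably many [c] produce a Cantor part. *)
Lemma jump_perturbation (g : V -> 'cV[R]_d) T (w : 'I_d -> V -> R)
    (F : 'I_d -> 'I_N -> V -> R) (v : V -> R)
    (c0 : R) : SBV Omega g -> (forall i, piecewise Omega T (w i) (F i)) ->
  piecewise Omega T v (fun=> cst 0) ->
  (forall x, Omega x -> hyperplanes T x -> quadrant_jump v x) -> 0 < c0 ->
  forall Gg, (exists Du Ds, [/\ distr_derivative Omega g Du,
    lebesgue_decomposition Omega Du Gg Ds &
    forall A, measurable A -> A `<=` Omega `\` approx_disc_set Omega g ->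
      forall i j, Ds i j A = 0%E]) ->
  exists c, let u := perturb g (fun i y => w i y + c * v y) in
    [/\ 0 < c <= c0, SBV Omega u &
      ac_density Omega u (fun x => \matrix_(i, j) (Gg x i j + F i j x))].
Proof.
move=> [[gi _] _] wF [tau vtau] vjump c00 Gg [Du [Ds [gDu DuE DsC]]].
have [s ws] := choice wF.
pose u (c : R) := perturb g (fun i y => w i y + c * v y).
pose sc (c : R) i j := cadd (s i j) (cscale c (tau j)).
have uP c i : piecewise_C1 Omega T (fun y => w i y + c * v y) (F i) (sc c i).
  have := piecewise_C1_add Omega_open Omega_bounded (ws i)
    (piecewise_C1_scale Omega_open Omega_bounded c vtau).
  congr (piecewise_C1 _ _ _ _ _); apply/funext => j; apply/funext => x.
  by rewrite mulr0 addr0.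
have uD c := perturb_decomposition Omega_open Omega_bounded gi gDu DuE (uP c).
pose Dc c i j := cadd (Ds i j) (sc c i j).
pose H := hyperplanes T.
have mH : measurable H by exact: measurable_hyperplanes.
have mw i : measurable_fun Omega (w i).
  by have /integrableP[/measurable_EFinP] := pw_integrable (ws i).
have mv : measurable_fun Omega v.
  by have /integrableP[/measurable_EFinP] := pw_integrable vtau.
have muc c i : measurable_fun Omega (fun y => w i y + c * v y).
  by apply: measurable_funD => //; exact: measurable_funM.
(* Only the hyperplanes matter: off them the added singular parts vanish, and continuity of the
   perturbation puts A minus H off the discontinuity set of g, where [Ds] vanishes. *)
have off c A i j : measurable A -> A `<=` Omega `\` approx_disc_set Omega (u c) ->
    Dc c i j A = Dc c i j (A `&` H).
  move=> mA AO; have mAH : measurable (A `&` H) by exact: measurableI.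
  have mAD : measurable (A `\` H) by exact: measurableD.
  have D0 : Dc c i j (A `\` H) = 0%E.
    apply: (@eq_trans _ _ (0 + 0)%E); last by rewrite adde0.
    congr (_ + _)%E; last by apply: (pw_singular (uP c i)) => // x [].
    apply: DsC; first exact: mAD.
    move=> x [/AO[Ox Su] Hx]; split; first exact: Ox.
    move=> Sg; apply: Su.
    apply: perturb_approx_disc_set => // k; exact: (pw_continuous (uP c k)).
  apply: (eq_trans (chargeDI (Dc c i j) mA mH)).
  by apply: (eq_trans (congr1 (adde^~ _) D0)); exact: add0e.
(* If every c in ]0, c0] fails, choose for each of them a set [A c] of approximate continuity points
   with nonzero singular part. The sets [A c] met with H are disjoint. *)
have [good|bad] := pselect (exists2 c, 0 < c <= c0 &
    forall A, measurable A -> A `<=` Omega `\` approx_disc_set Omega (u c) ->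
      forall i j, Dc c i j A = 0%E).
  have [c cc0 cC] := good; have [Du' [ui uDu' DuE']] := uD c.
  exists c; split => //; last by exists Du', (Dc c).
  split; first by split => //; exists Du'.
  by exists Du', (fun x => \matrix_(i, j) (Gg x i j + F i j x)), (Dc c).
exfalso.
pose B : set R := [set c | 0 < c <= c0].
have /choice[A AP] : forall c, exists A, measurable A /\
    (B c -> [/\ A `<=` Omega `\` approx_disc_set Omega (u c) &
      exists i j, Dc c i j A <> 0%E]).
  move=> c; have [Bc|Bc] := pselect (B c); last by exists set0; split.
  apply: contrapT => /forallNP AN; apply: bad; exists c; first exact: Bc.
  move=> A mA AO i j.
  apply: contrapT => DA; apply: (AN A); split; first exact: mA.
  move=> _; split; first exact: AO.
  by exists i, j.
have mA c : measurable (A c `&` H) by apply: measurableI => //; case: (AP c).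
have tA : trivIset B (fun c => A c `&` H).
  (* The row i used to compare limits comes from the nonzero entry of the singular part, which also
     covers d = 0. *)
  move=> c c' Bc Bc' [x [[Ac Hx] [Ac' _]]].
  have [_ /(_ Bc)[AO [i _]]] := AP c; have [_ /(_ Bc')[AO' _]] := AP c'.
  have [Ox Su] := AO _ Ac; have [_ Su'] := AO' _ Ac'.
  exact: (quadrant_jump_approx_limit i gi mw mv Ox (vjump _ Ox Hx) Su Su').
(* The singular part depends on c, so countability is applied to the fixed measures [Ds], [s] and
   [tau] that compose it: for each c one of them charges [A c] inside H. *)
have : countable B.
  pose S (nu : charge_rV) := [set c | B c /\ nu (A c `&` H) != 0%E].
  have cS nu : countable (S nu) by exact: charge_countable.
  apply: (@sub_countable _ _ _ (\bigcup_(p : 'I_d * 'I_N)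
    (S (Ds p.1 p.2) `|` S (s p.1 p.2) `|` S (tau p.2)))); last first.
    apply: bigcup_countable; first exact: countableP.
    by move=> p _; apply: countable_setU => //; exact: countable_setU.
  apply: subset_card_le => c Bc; have [mAc /(_ Bc)[AO [i [j]]]] := AP c.
  rewrite off// => D0; exists (i, j) => //=.
  have [Ds0|?] := eqVneq (Ds i j (A c `&` H)) 0%E; last by left; left.
  have [s0|?] := eqVneq (s i j (A c `&` H)) 0%E; last by left; right.
  have [t0|?] := eqVneq (tau j (A c `&` H)) 0%E; last by right.
  exfalso; apply: D0; apply: (@eq_trans _ _ (0 + (0 + c%:E * 0))%E).
    by congr (_ + (_ + _ * _))%E.
  by rewrite mule0 !adde0.
move=> /countable_lebesgue_measure0.
rewrite (_ : B = `]0, c0]%classic).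
  rewrite lebesgue_measure_itv/= lte_fin c00 sube0 => -[] c0E.
  by move: c00; rewrite c0E ltxx.
by apply/seteqP; split => x; rewrite /= in_itv.
Qed.

End jump_perturbation.

(** * The approximating sequence *)

Section approximation_step.
Variables (R : realType) (N d : nat) (Omega : set 'rV[R]_N).
Hypotheses (Omega_open : open Omega) (Omega_bounded : bounded_set Omega).
Local Notation V := 'rV[R]_N.
Local Notation leb := (lebesgue_rV R N).
Local Notation L1norm := (L1norm Omega).
Implicit Types (x y : V) (i : 'I_d) (j l : 'I_N) (T : seq ('I_N * R)).

Let mOmega : measurable Omega. Proof. exact: open_measurable_mx. Qed.

Lemma L1norm_sum_le (I : finType) (f : I -> V -> R) e :
  (forall k, leb.-integrable Omega (EFin \o f k)) -> (forall k, L1norm (f k) <= e) ->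
  L1norm (fun x => \sum_k f k x) <= #|I|%:R * e.
Proof.
move=> fi fe; have : forall s : seq I,
    L1norm (fun x => \sum_(k <- s) f k x) <= (size s)%:R * e.
  elim=> [|k s IHs].
    rewrite mul0r (@eq_L1norm _ _ _ _ (cst 0)); last by move=> x _; rewrite big_nil.
    by rewrite /L1norm; under eq_Rintegral do rewrite normr0; rewrite Rintegral_cst// mul0r.
  rewrite (@eq_L1norm _ _ _ _ (fun x => f k x + \sum_(k <- s) f k x)); last first.
    by move=> x _; rewrite big_cons.
  apply: (le_trans (L1normD Omega_open (fi k) (integrableR_sum mOmega _ fi))).
  by rewrite /= -natr1 mulrDl mul1r addrC lerD.
move=> /(_ (enum I)); rewrite -cardE; apply: le_trans.
by rewrite le_eqVlt; apply/orP; left; apply/eqP/eq_L1norm => x _; rewrite big_enum.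
Qed.

Lemma SBV_approximation (g : V -> 'cV[R]_d) (H : V -> 'M[R]_(d, N)) e :
  SBV Omega g -> L1 Omega H -> 0 < e ->
  exists u G, [/\ SBV Omega u, ac_density Omega u G,
    forall i, L1norm (fun x => u x i 0 - g x i 0) <= e &
    forall i j, L1norm (fun x => G x i j - H x i j) <= e].
Proof.
move=> gSBV Hi e0; have [_ [Du [Gg [Ds [gDu DuE DsC]]]]] := gSBV.
have [Gi _ _] := DuE.
pose f i j x := H x i j - Gg x i j.
have fi i j : leb.-integrable Omega (EFin \o f i j).
  exact: (integrableRB mOmega (Hi i j) (Gi i j)).
(* A row sums N pieces, one per column, each with error e', hence at most e / 2; the other half is
   left for c v. The gradient of v is 0, so it adds no error there. *)
pose e' := e / 2 / N.+1%:R.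
have e'0 : 0 < e' by rewrite !divr_gt0// ltr0n.
have Ne' : N%:R * e' <= e / 2.
  rewrite mulrCA ler_piMr//; first by rewrite ltW// divr_gt0.
  by rewrite ler_pdivrMr ?ltr0n// mul1r ler_nat.
have /choice[P PP] : forall q : 'I_d * 'I_N, exists P : seq ('I_N * R) * (V -> R) *
    ('I_N -> V -> R), [/\ piecewise Omega P.1.1 P.1.2 P.2, L1norm P.1.2 <= e' &
    forall l, L1norm (fun x => P.2 l x - f q.1 q.2 x *+ (l == q.2)) <= e'].
  move=> [i j]; have [T [w [F TwF]]] :=
    gradient_dense Omega_open Omega_bounded j (fi i j) e'0.
  by exists (T, w, F).
(* One jump function for the hyperplanes of all entries: a single c then serves every row. *)
have [T' [v [TT' vP vj]]] := jump_function Omega_open Omega_bounded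
  (flatten [seq (P q).1.1 | q <- enum {: 'I_d * 'I_N}]).
pose w i x := \sum_j (P (i, j)).1.2 x.
pose F i l x := \sum_j (P (i, j)).2 l x.
have PT i j : piecewise Omega T' (P (i, j)).1.2 (P (i, j)).2.
  have [[s sP] _ _] := PP (i, j); exists s.
  apply: piecewise_C1_mono sP => q qP; apply: TT'.
  by apply/flattenP; exists (P (i, j)).1.1 => //; apply: map_f; rewrite mem_enum.
have wF i : piecewise Omega T' (w i) (F i).
  by apply: piecewise_sum => // j _; exact: PT.
have wi i := (piecewise_integrable (wF i)).1.
have Fi i := (piecewise_integrable (wF i)).2.
have vi := (piecewise_integrable vP).1.
have v0 : 0 < L1norm v + 1 by rewrite ltr_wpDl// L1norm_ge0.
have c00 : 0 < e / 2 / (L1norm v + 1) by rewrite !divr_gt0.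
have [|c [/andP[c0 cc0] uSBV uG]] := jump_perturbation Omega_open Omega_bounded gSBV wF vP vj c00
  (Gg := Gg); first by exists Du, Ds.
exists (perturb g (fun i y => w i y + c * v y)),
  (fun x => \matrix_(i, j) (Gg x i j + F i j x)); split => //.
- move=> i; rewrite (@eq_L1norm _ _ _ _ (fun x => w i x + c * v x)); last first.
    by move=> x _; rewrite mxE; lra.
  apply: (le_trans (L1normD Omega_open (wi i) (integrableRZ mOmega c vi))).
  rewrite L1normZ// gtr0_norm// [leRHS](splitr e) lerD//.
    apply: le_trans Ne'; rewrite -[in leRHS](card_ord N).
    apply: L1norm_sum_le => j; last by case: (PP (i, j)).
    exact: (piecewise_integrable (PT i j)).1.
  apply: (@le_trans _ _ (c * (L1norm v + 1))).
    by rewrite ler_pM2l// lerDl.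
  by rewrite -ler_pdivlMr.
- move=> i l; rewrite (@eq_L1norm _ _ _ _ (fun x =>
    \sum_j ((P (i, j)).2 l x - f i j x *+ (l == j)))); last first.
    move=> x _; rewrite mxE sumrB (_ : \sum_j f i j x *+ (l == j) = f i l x).
      by rewrite /f /F; lra.
    by rewrite (bigD1 l)//= eqxx big1 ?addr0// => j /negbTE jl; rewrite eq_sym jl.
  apply: (le_trans (@L1norm_sum_le _ _ e' _ _)).
  + move=> j; apply: integrableRB => //; first exact: (piecewise_integrable (PT i j)).2.
    exact: integrable_mulrb.
  + by move=> j; have [_ _] := PP (i, j); exact.
  + rewrite card_ord; apply: le_trans Ne' _.
    by rewrite ler_pdivrMr// ler_peMr// ?ler1n// ltW.
Qed.

End approximation_step.

Section iterated_approximation.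
Variables (R : realType) (N d : nat) (Omega : set 'rV[R]_N).
Hypotheses (Omega_open : open Omega) (Omega_bounded : bounded_set Omega).
Local Notation V := 'rV[R]_N.
Local Notation leb := (lebesgue_rV R N).
Local Notation L1norm := (L1norm Omega).

Let mOmega : measurable Omega. Proof. exact: open_measurable_mx. Qed.

Lemma L1_cvg_le (u : nat -> V -> 'cV[R]_d) (g : V -> 'cV[R]_d) :
  (forall n, L1 Omega (u n)) -> L1 Omega g ->
  (forall n i, L1norm (fun x => u n x i 0 - g x i 0) <= n.+1%:R^-1) ->
  L1_cvg Omega u g.
Proof.
move=> ui gi ug; split => //.
have ugi n i : leb.-integrable Omega (EFin \o (fun x => u n x i 0 - g x i 0)).
  exact: (integrableRB mOmega (ui n i 0) (gi i 0)).
have nugi n i : leb.-integrable Omega (EFin \o (fun x => `|u n x i 0 - g x i 0|)).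
  exact: integrable_norm (ugi n i).
apply/cvge0_leP => [n|e e0].
  by apply: integral_ge0 => x _; rewrite lee_fin enorm_ge0.
near=> n.
apply: (@le_trans _ _ (\int[leb]_(x in Omega) (\sum_i `|u n x i 0 - g x i 0|)%:E)%E).
  apply: ge0_le_integral => //.
  - by move=> x _; rewrite lee_fin enorm_ge0.
  - apply/measurable_EFinP; apply: enorm_measurable => i k; rewrite (ord1 k).
    rewrite (_ : (fun x => _) = fun x => u n x i 0 - g x i 0).
      by have /integrableP[/measurable_EFinP] := ugi n i.
    by apply/funext => x; rewrite !mxE.
  - apply/measurable_EFinP; apply: measurable_sum => i.
    by have /integrableP[/measurable_EFinP] := nugi n i.
  - move=> x _; rewrite lee_fin (le_trans (enorm_le_sum _))//.
    by apply: ler_sum => i _; rewrite big_ord1 !mxE.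
have si := integrableR_sum mOmega (index_enum 'I_d) (nugi n).
rewrite -(fineK (integrable_fin_num mOmega si)) lee_fin.
apply: (@le_trans _ _ (L1norm (fun x => \sum_i `|u n x i 0 - g x i 0|))).
  by apply: le_Rintegral => //; [exact: integrable_norm|move=> x _; exact: ler_norm].
apply: (le_trans (@L1norm_sum_le _ _ _ Omega_open _ _ n.+1%:R^-1 (nugi n) _)).
  move=> i; apply: le_trans (ug n i); rewrite le_eqVlt; apply/orP; left; apply/eqP.
  by apply: eq_Rintegral => x _; rewrite normr_id.
(* Passing from d to d + 1 allows a division even when d = 0. *)
rewrite card_ord; apply: (@le_trans _ _ (d.+1%:R * n.+1%:R^-1)).
  by rewrite ler_wpM2r// ler_nat.
rewrite -ler_pdivlMl ?ltr0n//.
near: n; have de0 : 0 < d.+1%:R^-1 * e by rewrite mulr_gt0// invr_gt0.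
have := near_infty_natSinv_lt (PosNum de0).
by apply: filterS => n /= /ltW.
Unshelve. all: by end_near. Qed.

(** Each entry is at most 1 + |F|^p, and constants are integrable on a bounded set. *)
Lemma Lp_L1 (p : R) m n (F : V -> 'M[R]_(m, n)) : 1 <= p ->
  Lp Omega p F -> L1 Omega F.
Proof.
move=> p1 [mF Fp] i j.
have menorm : measurable_fun Omega (fun x => enorm (F x)) by exact: enorm_measurable.
have Fpi : leb.-integrable Omega (EFin \o (fun x => enorm (F x) `^ p)).
  apply/integrableP; split.
    apply/measurable_EFinP; exact: (measurableT_comp (measurable_powR _)).
  apply: le_lt_trans Fp; rewrite le_eqVlt; apply/orP; left; apply/eqP.
  by apply: eq_integral => x _; rewrite /= ger0_norm// powR_ge0.
have i1 : leb.-integrable Omega (EFin \o cst 1).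
  exact: (bounded_measurable_integrable mOmega (Omega_lty Omega_open Omega_bounded)
    (bounded_measurable_cst _ 1)).
apply: le_integrable (integrableRD mOmega i1 Fpi) => //.
  exact/measurable_EFinP.
move=> x _; rewrite /= lee_fin (le_trans (entry_le_enorm _ _ _))//.
rewrite ger0_norm; last by rewrite addr_ge0// powR_ge0.
have [e1|e1] := leP (enorm (F x)) 1; first by rewrite ler_wpDr// powR_ge0.
rewrite ler_wpDl//; rewrite -[leLHS]powRr1 ?enorm_ge0//.
by rewrite ler_powR// ltW.
Qed.

Section iteration.
Variables (H : nat -> V -> 'M[R]_(d, N))
  (S : nat -> (V -> 'cV[R]_d) -> nat -> (V -> 'cV[R]_d)).
Hypotheses (Hi : forall k, L1 Omega (H k))
  (SP : forall k g n, SBV Omega g -> exists G, [/\ SBV Omega (S k g n),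
    ac_density Omega (S k g n) G,
    forall i, L1norm (fun x => S k g n x i 0 - g x i 0) <= n.+1%:R^-1 &
    forall i j, L1norm (fun x => G x i j - H k x i j) <= n.+1%:R^-1]).

(** The counter k is the rank of the target used by the next step: a list of length m read from k
    uses the targets [H k], ..., [H (k + m - 1)], its head being the outermost index. *)
Fixpoint iterate k g (s : seq nat) :=
  if s is n :: s' then iterate k.+1 (S k g n) s' else g.

Lemma iterate_cat k g s t :
  iterate k g (s ++ t) = iterate (k + size s) (iterate k g s) t.
Proof.
elim: s k g => [|n s IHs] k g /=; first by rewrite addn0.
by rewrite IHs addSnnS.
Qed.

Lemma iterate_SBV k g s : SBV Omega g -> SBV Omega (iterate k g s).
Proof.
elim: s k g => [|n s IHs] k g gSBV; [exact: gSBV|apply: IHs].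
by have [G []] := SP k n gSBV.
Qed.

(** Each step stays within 1 / (n + 1) of its input, so the inner limits undo the later steps: once
    n_1 is fixed, they lead back to [S k g n_1]. *)
Lemma iterate_L1_cvg m k g : SBV Omega g ->
  iter_lim (@L1_cvg R N Omega d 1) m (iterate k g) g.
Proof.
elim: m k g => [|m IHm] k g gSBV; first reflexivity.
exists (S k g); split; last first.
  by move=> n; apply: IHm; have [G []] := SP k n gSBV.
apply: L1_cvg_le => [n||n i].
- by have [G [[[]]]] := SP k n gSBV.
- by case: gSBV => -[].
- by have [G [_ _]] := SP k n gSBV.
Qed.

(** The innermost limit gives [H (k + m)] whatever the outer indices, since a step aims at its
    target from any starting function. *)
Lemma iterate_weakstar_cvg m k g : SBV Omega g ->
  iter_lim (@weakstar_cvg R N Omega d N) m.+1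
    (fun s => mxmeasure_of_fun Omega (nabla Omega (iterate k g s)))
    (mxmeasure_of_fun Omega (H (k + m))).
Proof.
elim: m k g => [|m IHm] k g gSBV.
  exists (fun n => mxmeasure_of_fun Omega (nabla Omega (S k g n))).
  split; last by move=> n; reflexivity.
  have /choice[G GP] := fun n => SP k n gSBV; rewrite addn0.
  apply: (weakstar_cvg_nabla Omega_open Omega_bounded (G := G)).
  - by move=> n; have [] := GP n.
  - exact: Hi.
  - by move=> n i j; have [_ _ _] := GP n.
exists (fun=> mxmeasure_of_fun Omega (H (k + m.+1))); split.
  by move=> phi _ i j; exact: cvg_cst.
move=> n; rewrite -addSnnS; apply: IHm; by have [G []] := SP k n gSBV.
Qed.

End iteration.

End iterated_approximation.

Theorem theorem2p6 (R : realType) (N d L : nat) (p : R) (Omega : set 'rV[R]_N)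
    (Omega_open : open Omega) (Omega_connected : connected Omega)
    (Omega_bounded : bounded_set Omega)
    (Omega_lipschitz : lipschitz_boundary Omega)
    (p_ge1 : 1 <= p) (L_gt0 : (0 < L)%N)
    (g : 'rV[R]_N -> 'cV[R]_d) (G : 'I_L -> 'rV[R]_N -> 'M[R]_(d, N))
    (gG : SD Omega p g G) :
  exists u : seq nat -> 'rV[R]_N -> 'cV[R]_d,
    (forall s, size s = L -> SBV Omega (u s)) /\ SD_cvg Omega u g G.
Proof.
have [gSBV G1 Gp] := gG.
(* Extending G by 0 beyond L lets the iteration be indexed by all natural numbers. *)
pose H k : 'rV[R]_N -> 'M[R]_(d, N) := oapp G (fun=> 0) (insub k : option 'I_L).
have HG (l : 'I_L) : H l = G l by rewrite /H valK.
have Hi k : L1 Omega (H k).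
  rewrite /H; case: insubP => [l _ _|_] /=; last first.
    by move=> i j; under eq_fun do rewrite mxE; exact: integrable0.
  have [lL|] := ltnP l.+1 L; first exact: G1.
  move=> Ll; apply: (Lp_L1 Omega_open Omega_bounded p_ge1); apply: Gp.
  by apply/eqP; rewrite eqn_leq Ll ltn_ord.
(* Stated as an implication so that choice yields a total step function, with an arbitrary value
   when [g'] is not in SBV. *)
pose good k g' n u := SBV Omega g' -> exists G', [/\ SBV Omega u,
  ac_density Omega u G',
  forall i, L1norm Omega (fun x => u x i 0 - g' x i 0) <= n.+1%:R^-1 &
  forall i j, L1norm Omega (fun x => G' x i j - H k x i j) <= n.+1%:R^-1].
have /choice[S0 S0P] : forall q : nat * ('rV[R]_N -> 'cV[R]_d) * nat,
    exists u, good q.1.1 q.1.2 q.2 u.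
  move=> [[k g'] n]; have [g'SBV|g'N] := pselect (SBV Omega g'); last by exists g'.
  have n0 : 0 < n.+1%:R^-1 :> R by rewrite invr_gt0.
  have [u [G' uG']] := SBV_approximation Omega_open Omega_bounded g'SBV (Hi k) n0.
  by exists u => _; exists G'.
pose S k g' n := S0 (k, g', n).
have SP k g' n : good k g' n (S k g' n) by exact: (S0P (k, g', n)).
pose u := iterate S 0 g.
have uSBV s : SBV Omega (u s) by exact: (iterate_SBV SP).
exists u; split; first by move=> s _; exact: uSBV.
split.
- exact: (iterate_L1_cvg Omega_open SP).
(* The iteration accepts lists of every length, so u itself on lists of length l + 1 is the
   intermediate sequence. *)
- move=> l lL; exists u; split.
  + by move=> s _; exact: uSBV.
  + move=> s sl.
    rewrite (_ : (fun t => u (s ++ t)) = iterate S (size s) (u s)); last first.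
      by apply/funext => t; rewrite /u iterate_cat.
    apply: (iterate_L1_cvg Omega_open SP); exact: uSBV.
  + rewrite -HG -[X in H X]add0n.
    exact: (iterate_weakstar_cvg Omega_open Omega_bounded Hi SP).
- move=> l lL; rewrite -HG -[X in H X]add0n -[X in iter_lim _ X]lL.
  exact: (iterate_weakstar_cvg Omega_open Omega_bounded Hi SP).
Qed.
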